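(* Let $E\to M$ be a vector bundle. The automorphism group $\mathrm{Aut}(\mathcal E)$ of the omni-Lie algebroid $\mathcal E=\mathfrak DE\oplus\mathfrak JE$ is the semidirect product of $\mathrm{Aut}(E)$ and the abelian group $\Gamma(\mathrm{Hom}(TM,E))$: $$\mathrm{Aut}(\mathcal E)\cong\mathrm{Aut}(E)\ltimes\Gamma(\mathrm{Hom}(TM,E)),$$ where the action of $\mathrm{Aut}(E)$ on $\Gamma(\mathrm{Hom}(TM,E))$ is $\Phi\cdot\eta=\Phi\circ\eta\circ\phi_*^{-1}$, $\phi_*$ being the tangent map of the diffeomorphism $\phi:M\to M$ covered by $\Phi$.
   Context: **Bundles.** $\mathfrak DE$ is the gauge Lie algebroid of $E$: its sections are the $\mathbb R$-linear $\mathfrak d:\Gamma(E)\to\Gamma(E)$ for which there is a vector field $j(\mathfrak d)$ with $\mathfrak d(fu)=f\mathfrak d(u)+j(\mathfrak d)(f)u$; bracket $[\cdot,\cdot]_{\mathfrak D}$ = commutator, anchor $j$. The first jet bundle $\mathfrak JE$ is regarded as $\{\nu\in\mathrm{Hom}(\mathfrak DE,E):\nu(\Psi)=\Psi(\nu(\mathrm{Id}_E))\ \forall\Psi\in\mathfrak{gl}(E)\}$, the jet $[u]_m$ corresponding to $\mathfrak d\mapsto\mathfrak d(u)(m)$. Write $\langle\mu,\mathfrak d\rangle_E=\langle\mathfrak d,\mu\rangle_E=\mu(\mathfrak d)$, and $\mathbf d:\Gamma(E)\to\Gamma(\mathfrak JE)$, $(\mathbf du)(\mathfrak d)=\mathfrak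 d(u)$. The Lie derivative on $\Gamma(\mathfrak JE)$ is $\langle\mathcal L_{\mathfrak d}\mu,\mathfrak d'\rangle_E=\mathfrak d\langle\mu,\mathfrak d'\rangle_E-\langle\mu,[\mathfrak d,\mathfrak d']_{\mathfrak D}\rangle_E$. **Omni-Lie algebroid.** $\mathcal E=\mathfrak DE\oplus\mathfrak JE$ with anchor $\rho$ the projection to $\mathfrak DE$, pairing $(\mathfrak d+\mu,\mathfrak r+\nu)_E=\tfrac12(\langle\mathfrak d,\nu\rangle_E+\langle\mathfrak r,\mu\rangle_E)$ and bracket $\{\mathfrak d+\mu,\mathfrak r+\nu\}=[\mathfrak d,\mathfrak r]_{\mathfrak D}+\mathcal L_{\mathfrak d}\nu-\mathcal L_{\mathfrak r}\mu+\mathbf d\langle\mu,\mathfrak r\rangle_E$. **Automorphisms.** $\mathrm{Aut}(E)$ is the group of vector bundle automorphisms $\Phi:E\to E$ covering arbitrary diffeomorphisms $\phi:M\to M$; $\Phi$ acts on sections by $\Phi(u)=\Phi\circ u\circ\phi^{-1}$ and $\mathrm{Ad}_\Phi(\mathfrak d)(u)=\Phi\circ\mathfrak d\circ\Phi^{-1}(u)$. $\mathrm{Aut}(\mathcal E)$ is the group of pairs $(F,\Phi)$, $F:\mathcal E\to\mathcal E$ a bundle automorphism covering a bundle automorphism $\Phi$ of $E$, with $(F(X),F(Y))_E=\Phi(X,Y)_E$, $F\{X,Y\}=\{F(X),F(Y)\}$ and $\rho\circ F=\mathrm{Ad}_\Phi\circ\rho$. *)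

(* Defs.v *)
From HB Require Import structures.
From mathcomp Require Import all_boot all_order all_algebra.
From mathcomp Require Import boolp classical_sets functions reals.
From mathcomp Require Import interval_inference topology.
From mathcomp Require Import normedtype landau derive ring.
Set Implicit Arguments. Unset Strict Implicit. Unset Printing Implicit Defensive.
Import Order.TTheory GRing.Theory Num.Theory.
Import numFieldNormedType.Exports.
Local Open Scope classical_set_scope.
Local Open Scope ring_scope.

Section Smooth.
Variable R : realType.

(* Only meaningful for U open, which is how it is used throughout. *)
Fixpoint Ck (n k : nat) (U : set 'rV[R]_n) (f : 'rV[R]_n -> R) : Prop :=
  if k is k'.+1 then
    (forall x, U x -> differentiable f x) /\
    forall i, Ck k' U ('D_(delta_mx ord0 i) f)
  else forall x, U x -> {for x, continuous f}.

Definition Cinf (n : nat) (U : set 'rV[R]_n) (f : 'rV[R]_n -> R) : Prop :=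
  forall k, Ck k U f.

Lemma near_eq_differentiable (V W : normedModType R) (f g : V -> W) (x : V) :
  (\near x, f x = g x) -> differentiable f x -> differentiable g x.
Proof.
move=> fg df; have -> : g = f + (g - f) by rewrite addrC subrK.
apply: differentiableD => //.
have h0 : \near x, (g - f) x = 0.
  by near=> y; rewrite /= /GRing.add /= /GRing.opp/=; apply/eqP;
     rewrite subr_eq0 eq_sym; apply/eqP; near: y.
have hx : (g - f) x = 0 by exact: nbhs_singleton h0.
have hz : (g - f) \o shift x =
    cst ((g - f) x) + (\0 : {linear V -> W}) +o_ 0 id.
  apply/eqaddoP => e e0.
  have : \forall y \near (0:V), (g - f) (y + x) = 0.
    by move: h0; rewrite (near_shift 0 x) /= subr0.
  apply: filterS => y; rewrite /= hx => hy.
  rewrite (_ : (_ - _) y = (g - f) (y + x) - 0 - 0).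
    by rewrite hy !subr0 normr0 mulr_ge0 // ltW.
  by rewrite -[LHS]/((g - f) (y + x) - (0 + 0)) hy addr0 !subr0.
apply/diff_locallyP.
have -> : 'd (g - f) x = (\0 : {linear V -> W}) :> (V -> W).
  by apply: diff_unique => //; exact: cst_continuous.
by split => //; exact: cst_continuous.
Unshelve. all: by end_near. Qed.

Section Dim.
Variable n : nat.
Implicit Types (U V : set 'rV[R]_n) (f g : 'rV[R]_n -> R).

Lemma Ck_sub k U V f : U `<=` V -> Ck k V f -> Ck k U f.
Proof.
move=> UV; elim: k f => [|k IH] f /= fV.
  by move=> x Ux; exact/fV/UV.
by case: fV => fV fD; split=> [x Ux|i]; [exact/fV/UV|exact/IH/fD].
Qed.

Lemma Ck_loc k U f :
  (forall x, U x -> exists2 V, V x & Ck k V f) -> Ck k U f.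
Proof.
elim: k f => [|k IH] f /= H.
  by move=> x /H[V Vx]; apply.
split=> [x /H[V Vx [+ _]]|i]; first exact.
by apply: IH => x /H[V Vx [_ +]]; exists V.
Qed.

Lemma Ck_ext k U f g : open U -> (forall x, U x -> f x = g x) ->
  Ck k U f -> Ck k U g.
Proof.
move=> oU; elim: k f g => [|k IH] f g fg /= fC.
  move=> x Ux; have /= fc := fC x Ux; rewrite /prop_for /continuous_at -fg//.
  have nfg : {near nbhs x, f =1 g}.
    by have := open_nbhs_nbhs (conj oU Ux); apply: filterS => y /fg.
  exact: cvg_trans (near_eq_cvg nfg) fc.
case: fC => fd fD; have nfg x : U x -> \near x, f x = g x.
  by move=> Ux; have := open_nbhs_nbhs (conj oU Ux); apply: filterS => y /fg.
split=> [x Ux|i]; first exact: near_eq_differentiable (nfg x Ux) (fd x Ux).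
by apply: IH (fD i) => x Ux; apply: near_eq_derive; exact: nfg.
Qed.

Lemma Ck_lower k U f : Ck k.+1 U f -> Ck k U f.
Proof.
elim: k f => [|k IH] f [fd fD].
  by move=> x Ux; apply: differentiable_continuous; exact: fd.
by split=> // i; exact/IH/fD.
Qed.

Lemma Ck_cst k U (a : R) : Ck k U (cst a).
Proof.
elim: k a => [|k IH] a /=; first by move=> x _; exact: cst_continuous.
split=> [x _|i]; first exact: differentiable_cst.
suff -> : 'D_(delta_mx ord0 i) (cst a) = cst 0 :> ('rV[R]_n -> R) by [].
by apply/funext => x; rewrite derive_cst.
Qed.

Lemma CkD k U f g : open U -> Ck k U f -> Ck k U g -> Ck k U (f + g).
Proof.
move=> oU; elim: k f g => [|k IH] f g /= fC gC.
  by move=> x Ux; apply: continuousD; [exact: fC|exact: gC].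
case: fC gC => fd fD [gd gD].
split=> [x Ux|i]; first by apply: differentiableD; [exact: fd|exact: gd].
apply: Ck_ext (IH _ _ (fD i) (gD i)) => // x Ux.
by rewrite deriveD//; apply: diff_derivable; [exact: fd|exact: gd].
Qed.

Lemma CkM k U f g : open U -> Ck k U f -> Ck k U g -> Ck k U (f * g).
Proof.
move=> oU; elim: k f g => [|k IH] f g.
  by move=> fC gC x Ux; apply: continuousM; [exact: fC|exact: gC].
move=> fC gC; have [f' g'] := (Ck_lower fC, Ck_lower gC).
case: fC gC => fd fD [gd gD].
split=> [x Ux|i]; first by apply: differentiableM; [exact: fd|exact: gd].
apply: Ck_ext (CkD oU (IH _ _ f' (gD i)) (IH _ _ g' (fD i))) => // x Ux.
by rewrite deriveM//; apply: diff_derivable; [exact: fd|exact: gd].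
Qed.

Lemma Ck_sum k U (I : Type) (r : seq I) (F : I -> 'rV[R]_n -> R) : open U ->
  (forall i, Ck k U (F i)) -> Ck k U (\sum_(i <- r) F i).
Proof.
move=> oU FC; elim: r => [|i r IH]; first by rewrite big_nil; exact: Ck_cst.
by rewrite big_cons; exact: CkD.
Qed.

End Dim.

Lemma Ck_comp k m n (U : set 'rV[R]_m) (V : set 'rV[R]_n)
    (g : 'rV[R]_m -> 'rV[R]_n) (f : 'rV[R]_n -> R) :
  open U -> (forall x, U x -> V (g x)) ->
  (forall i, Ck k U (fun x => g x ord0 i)) -> Ck k V f -> Ck k U (f \o g).
Proof.
move=> oU gUV.
have gE : g = \sum_i (fun x => g x ord0 i *: delta_mx ord0 i).
  by apply/funext => x; rewrite fct_sumE {1}(row_sum_delta (g x)).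
elim: k f => [|k IH] f gC fC.
  move=> x Ux; apply: continuous_comp; last exact/fC/gUV.
  suff gc : {for x, continuous
      (\sum_i (fun x => g x ord0 i *: delta_mx ord0 i) : _ -> 'rV[R]_n)}.
    exact: (eq_ind _ (fun h : 'rV[R]_m -> 'rV[R]_n => {for x, continuous h})
      gc g (esym gE)).
  elim/big_ind: _ => [|a b ac bc|i _].
  - exact: cst_continuous.
  - exact: continuousD.
  - by apply: continuousZr_tmp; exact: gC.
have gd x : U x -> differentiable g x.
  move=> Ux; rewrite {1}gE; apply: differentiable_sum => i.
  by apply: differentiableZl; exact: (gC i).1.
have fd x : U x -> differentiable f (g x) by move=> Ux; exact/fC.1/gUV.
split=> [x Ux|i]; first by apply: differentiable_comp; [exact: gd|exact: fd].
have gC' j : Ck k U (fun x => g x ord0 j) by exact/Ck_lower/gC.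
have C1 j := IH _ gC' (fC.2 j).
have C2 j := (gC j).2 i.
apply: Ck_ext (Ck_sum (index_enum _) oU (fun j => CkM oU (C2 j) (C1 j))) => //.
move=> x Ux; rewrite fct_sumE deriveE; last exact: differentiable_comp (gd _ _) (fd _ _).
rewrite diff_comp ?[in RHS]/=; [|exact: gd|exact: fd].
rewrite -[in 'd g x _]deriveE; last exact: gd.
rewrite derive_mx; last by apply: diff_derivable; exact: gd.
rewrite [X in 'd f _ X]row_sum_delta linear_sum; apply: eq_bigr => j _.
by rewrite linearZ/= mxE -[X in _ = _ *: X]deriveE; last exact: fd.
Qed.

End Smooth.

Section Subspaces.
Variables (R : pzRingType) (V : lmodType R).

Record subspace := Subspace {
  subspace_pred :> V -> Prop;
  subspace0 : subspace_pred 0;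
  subspaceP : forall (a : R) u v,
    subspace_pred u -> subspace_pred v -> subspace_pred (a *: u + v)
}.

Variable S : subspace.

Definition subspace_mem : pred V := fun v => `[< S v >].

Lemma subspace_mem_closed : submod_closed subspace_mem.
Proof.
split=> [|a u v /asboolP Su /asboolP Sv]; apply/asboolP.
  exact: subspace0.
exact: subspaceP.
Qed.

HB.instance Definition _ :=
  GRing.isSubmodClosed.Build R V subspace_mem subspace_mem_closed.

Record subspace_of := SubspaceOf {
  ssval : V;
  ssvalP_subproof : subspace_mem ssval
}.

HB.instance Definition _ := [isSub for ssval].
HB.instance Definition _ := [Choice of subspace_of by <:].
HB.instance Definition _ := [SubChoice_isSubLmodule of subspace_of by <:].

Lemma ssvalP (x : subspace_of) : S (ssval x).
Proof. exact/asboolP/ssvalP_subproof. Qed.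

Definition mksub (v : V) (Sv : S v) : subspace_of :=
  @SubspaceOf v (asboolT Sv).

Lemma subspace_of_inj : injective ssval. Proof. exact: val_inj. Qed.

Lemma ssvalD x y : ssval (x + y) = ssval x + ssval y. Proof. exact: (raddfD (\val : subspace_of -> V)). Qed.
Lemma ssvalZ a x : ssval (a *: x) = a *: ssval x.
Proof. exact: (linearZ_LR (\val : subspace_of -> V)). Qed.
Lemma ssval0 : ssval 0 = 0. Proof. exact: (raddf0 (\val : subspace_of -> V)). Qed.
Lemma ssvalZD a x y : ssval (a *: x + y) = a *: ssval x + ssval y.
Proof. by rewrite ssvalD ssvalZ. Qed.

Lemma subspaceD u v : S u -> S v -> S (u + v).
Proof. by move=> Su Sv; rewrite -[u]scale1r; exact: subspaceP. Qed.
Lemma subspaceZ a u : S u -> S (a *: u).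
Proof. by move=> Su; rewrite -[_ *: _]addr0; apply: subspaceP => //; exact: subspace0. Qed.
Lemma subspaceB u v : S u -> S v -> S (u - v).
Proof. by move=> Su Sv; rewrite addrC -scaleN1r; exact: subspaceP. Qed.

End Subspaces.
Arguments ssval {R V S}.
Arguments mksub {R V} S v Sv.
Coercion subspace_of : subspace >-> Sortclass.

Section Hom.
Variables (R : comPzRingType) (U V : lmodType R).

Lemma lin_subproof0 : linear (0 : U -> V).
Proof.
move=> a u v; apply/esym; rewrite -[RHS]addr0; congr (_ + _).
exact: scaler0.
Qed.
Lemma lin_subproof (a : R) (f g : U -> V) :
  linear f -> linear g -> linear (a *: f + g).
Proof.
move=> fl gl b u v.
change (a *: f (b *: u + v) + g (b *: u + v) =
  b *: (a *: f u + g u) + (a *: f v + g v)).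
rewrite fl gl !scalerDr !scalerA [b * a]mulrC.
by rewrite addrACA.
Qed.
Lemma linear_at0 (f : U -> V) : linear f -> f 0 = 0.
Proof. by move=> fl; have := fl (-1) 0 0; rewrite scaler0 addr0 scaleN1r addNr. Qed.
Lemma linear_atZ (f : U -> V) a u : linear f -> f (a *: u) = a *: f u.
Proof. by move=> fl; have := fl a u 0; rewrite linear_at0// !addr0. Qed.
Definition Hom : subspace (U -> V) := Subspace lin_subproof0 lin_subproof.

End Hom.

Section Dsec.
Variables (M : Type) (R : pzRingType) (V : M -> lmodType R).

Definition dsec := forall m, V m.

HB.instance Definition _ := Choice.copy dsec (forall m, V m).

Definition dsec_add (u v : dsec) : dsec := fun m => u m + v m.
Definition dsec_opp (u : dsec) : dsec := fun m => - u m.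
Definition dsec_zero : dsec := fun m => 0.
Definition dsec_scale (a : R) (u : dsec) : dsec := fun m => a *: u m.

Fact dsec_addA : associative dsec_add.
Proof. by move=> u v w; apply: functional_extensionality_dep => m; exact: addrA. Qed.
Fact dsec_addC : commutative dsec_add.
Proof. by move=> u v; apply: functional_extensionality_dep => m; exact: addrC. Qed.
Fact dsec_add0 : left_id dsec_zero dsec_add.
Proof. by move=> u; apply: functional_extensionality_dep => m; exact: add0r. Qed.
Fact dsec_addN : left_inverse dsec_zero dsec_opp dsec_add.
Proof. by move=> u; apply: functional_extensionality_dep => m; exact: addNr. Qed.

HB.instance Definition _ :=
  GRing.isZmodule.Build dsec dsec_addA dsec_addC dsec_add0 dsec_addN.

Fact dsec_scaleA a b u : dsec_scale a (dsec_scale b u) = dsec_scale (a * b) u.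
Proof. by apply: functional_extensionality_dep => m; exact: scalerA. Qed.
Fact dsec_scale1 : left_id 1 dsec_scale.
Proof. by move=> u; apply: functional_extensionality_dep => m; exact: scale1r. Qed.
Fact dsec_scaleDr : right_distributive dsec_scale +%R.
Proof. by move=> a u v; apply: functional_extensionality_dep => m; exact: scalerDr. Qed.
Fact dsec_scaleDl u : {morph dsec_scale^~ u : a b / a + b}.
Proof. by move=> a b; apply: functional_extensionality_dep => m; exact: scalerDl. Qed.

HB.instance Definition _ := GRing.Zmodule_isLmodule.Build R dsec
  dsec_scaleA dsec_scale1 dsec_scaleDr dsec_scaleDl.

End Dsec.

(* Fibrewise linear maps of the total space {m : M & V m}, covering a map of
   the base; smoothness is imposed later. *)
Section FibrewiseMaps.
Variables (M : Type) (R : pzRingType) (V : M -> lmodType R).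

Record fibmap := Fibmap {
  fbase : M -> M;
  ffib : forall m, V m -> V (fbase m);
  ffib_linear : forall m, linear (@ffib m)
}.

Definition ftot (f : fibmap) (e : {m : M & V m}) : {m : M & V m} :=
  existT V (fbase f (projT1 e)) (ffib f (projT2 e)).

Lemma existT_snd_inj m (x y : V m) : existT V m x = existT V m y -> x = y.
Proof.
have H (p q : {m : M & V m}) (e : p = q) :
    eq_rect _ V (projT2 p) _ (congr1 (@projT1 _ _) e) = projT2 q.
  by case: _ / e.
move=> e; have := H _ _ e.
by move: (congr1 _ e) => /= p; rewrite (Prop_irrelevance p erefl).
Qed.

Lemma fibmap_ext (f g : fibmap) : ftot f =1 ftot g -> f = g.
Proof.
case: f g => [f F Fl] [g G Gl] fg.
have efg : f = g.
  by apply/funext => m; exact: (congr1 (fun p : {m : M & V m} => projT1 p) (fg (existT V m 0))).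
subst g; have eFG : F = G.
  apply: functional_extensionality_dep => m; apply/funext => v.
  have := fg (existT V m v); rewrite /ftot /= => e.
  exact: existT_snd_inj e.
by subst G; congr Fibmap; exact: Prop_irrelevance.
Qed.

Fact fibmap_id_linear m : linear (@id (V m)). Proof. by []. Qed.
Definition fibmap_id : fibmap := Fibmap fibmap_id_linear.

Fact fibmap_comp_linear (f g : fibmap) m :
  linear (fun v : V m => ffib f (ffib g v)).
Proof. by move=> a u v; rewrite !ffib_linear. Qed.
Definition fibmap_comp (f g : fibmap) : fibmap := Fibmap (fibmap_comp_linear f g).

Lemma ftot_comp f g : ftot (fibmap_comp f g) = ftot f \o ftot g.
Proof. by []. Qed.

(* f restricted to the fibre over m, landing in the fibre over a point m'
   propositionally equal to fbase f m: this avoids casts in statements. *)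
Definition fat (f : fibmap) m m' (e : fbase f m = m') (v : V m) : V m' :=
  eq_rect _ V (ffib f v) _ e.

Lemma fat_tot f m m' (e : fbase f m = m') v :
  existT V m' (fat e v) = ftot f (existT V m v).
Proof. by case: _ / e. Qed.

Lemma fat_linear f m m' (e : fbase f m = m') : linear (fat e).
Proof. by case: _ / e => a u v; exact: ffib_linear. Qed.

Record fibaut := Fibaut {
  fibaut_map :> fibmap;
  fibaut_inv_map : fibmap;
  fibaut_mapK : cancel (ftot fibaut_map) (ftot fibaut_inv_map);
  fibaut_inv_mapK : cancel (ftot fibaut_inv_map) (ftot fibaut_map)
}.

HB.instance Definition _ := gen_eqMixin fibaut.
HB.instance Definition _ := gen_choiceMixin fibaut.

Lemma fibaut_ext (f g : fibaut) : ftot f =1 ftot g -> f = g.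
Proof.
case: f g => [f f' fK f'K] [g g' gK g'K] /= /fibmap_ext fg; subst g.
have fg' : f' = g'.
  by apply: fibmap_ext => e; rewrite -[in LHS](g'K e) fK.
by subst g'; congr Fibaut; exact: Prop_irrelevance.
Qed.

Fact fibmap_idK : cancel (ftot fibmap_id) (ftot fibmap_id).
Proof. by case. Qed.
Definition fibaut_one : fibaut := Fibaut fibmap_idK fibmap_idK.

Definition fibaut_inv (f : fibaut) : fibaut := Fibaut (@fibaut_inv_mapK f) (@fibaut_mapK f).

Fact fibaut_mulK (f g : fibaut) :
  cancel (ftot (fibmap_comp f g))
    (ftot (fibmap_comp (fibaut_inv_map g) (fibaut_inv_map f))).
Proof. by move=> e; rewrite !ftot_comp /= !fibaut_mapK. Qed.
Fact fibaut_inv_mulK (f g : fibaut) :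
  cancel (ftot (fibmap_comp (fibaut_inv_map g) (fibaut_inv_map f)))
    (ftot (fibmap_comp f g)).
Proof. by move=> e; rewrite !ftot_comp /= !fibaut_inv_mapK. Qed.
Definition fibaut_mul (f g : fibaut) : fibaut :=
  Fibaut (@fibaut_mulK f g) (@fibaut_inv_mulK f g).

Fact fibaut_mulA : associative fibaut_mul.
Proof. by move=> f g h; exact: fibaut_ext. Qed.
Fact fibaut_mul1 : left_id fibaut_one fibaut_mul.
Proof. by move=> f; apply: fibaut_ext => -[]. Qed.
Fact fibaut_mulr1 : right_id fibaut_one fibaut_mul.
Proof. by move=> f; apply: fibaut_ext => -[]. Qed.
Fact fibaut_mulV : left_inverse fibaut_one fibaut_inv fibaut_mul.
Proof. by move=> f; apply: fibaut_ext => e; rewrite ftot_comp /= fibaut_mapK; case: e. Qed.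
Fact fibaut_mulrV : right_inverse fibaut_one fibaut_inv fibaut_mul.
Proof. by move=> f; apply: fibaut_ext => e; rewrite ftot_comp /= fibaut_inv_mapK; case: e. Qed.

HB.instance Definition _ := isGroup.Build fibaut
  fibaut_mulA fibaut_mul1 fibaut_mulr1 fibaut_mulV fibaut_mulrV.

Lemma fautK (f : fibaut) : cancel (ftot f) (ftot (f^-1)%g). Proof. exact: fibaut_mapK. Qed.
Lemma fautVK (f : fibaut) : cancel (ftot (f^-1)%g) (ftot f). Proof. exact: fibaut_inv_mapK. Qed.

Lemma fbaseK (f : fibaut) : cancel (fbase f) (fbase (f^-1)%g).
Proof. by move=> m; exact: (congr1 (fun p : {m : M & V m} => projT1 p) (fautK f (existT V m 0))). Qed.
Lemma fbaseVK (f : fibaut) : cancel (fbase (f^-1)%g) (fbase f).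
Proof. by move=> m; exact: (congr1 (fun p : {m : M & V m} => projT1 p) (fautVK f (existT V m 0))). Qed.

(* f o u o phi^-1, for f covering phi. *)
Definition push (f : fibaut) (u : dsec V) : dsec V :=
  fun m => fat (fbaseVK f m) (u (fbase (f^-1)%g m)).

Lemma push_linear f : linear (push f).
Proof.
by move=> a u v; apply: functional_extensionality_dep => m; exact: fat_linear.
Qed.

Lemma push_at (f : fibaut) (u : dsec V) m m' (e : fbase f m = m') :
  push f u m' = fat e (u m).
Proof.
apply: existT_snd_inj; rewrite !fat_tot; congr ftot.
by have -> : fbase (f^-1)%g m' = m by rewrite -e fbaseK.
Qed.

Lemma push1 u : push 1%g u = u.
Proof.
apply: functional_extensionality_dep => m; apply: existT_snd_inj.
by rewrite fat_tot.
Qed.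

Lemma pushM f g u : push (f * g)%g u = push f (push g u).
Proof.
apply: functional_extensionality_dep => m; apply: existT_snd_inj.
by rewrite !fat_tot.
Qed.

Lemma pushK f u : push (f^-1)%g (push f u) = u.
Proof. by rewrite -pushM mulVg push1. Qed.
Lemma pushVK f u : push f (push (f^-1)%g u) = u.
Proof. by rewrite -pushM mulgV push1. Qed.

Lemma fat_comp (f g : fibaut) m m' m'' (e : fbase g m = m') (e' : fbase f m' = m'')
  (e'' : fbase (f * g)%g m = m'') v : fat e'' v = fat e' (fat e v).
Proof. by apply: existT_snd_inj; rewrite !fat_tot. Qed.

Lemma fatK (f : fibaut) m m' (e : fbase f m = m') (e' : fbase (f^-1)%g m' = m) v :
  fat e' (fat e v) = v.
Proof. by apply: existT_snd_inj; rewrite !fat_tot fautK. Qed.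

End FibrewiseMaps.

Section Manifolds.
Variable R : realType.

Record chart (n : nat) (M : topologicalType) := Chart {
  cdom : set M;
  cmap : M -> 'rV[R]_n;
  cinv : 'rV[R]_n -> M;
  cdom_open : open cdom;
  cimg_open : open (cmap @` cdom);
  cmapK : forall p, cdom p -> cinv (cmap p) = p;
  cmap_cont : forall p, cdom p -> {for p, continuous cmap};
  cinv_cont : forall p, cdom p -> {for cmap p, continuous cinv}
}.

Record manifold (n : nat) := Manifold {
  mpoint :> topologicalType;
  mhausdorff : hausdorff_space mpoint;
  msecond_countable : @second_countable mpoint;
  atlas : set (chart n mpoint);
  atlas_cover : forall p, exists2 c, atlas c & cdom c p;
  atlas_compat : forall c c', atlas c -> atlas c' ->
    forall i, Cinf (cmap c @` (cdom c `&` cdom c'))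
                   (fun x => cmap c' (cinv c x) ord0 i)
}.

Section OneManifold.
Variables (n : nat) (M : manifold n).
Implicit Types (U V : set M) (f g : M -> R).

Definition smooth_on U f : Prop :=
  forall c, atlas c -> Cinf (cmap c @` (cdom c `&` U)) (f \o cinv c).

Definition smooth_map (phi : M -> M) : Prop :=
  continuous phi /\
  forall c c', atlas c -> atlas c' ->
  forall i, Cinf (cmap c @` (cdom c `&` phi @^-1` cdom c'))
                 (fun x => cmap c' (phi (cinv c x)) ord0 i).

Lemma chart_open (c : chart n M) U : open U -> open (cmap c @` (cdom c `&` U)).
Proof.
move=> oU; rewrite openE => _ [p [cp Up] <-].
have : nbhs (cmap c p) (cmap c @` cdom c).
  by apply: open_nbhs_nbhs; split; [exact: cimg_open|exists p].
have : nbhs (cmap c p) (cinv c @^-1` U).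
  apply: (cinv_cont cp); rewrite cmapK//.
  exact: open_nbhs_nbhs.
rewrite /interior; apply: filterS2 => y /= Uy [q cq qy].
by exists q => //; split => //; rewrite -(cmapK cq) qy.
Qed.

Lemma smooth_onS U V f : U `<=` V -> smooth_on V f -> smooth_on U f.
Proof.
move=> UV fV c ac k; apply: Ck_sub (fV c ac k).
by move=> _ [p [cp Up] <-]; exists p => //; split=> //; exact: UV.
Qed.

Lemma smooth_on_loc U f :
  (forall p, U p -> exists2 V, V p & smooth_on V f) -> smooth_on U f.
Proof.
move=> H c ac k; apply: Ck_loc => _ [p [cp Up] <-].
have [V Vp fV] := H p Up.
by exists (cmap c @` (cdom c `&` V)); [exists p|exact: fV].
Qed.

Lemma smooth_on_ext U f g : open U -> (forall p, U p -> f p = g p) ->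
  smooth_on U f -> smooth_on U g.
Proof.
move=> oU fg fU c ac k; apply: Ck_ext (fU c ac k); first exact: chart_open.
by move=> _ [p [cp Up] <-] /=; rewrite cmapK// fg.
Qed.

Lemma smooth_on_cst U (a : R) : smooth_on U (fun=> a).
Proof. by move=> c ac k; exact: Ck_cst. Qed.

Lemma smooth_onD U f g : open U -> smooth_on U f -> smooth_on U g ->
  smooth_on U (fun p => f p + g p).
Proof.
move=> oU fU gU c ac k.
by apply: CkD (fU c ac k) (gU c ac k); exact: chart_open.
Qed.

Lemma smooth_onM U f g : open U -> smooth_on U f -> smooth_on U g ->
  smooth_on U (fun p => f p * g p).
Proof.
move=> oU fU gU c ac k.
by apply: CkM (fU c ac k) (gU c ac k); exact: chart_open.
Qed.

Lemma smooth_on_sum U (I : Type) (r : seq I) (F : I -> M -> R) : open U ->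
  (forall i, smooth_on U (F i)) -> smooth_on U (fun p => \sum_(i <- r) F i p).
Proof.
move=> oU FU; elim: r => [|i r IH].
  by under eq_fun do rewrite big_nil; exact: smooth_on_cst.
by under eq_fun do rewrite big_cons; apply: smooth_onD.
Qed.

Lemma smooth_map_continuous phi : smooth_map phi -> continuous phi.
Proof. by case. Qed.

Lemma smooth_map_open phi U : smooth_map phi -> open U -> open (phi @^-1` U).
Proof. by move=> [/continuousP + _]; apply. Qed.

Lemma smooth_on_comp phi U f : smooth_map phi -> open U -> smooth_on U f ->
  smooth_on (phi @^-1` U) (f \o phi).
Proof.
move=> sphi oU fU c ac k; apply: Ck_loc => _ [p [cp /= Up] <-].
have [c' ac' c'p] := atlas_cover (phi p).
pose W := phi @^-1` (cdom c' `&` U).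
have oW : open W.
  by apply: smooth_map_open => //; apply: openI => //; exact: cdom_open.
exists (cmap c @` (cdom c `&` W)); first by exists p.
have oV : open (cmap c @` (cdom c `&` W)) by exact: chart_open.
apply: Ck_ext (Ck_comp (g := fun x => cmap c' (phi (cinv c x))) oV _ _
   (fU c' ac' k)) => //.
- by move=> _ [q [cq [/= c'q Uq]] <-] /=; rewrite !cmapK.
- by move=> _ [q [cq [/= c'q Uq]] <-] /=; rewrite !cmapK//; exists (phi q).
- move=> i; apply: Ck_sub (sphi.2 c c' ac ac' i k).
  by move=> _ [q [cq [/= c'q Uq]] <-]; exists q.
Qed.

Lemma smooth_map_id : smooth_map id.
Proof. by split; [move=> p; exact: cvg_id|exact: atlas_compat]. Qed.

Lemma smooth_map_comp phi psi :
  smooth_map phi -> smooth_map psi -> smooth_map (phi \o psi).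
Proof.
move=> sphi spsi; split.
  by move=> p; apply: continuous_comp; [exact: spsi.1|exact: sphi.1].
move=> c c' ac ac' i.
have oU : open (phi @^-1` cdom c').
  by apply: smooth_map_open => //; exact: cdom_open.
suff fU : smooth_on (phi @^-1` cdom c') (fun p => cmap c' (phi p) ord0 i).
  exact: smooth_on_comp fU c ac.
by move=> d ad; exact: sphi.2.
Qed.

Lemma smooth_map_cont_comp phi f :
  smooth_map phi -> smooth_on setT f -> smooth_on setT (f \o phi).
Proof.
by move=> sphi /(smooth_on_comp sphi openT); rewrite preimage_setT.
Qed.

Fact smooth_fun_subproof0 : smooth_on setT (0 : M -> R^o).
Proof. exact: smooth_on_cst. Qed.
Fact smooth_fun_subproof (a : R) (f g : M -> R^o) :
  smooth_on setT f -> smooth_on setT g -> smooth_on setT (a *: f + g).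
Proof.
move=> fs gs; apply: smooth_onD gs; first exact: openT.
by apply: smooth_onM fs; [exact: openT|exact: smooth_on_cst].
Qed.
Definition smooth_fun : subspace (M -> R^o) :=
  Subspace smooth_fun_subproof0 smooth_fun_subproof.

End OneManifold.

Section Bundles.
Variables (n : nat) (M : manifold n).
Local Notation smooth_fun := (smooth_fun M).

Definition sfmul (f g : smooth_fun) : smooth_fun :=
  mksub smooth_fun (fun p => ssval f p * ssval g p)
    (smooth_onM openT (ssvalP f) (ssvalP g)).

Definition sfcomp (f : smooth_fun) (phi : M -> M) (sphi : smooth_map phi) :
    smooth_fun :=
  mksub smooth_fun (ssval f \o phi)
    (smooth_map_cont_comp sphi (ssvalP f)).

(* T_m M is the space of derivations of C^oo(M) at m. *)
Definition is_derivation (m : M) (v : smooth_fun -> R^o) : Prop :=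
  linear v /\ forall f g, v (sfmul f g) = ssval f m * v g + ssval g m * v f.

Fact is_derivation0 m : is_derivation m 0.
Proof.
split; first exact: (subspace0 (Hom smooth_fun R^o)).
by move=> f g; rewrite !mulr0 addr0.
Qed.
Fact is_derivationP m (a : R) v w :
  is_derivation m v -> is_derivation m w -> is_derivation m (a *: v + w).
Proof.
move=> [vl vM] [wl wM]; split.
  exact: (subspaceP (s := Hom smooth_fun R^o)).
move=> f g.
change (a * v (sfmul f g) + w (sfmul f g) =
  ssval f m * (a * v g + w g) + ssval g m * (a * v f + w f)).
rewrite vM wM !mulrDr !mulrA [ssval f m * a]mulrC [ssval g m * a]mulrC addrACA.
by rewrite -!mulrA.
Qed.
Definition tangent m : subspace (smooth_fun -> R^o) :=
  Subspace (is_derivation0 m) (@is_derivationP m).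

Fact tangent_map_subproof phi (sphi : smooth_map phi) m m' (e : phi m = m')
    (v : tangent m) : is_derivation m' (fun f => ssval v (sfcomp f sphi)).
Proof.
have [vl vM] := ssvalP v; split=> [a f g|f g].
  rewrite -vl; congr (ssval v _); exact: subspace_of_inj.
rewrite -e -[ssval f (phi m)]/(ssval (sfcomp f sphi) m).
rewrite -[ssval g (phi m)]/(ssval (sfcomp g sphi) m) -vM.
by congr (ssval v _); exact: subspace_of_inj.
Qed.

Definition tangent_map phi (sphi : smooth_map phi) m m' (e : phi m = m')
    (v : tangent m) : tangent m' :=
  mksub (tangent m') (fun f => ssval v (sfcomp f sphi))
    (tangent_map_subproof sphi e v).

(* The bundles derived from TM and E (TM, Hom(TM, E), DE, JE and their sum) are
   given by their fibres together with the subspace of smooth sections among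
   all set-theoretic sections; the latter is the space Gamma(B). *)
Record bundle := Bundle {
  bfib :> M -> lmodType R;
  bsmooth : subspace (dsec bfib)
}.

Definition Gamma (B : bundle) := subspace_of (bsmooth B).
HB.instance Definition _ B := GRing.Lmodule.on (Gamma B).

Fact vfield_subproof0 :
  (fun X : dsec (fun m => tangent m : lmodType R) =>
    forall f : smooth_fun, smooth_on setT (fun m => ssval (X m) f)) 0.
Proof. by move=> f; exact: smooth_on_cst. Qed.
Fact vfield_subproof (a : R) (X Y : dsec (fun m => tangent m : lmodType R)) :
  (forall f : smooth_fun, smooth_on setT (fun m => ssval (X m) f)) ->
  (forall f : smooth_fun, smooth_on setT (fun m => ssval (Y m) f)) ->
  (forall f : smooth_fun, smooth_on setT (fun m => ssval ((a *: X + Y) m) f)).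
Proof. by move=> sX sY f; exact: (smooth_fun_subproof a (sX f) (sY f)). Qed.
Definition tangent_bundle : bundle :=
  Bundle (Subspace vfield_subproof0 vfield_subproof).

End Bundles.
End Manifolds.

Section VectorBundles.
Variables (R : realType) (n : nat) (M : manifold R n).

(* V is a vector bundle of rank k when covered by fibrewise linear
   trivializations over open sets whose transition matrices are smooth; the
   total space is {m : M & V m}. The maps are total in m, but only their
   values over tdom matter. *)
Record trivialization (k : nat) (V : M -> lmodType R) := Trivialization {
  tdom : set M;
  tmap : forall m, V m -> 'rV[R]_k;
  tinv : forall m, 'rV[R]_k -> V m;
  tdom_open : open tdom;
  tmap_linear : forall m, tdom m -> linear (@tmap m);
  tmapK : forall m, tdom m -> cancel (@tmap m) (@tinv m);
  tinvK : forall m, tdom m -> cancel (@tinv m) (@tmap m)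
}.

Record vector_bundle (k : nat) := VectorBundle {
  fiber : M -> lmodType R;
  trivs : set (trivialization k fiber);
  trivs_cover : forall m, exists2 t, trivs t & tdom t m;
  trivs_compat : forall t t', trivs t -> trivs t' -> forall i j,
    smooth_on (tdom t `&` tdom t')
      (fun m => tmap t' (tinv t m (delta_mx ord0 i)) ord0 j)
}.

Variables (k : nat) (E : vector_bundle k).
Local Notation smooth_fun := (smooth_fun M).

Definition smooth_section (u : dsec (fiber E)) : Prop :=
  forall t, trivs t -> forall j,
    smooth_on (tdom t) (fun m => tmap t (u m) ord0 j).

Fact smooth_section0 : smooth_section 0.
Proof.
move=> t et j; apply: smooth_on_ext (smooth_on_cst _ 0); first exact: tdom_open.
move=> m tm; rewrite -[X in tmap t X]/(0 : fiber E m).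
by rewrite (linear_at0 (tmap_linear tm)) mxE.
Qed.

Fact smooth_sectionP (a : R) (u v : dsec (fiber E)) :
  smooth_section u -> smooth_section v -> smooth_section (a *: u + v).
Proof.
move=> us vs t et j; have ot := tdom_open t.
apply: smooth_on_ext (smooth_onD ot (smooth_onM ot
  (smooth_on_cst _ a) (us t et j)) (vs t et j)) => // m tm.
rewrite -[(a *: u + v) m]/(a *: u m + v m).
by rewrite (tmap_linear tm) !mxE.
Qed.

Definition vbundle : bundle M := Bundle (Subspace smooth_section0 smooth_sectionP).
Local Notation sectionE := (Gamma vbundle).

Fact fsec_subproof (f : smooth_fun) (u : sectionE) :
  smooth_section (fun m => ssval f m *: ssval u m).
Proof.
move=> t et j; have ot := tdom_open t.
have fs : smooth_on (tdom t) (ssval f).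
  by apply: smooth_onS (ssvalP f) => //; exact: subsetT.
apply: smooth_on_ext (smooth_onM ot fs (ssvalP u t et j)) => // m tm.
by rewrite (linear_atZ _ _ (tmap_linear tm)) mxE.
Qed.
Definition fsec (f : smooth_fun) (u : sectionE) : sectionE :=
  mksub (bsmooth vbundle) (fun m => ssval f m *: ssval u m) (fsec_subproof f u).

(* The fibre of DE over m: R-linear d : Gamma(E) -> E_m with a symbol v in T_mM
   such that d(f u) = f(m) d(u) + v(f) u(m). *)
Definition is_covdiff (m : M) (d : sectionE -> fiber E m) : Prop :=
  linear d /\ exists v : tangent m, forall f u,
    d (fsec f u) = ssval f m *: d u + ssval v f *: ssval u m.

Fact is_covdiff0 m : is_covdiff (0 : sectionE -> fiber E m).
Proof.
split; first exact: (subspace0 (Hom sectionE (fiber E m))).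
exists 0 => f u; rewrite -[LHS]/(0 : fiber E m) -[X in _ *: X + _]/(0 : fiber E m).
by rewrite -[ssval 0 f]/(0 : R) scaler0 scale0r addr0.
Qed.
Fact is_covdiffP m (a : R) (d r : sectionE -> fiber E m) :
  is_covdiff d -> is_covdiff r -> is_covdiff (a *: d + r).
Proof.
move=> [dl [v dv]] [rl [w rw]]; split.
  exact: (subspaceP (s := Hom sectionE (fiber E m))).
exists (a *: v + w) => f u; rewrite ssvalZD.
change (a *: d (fsec f u) + r (fsec f u) =
  ssval f m *: (a *: d u + r u) + (a * ssval v f + ssval w f) *: ssval u m).
rewrite dv rw !scalerDr scalerDl !scalerA [ssval f m * a]mulrC addrACA.
by rewrite mulrC.
Qed.
Definition gauge m : subspace (sectionE -> fiber E m) :=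
  Subspace (is_covdiff0 m) (@is_covdiffP m).

(* A section of DE is smooth when u |-> (m |-> d_m(u)) is an operator on
   Gamma(E) with d(f u) = f d(u) + X(f) u for some vector field X = j(d). *)
Definition smooth_gauge (d : dsec (fun m => gauge m : lmodType R)) : Prop :=
  (forall u : sectionE, smooth_section (fun m => ssval (d m) u)) /\
  exists X : Gamma (tangent_bundle M), forall f u m,
    ssval (d m) (fsec f u) =
    ssval f m *: ssval (d m) u + ssval (ssval X m) f *: ssval u m.

Fact smooth_gauge0 : smooth_gauge 0.
Proof.
split=> [u|]; first exact: smooth_section0.
exists 0 => f u m; rewrite -[ssval (0 m)]/(0 : sectionE -> fiber E m).
rewrite -[LHS]/(0 : fiber E m) -[X in _ *: X + _]/(0 : fiber E m).
by rewrite -[ssval _ f]/(0 : R) scaler0 scale0r addr0.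
Qed.
Fact smooth_gaugeP (a : R) (d r : dsec (fun m => gauge m : lmodType R)) :
  smooth_gauge d -> smooth_gauge r -> smooth_gauge (a *: d + r).
Proof.
move=> [ds [X dX]] [rs [Y rY]]; split=> [u|].
  exact: (smooth_sectionP a (ds u) (rs u)).
exists (a *: X + Y) => f u m.
change (a *: ssval (d m) (fsec f u) + ssval (r m) (fsec f u) =
  ssval f m *: (a *: ssval (d m) u + ssval (r m) u) +
  (a * ssval (ssval X m) f + ssval (ssval Y m) f) *: ssval u m).
rewrite dX rY !scalerDr scalerDl !scalerA [ssval f m * a]mulrC addrACA.
by rewrite mulrC.
Qed.
Definition gauge_bundle : bundle M :=
  Bundle (Subspace smooth_gauge0 smooth_gaugeP).
Local Notation sectionD := (Gamma gauge_bundle).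

Fact gl_gauge_subproof m (Psi : Hom (fiber E m) (fiber E m)) :
  is_covdiff (fun u : sectionE => ssval Psi (ssval u m)).
Proof.
have Pl := ssvalP Psi; split=> [a u v|]; first by rewrite -Pl.
exists 0 => f u; rewrite -[ssval 0 f]/(0 : R) scale0r addr0.
exact: linear_atZ.
Qed.
(* The inclusion gl(E) -> DE, with zero symbol. *)
Definition gl_gauge m (Psi : Hom (fiber E m) (fiber E m)) : gauge m :=
  mksub (gauge m) (fun u => ssval Psi (ssval u m)) (gl_gauge_subproof Psi).

Fact id_gl_subproof m : linear (@id (fiber E m)). Proof. by []. Qed.
Definition id_gl m : Hom (fiber E m) (fiber E m) :=
  mksub (Hom (fiber E m) (fiber E m)) id (@id_gl_subproof m).

Definition is_jet m (nu : gauge m -> fiber E m) : Prop :=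
  linear nu /\ forall Psi, nu (gl_gauge Psi) = ssval Psi (nu (gl_gauge (id_gl m))).

Fact is_jet0 m : is_jet (0 : gauge m -> fiber E m).
Proof.
split; first exact: (subspace0 (Hom (gauge m) (fiber E m))).
move=> Psi; rewrite -[LHS]/(0 : fiber E m) -[X in ssval Psi X]/(0 : fiber E m).
by rewrite (linear_at0 (ssvalP Psi)).
Qed.
Fact is_jetP m (a : R) (mu nu : gauge m -> fiber E m) :
  is_jet mu -> is_jet nu -> is_jet (a *: mu + nu).
Proof.
move=> [ml mP] [nl nP]; split.
  exact: (subspaceP (s := Hom (gauge m) (fiber E m))).
move=> Psi; change (a *: mu (gl_gauge Psi) + nu (gl_gauge Psi) =
  ssval Psi (a *: mu (gl_gauge (id_gl m)) + nu (gl_gauge (id_gl m)))).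
by rewrite mP nP (ssvalP Psi).
Qed.
Definition jet m : subspace (gauge m -> fiber E m) :=
  Subspace (is_jet0 m) (@is_jetP m).

(* Smoothness as a section of Hom(DE, E): smooth sections are mapped to smooth
   sections. *)
Definition smooth_jet (nu : dsec (fun m => jet m : lmodType R)) : Prop :=
  forall d : sectionD, smooth_section (fun m => ssval (nu m) (ssval d m)).
Fact smooth_jet0 : smooth_jet 0.
Proof. by move=> d; exact: smooth_section0. Qed.
Fact smooth_jetP (a : R) (mu nu : dsec (fun m => jet m : lmodType R)) :
  smooth_jet mu -> smooth_jet nu -> smooth_jet (a *: mu + nu).
Proof. by move=> ms ns d; exact: (smooth_sectionP a (ms d) (ns d)). Qed.
Definition jet_bundle : bundle M := Bundle (Subspace smooth_jet0 smooth_jetP).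
Local Notation sectionJ := (Gamma jet_bundle).

Definition omni_fiber (m : M) : lmodType R := (gauge m * jet m)%type.

Definition smooth_omni (X : dsec omni_fiber) : Prop :=
  smooth_gauge (fun m => (X m).1) /\ smooth_jet (fun m => (X m).2).
Fact smooth_omni0 : smooth_omni 0.
Proof. by split; [exact: smooth_gauge0|exact: smooth_jet0]. Qed.
Fact smooth_omniP (a : R) (X Y : dsec omni_fiber) :
  smooth_omni X -> smooth_omni Y -> smooth_omni (a *: X + Y).
Proof.
move=> [X1 X2] [Y1 Y2].
by split; [exact: (smooth_gaugeP a X1 Y1)|exact: (smooth_jetP a X2 Y2)].
Qed.
Definition omni : bundle M := Bundle (Subspace smooth_omni0 smooth_omniP).

(* d(u) = <du, d>_E, where du is the jet prolongation of u. *)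
Definition gauge_act (d : sectionD) (u : sectionE) : sectionE :=
  mksub (bsmooth vbundle) (fun m => ssval (ssval d m) u) ((ssvalP d).1 u).

(* <nu, d>_E *)
Definition jet_act (nu : sectionJ) (d : sectionD) : sectionE :=
  mksub (bsmooth vbundle) (fun m => ssval (ssval nu m) (ssval d m)) (ssvalP nu d).

Definition omni_fst (X : Gamma omni) : sectionD :=
  mksub (bsmooth gauge_bundle) (fun m => (ssval X m).1) (ssvalP X).1.
Definition omni_snd (X : Gamma omni) : sectionJ :=
  mksub (bsmooth jet_bundle) (fun m => (ssval X m).2) (ssvalP X).2.

End VectorBundles.

Section Brackets.
Variables (R : realType) (n : nat) (M : manifold R n).
Local Notation smooth_fun := (smooth_fun M).
Local Notation vfield := (Gamma (tangent_bundle M)).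

Definition vact (X : vfield) (f : smooth_fun) : smooth_fun :=
  mksub smooth_fun (fun m => ssval (ssval X m) f) (ssvalP X f).

Lemma vact_linear X : linear (vact X).
Proof.
move=> a f g; apply: subspace_of_inj; apply/funext => m.
exact: (ssvalP (ssval X m)).1.
Qed.

Lemma vactM X f g : vact X (sfmul f g) = sfmul f (vact X g) + sfmul g (vact X f).
Proof.
apply: subspace_of_inj; apply/funext => m.
exact: (ssvalP (ssval X m)).2.
Qed.

Fact vbracket_subproof (X Y : vfield) m :
  is_derivation m
    (fun f => ssval (ssval X m) (vact Y f) - ssval (ssval Y m) (vact X f) : R^o).
Proof.
have [Xl XM] := ssvalP (ssval X m); have [Yl YM] := ssvalP (ssval Y m).
split=> [a f g|f g].
  rewrite !vact_linear Xl Yl scalerBr opprD -!addrA; congr (_ + _).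
  by rewrite addrCA.
have lD (v : smooth_fun -> R^o) : linear v -> forall f g, v (f + g) = v f + v g.
  by move=> vl h h'; rewrite -[h]scale1r vl !scale1r.
rewrite !vactM !lD// !XM !YM /=.
ring.
Qed.

Definition vbracket (X Y : vfield) : vfield :=
  mksub (bsmooth (tangent_bundle M))
    (fun m => mksub (tangent m)
      (fun f => ssval (ssval X m) (vact Y f) - ssval (ssval Y m) (vact X f))
      (vbracket_subproof X Y m))
    (fun f => subspaceB (ssvalP (vact X (vact Y f))) (ssvalP (vact Y (vact X f)))).

Variables (k : nat) (E : vector_bundle M k).
Local Notation sectionE := (Gamma (vbundle E)).
Local Notation sectionD := (Gamma (gauge_bundle E)).
Local Notation sectionJ := (Gamma (jet_bundle E)).

Lemma gauge_act_fsec (d : sectionD) : exists X : vfield, forall f (u : sectionE),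
  gauge_act d (fsec f u) = fsec f (gauge_act d u) + fsec (vact X f) u.
Proof.
have [_ [X dX]] := ssvalP d; exists X => f u.
by apply: subspace_of_inj; apply: functional_extensionality_dep => m; exact: dX.
Qed.

Lemma gauge_act_linear (d : sectionD) : linear (gauge_act d).
Proof.
move=> a u v; apply: subspace_of_inj.
by apply: functional_extensionality_dep => m; exact: (ssvalP (ssval d m)).1.
Qed.

Lemma commD_at (d r : sectionD) (X Y : vfield) m :
  (forall f u, gauge_act d (fsec f u) = fsec f (gauge_act d u) + fsec (vact X f) u) ->
  (forall f u, gauge_act r (fsec f u) = fsec f (gauge_act r u) + fsec (vact Y f) u) ->
  forall f (u : sectionE),
  ssval (ssval d m) (gauge_act r (fsec f u)) - ssval (ssval r m) (gauge_act d (fsec f u)) =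
  ssval f m *: (ssval (ssval d m) (gauge_act r u) - ssval (ssval r m) (gauge_act d u)) +
  ssval (ssval (vbracket X Y) m) f *: ssval u m.
Proof.
move=> dX rY f u.
have lD (s : sectionD) v w : gauge_act s (v + w) = gauge_act s v + gauge_act s w.
  by rewrite -[v]scale1r gauge_act_linear !scale1r.
have ev (s : sectionD) v : ssval (ssval s m) v = ssval (gauge_act s v) m by [].
rewrite !ev dX rY !lD !dX !rY.
change (ssval f m *: ssval (gauge_act d (gauge_act r u)) m +
    ssval (ssval X m) f *: ssval (gauge_act r u) m +
    (ssval (ssval Y m) f *: ssval (gauge_act d u) m +
     ssval (ssval X m) (vact Y f) *: ssval u m) -
    (ssval f m *: ssval (gauge_act r (gauge_act d u)) m +
    ssval (ssval Y m) f *: ssval (gauge_act d u) m +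
    (ssval (ssval X m) f *: ssval (gauge_act r u) m +
     ssval (ssval Y m) (vact X f) *: ssval u m)) =
    ssval f m *: (ssval (gauge_act d (gauge_act r u)) m - ssval (gauge_act r (gauge_act d u)) m) +
    (ssval (ssval X m) (vact Y f) - ssval (ssval Y m) (vact X f)) *: ssval u m).
rewrite scalerBr scalerBl.
set a := ssval f m *: _; set b := _ *: ssval (gauge_act r u) m.
set c := _ *: ssval (gauge_act d u) m; set p := _ *: ssval u m.
set a' := ssval f m *: _; set p' := _ *: ssval u m.
have -> : a + b + (c + p) = (a + p) + (b + c).
  by rewrite -!addrA; congr (_ + _); rewrite addrA addrC.
have -> : a' + c + (b + p') = (a' + p') + (b + c).
  by rewrite -!addrA; congr (_ + _); rewrite addrCA addrA addrC.
by rewrite opprD addrACA subrr addr0 opprD addrACA.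
Qed.

Fact comm_subproof (d r : sectionD) m :
  is_covdiff (fun u : sectionE =>
    ssval (ssval d m) (gauge_act r u) - ssval (ssval r m) (gauge_act d u)).
Proof.
split=> [a u v|].
  have [[dl _] [rl _]] := (ssvalP (ssval d m), ssvalP (ssval r m)).
  by rewrite !gauge_act_linear dl rl scalerBr opprD addrACA.
have [[X dX] [Y rY]] := (gauge_act_fsec d, gauge_act_fsec r).
by exists (ssval (vbracket X Y) m) => f u; exact: commD_at.
Qed.

Definition comm_at (d r : sectionD) : dsec (fun m => gauge E m : lmodType R) :=
  fun m => mksub (gauge E m)
    (fun u => ssval (ssval d m) (gauge_act r u) - ssval (ssval r m) (gauge_act d u))
    (comm_subproof d r m).

Fact comm_smooth (d r : sectionD) : smooth_gauge (comm_at d r).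
Proof.
split=> [u|].
  exact: (subspaceB (ssvalP (gauge_act d (gauge_act r u))) (ssvalP (gauge_act r (gauge_act d u)))).
have [[X dX] [Y rY]] := (gauge_act_fsec d, gauge_act_fsec r).
by exists (vbracket X Y) => f u m; exact: commD_at.
Qed.

(* [d, r]_D *)
Definition gauge_comm (d r : sectionD) : sectionD :=
  mksub (bsmooth (gauge_bundle E)) (comm_at d r) (comm_smooth d r).

Lemma commE d r u : gauge_act (gauge_comm d r) u = gauge_act d (gauge_act r u) - gauge_act r (gauge_act d u).
Proof. by apply: subspace_of_inj; apply: functional_extensionality_dep. Qed.

(* <L_d nu, d'>_E *)
Definition lie_pair (d : sectionD) (nu : sectionJ) (d' : sectionD) : sectionE :=
  gauge_act d (jet_act nu d') - jet_act nu (gauge_comm d d').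

(* Z = {X, Y}: the DE-component is [d, r]_D, and the JE-component
   L_d nu - L_r mu + d<mu, r> is determined by its pairings with Gamma(DE),
   which is how the Lie derivative of jets is defined. *)
Definition is_omni_bracket (X Y Z : Gamma (omni E)) : Prop :=
  let d := omni_fst X in let mu := omni_snd X in
  let r := omni_fst Y in let nu := omni_snd Y in
  omni_fst Z = gauge_comm d r /\
  forall d' : sectionD,
    jet_act (omni_snd Z) d' =
    lie_pair d nu d' - lie_pair r mu d' + gauge_act d' (jet_act mu r).

Definition omni_anchor m (x : omni E m) : gauge E m := x.1.

Definition omni_pair m (x y : omni E m) : fiber E m :=
  (2%:R^-1 : R) *: (ssval y.2 x.1 + ssval x.2 y.1).

End Brackets.

Section Automorphisms.
Variables (R : realType) (n : nat) (M : manifold R n).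
Variables (k : nat) (E : vector_bundle M k).
Local Notation smooth_fun := (smooth_fun M).
Local Notation sectionE := (Gamma (vbundle E)).

Lemma linear_at_sum (U V : lmodType R) (f : U -> V) I (r : seq I) (a : I -> R) v :
  linear f -> f (\sum_(i <- r) a i *: v i) = \sum_(i <- r) a i *: f (v i).
Proof.
move=> fl; elim: r => [|i r IH]; first by rewrite !big_nil linear_at0.
by rewrite !big_cons fl IH.
Qed.

Lemma triv_expand (t : trivialization k (fiber E)) m (tm : tdom t m)
    (V : lmodType R) (L : fiber E m -> V) v : linear L ->
  L v = \sum_i tmap t v ord0 i *: L (tinv t m (delta_mx ord0 i)).
Proof.
move=> Ll; rewrite -linear_at_sum//; congr L.
rewrite -[LHS](tmapK tm) -[RHS](tmapK tm); congr tinv.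
rewrite (linear_at_sum _ _ _ (tmap_linear tm)) [LHS]row_sum_delta.
by apply: eq_bigr => i _; rewrite tinvK.
Qed.

(* Smoothness of a bundle map, read in local trivializations. *)
Definition smooth_fibmap (f : fibmap (fiber E)) : Prop :=
  smooth_map (fbase f) /\
  forall t t', trivs t -> trivs t' -> forall i j,
    smooth_on (tdom t `&` fbase f @^-1` tdom t')
      (fun m => tmap t' (ffib f (tinv t m (delta_mx ord0 i))) ord0 j).

Lemma smooth_fibmap_id : smooth_fibmap (fibmap_id (fiber E)).
Proof. by split; [exact: smooth_map_id|exact: trivs_compat]. Qed.

Lemma smooth_fibmap_comp (f g : fibmap (fiber E)) :
  smooth_fibmap f -> smooth_fibmap g -> smooth_fibmap (fibmap_comp f g).
Proof.
move=> [sf sF] [sg sG]; split; first exact: smooth_map_comp.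
move=> t t' et et' i j; apply: smooth_on_loc => m [tm /= t'm].
have [t1 et1 t1m] := trivs_cover E (fbase g m).
pose W1 := tdom t1 `&` fbase f @^-1` tdom t'.
have oW1 : open W1.
  by apply: openI; [|apply: smooth_map_open => //]; exact: tdom_open.
pose W := tdom t `&` fbase g @^-1` W1.
have oW : open W.
  by apply: openI; [exact: tdom_open|exact: smooth_map_open].
exists W => //.
have A l : smooth_on W
    (fun m => tmap t1 (ffib g (tinv t m (delta_mx ord0 i))) ord0 l).
  by apply: smooth_onS (sG t t1 et et1 i l) => p [tp [t1p _]].
have B l : smooth_on W (fun m =>
    tmap t' (ffib f (tinv t1 (fbase g m) (delta_mx ord0 l))) ord0 j).
  have := smooth_on_comp sg oW1 (sF t1 t' et1 et' l j).
  by apply: smooth_onS => p [_].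
apply: smooth_on_ext (smooth_on_sum (index_enum _) oW
  (fun l => smooth_onM oW (A l) (B l))) => // p [tp [/= t1p t'p]].
rewrite [ffib f (ffib g _)](triv_expand t1p _ (@ffib_linear _ _ _ f _)).
by rewrite (linear_at_sum _ _ _ (tmap_linear t'p)) summxE; apply: eq_bigr => l _; rewrite mxE.
Qed.

Definition is_aut (f : fibaut (fiber E)) : Prop :=
  smooth_fibmap f /\ smooth_fibmap (f^-1)%g.

Definition is_aut_mem : pred (fibaut (fiber E)) := fun f => `[< is_aut f >].

Fact is_aut_closed : group_closed is_aut_mem.
Proof.
split=> [|f g /asboolP[fs fs'] /asboolP[gs gs']]; apply/asboolP.
  by split; [|rewrite invg1]; exact: smooth_fibmap_id.
by split; [|rewrite invgF]; exact: smooth_fibmap_comp.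
Qed.

Record aut := Aut {
  aut_val :> fibaut (fiber E);
  aut_subproof : is_aut_mem aut_val
}.
HB.instance Definition _ := [isSub for aut_val].
HB.instance Definition _ := [Choice of aut by <:].
HB.instance Definition _ :=
  SubChoice_isSubGroup.Build (fibaut (fiber E)) is_aut_mem aut is_aut_closed.

Lemma aut_smooth (Phi : aut) : smooth_map (fbase Phi).
Proof. by have /asboolP[[]] := aut_subproof Phi. Qed.
Lemma aut_smoothV (Phi : aut) : smooth_map (fbase (aut_val Phi)^-1%g).
Proof. by have /asboolP[_ []] := aut_subproof Phi. Qed.

Lemma tmap_fat (t : trivialization k (fiber E)) (f : fibmap (fiber E)) m m'
    (e : fbase f m = m') v : tmap t (fat e v) = tmap t (ffib f v).
Proof. by case: _ / e. Qed.

Fact push_smooth (Phi : aut) (u : sectionE) :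
  smooth_section (push Phi (ssval u)).
Proof.
have /asboolP[[sf sF] [sg _]] := aut_subproof Phi.
pose psi := fbase (aut_val Phi)^-1%g; rewrite -/psi in sg.
move=> t et j; apply: smooth_on_loc => m tm.
have [t1 et1 t1m] := trivs_cover E (psi m).
pose W1 := tdom t1 `&` fbase (aut_val Phi) @^-1` tdom t.
have oW1 : open W1.
  by apply: openI; [|apply: smooth_map_open => //]; exact: tdom_open.
pose W := tdom t `&` psi @^-1` W1.
have oW : open W.
  by apply: openI; [exact: tdom_open|exact: smooth_map_open].
exists W; first by split => //; split => //; rewrite /= fbaseVK.
have A l : smooth_on W (fun m => tmap t1 (ssval u (psi m)) ord0 l).
  have := smooth_on_comp sg (tdom_open t1) (ssvalP u t1 et1 l).
  by apply: smooth_onS => p [_ []].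
have B l : smooth_on W (fun m =>
    tmap t (ffib (aut_val Phi) (tinv t1 (psi m) (delta_mx ord0 l))) ord0 j).
  have := smooth_on_comp sg oW1 (sF t1 t et1 et l j).
  by apply: smooth_onS => p [_].
apply: smooth_on_ext (smooth_on_sum (index_enum _) oW
  (fun l => smooth_onM oW (A l) (B l))) => // p [tp [/= t1p t'p]].
rewrite /push tmap_fat.
rewrite [ffib (aut_val Phi) _](triv_expand t1p _ (@ffib_linear _ _ _ (aut_val Phi) _)).
by rewrite (linear_at_sum _ _ _ (tmap_linear t'p)) summxE; apply: eq_bigr => l _; rewrite mxE.
Qed.

Definition act_section (Phi : aut) (u : sectionE) : sectionE :=
  mksub (bsmooth (vbundle E)) (push Phi (ssval u)) (push_smooth Phi u).

Lemma act_sectionV (Phi : aut) u m m' (e : fbase Phi m = m') :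
  fat e (ssval (act_section Phi^-1%g u) m) = ssval u m'.
Proof.
have -> : ssval u = push Phi (ssval (act_section Phi^-1%g u)).
  by rewrite pushVK.
exact: esym (push_at _ e).
Qed.

Lemma act_section_linear (Phi : aut) : linear (act_section Phi).
Proof. by move=> a u v; apply: subspace_of_inj; exact: push_linear. Qed.

Lemma act_section_fsec (Phi : aut) (f : smooth_fun) u :
  act_section Phi (fsec f u) =
  fsec (sfcomp f (aut_smoothV Phi)) (act_section Phi u).
Proof.
apply: subspace_of_inj; apply: functional_extensionality_dep => m.
exact: (linear_atZ _ _ (fat_linear _)).
Qed.

Fact Ad_subproof (Phi : aut) m m' (e : fbase Phi m = m') (d : gauge E m) :
  is_covdiff (fun u => fat e (ssval d (act_section (Phi^-1)%g u))).
Proof.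
have [dl [v dv]] := ssvalP d; split=> [a u w|].
  by rewrite act_section_linear dl fat_linear.
exists (tangent_map (aut_smooth Phi) e v) => f u.
rewrite act_section_fsec dv fat_linear (linear_atZ _ _ (fat_linear _)).
rewrite act_sectionV; congr (_ *: _ + _ *: _).
  by rewrite -e.
by congr (ssval v _); exact: subspace_of_inj.
Qed.

(* Ad_Phi(d) = Phi o d o Phi^-1, from the fibre over m to the fibre over
   m' = phi(m) *)
Definition Ad (Phi : aut) m m' (e : fbase Phi m = m') (d : gauge E m) :
    gauge E m' :=
  mksub (gauge E m') (fun u => fat e (ssval d (act_section (Phi^-1)%g u)))
    (Ad_subproof e d).

Definition smooth_hom
    (eta : dsec (fun m => Hom (tangent m) (fiber E m) : lmodType R)) : Prop :=
  forall X : Gamma (tangent_bundle M),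
    smooth_section (fun m => ssval (eta m) (ssval X m)).
Fact smooth_hom0 : smooth_hom 0.
Proof. by move=> X; exact: smooth_section0. Qed.
Fact smooth_homP (a : R) (eta theta : dsec _) :
  smooth_hom eta -> smooth_hom theta -> smooth_hom (a *: eta + theta).
Proof. by move=> es ts X; exact: (smooth_sectionP a (es X) (ts X)). Qed.
Definition homTE : bundle M := Bundle (Subspace smooth_hom0 smooth_homP).

Fact tangent_map_linear phi (sphi : smooth_map phi) (m m' : M) (e : phi m = m') :
  linear (tangent_map sphi e).
Proof. by move=> a v w; apply: subspace_of_inj. Qed.

Fact hom_act_subproof (Phi : aut) (eta : Gamma homTE) m :
  linear (fun v : tangent m =>
    fat (fbaseVK Phi m) (ssval (ssval eta (fbase (aut_val Phi)^-1%g m))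
      (tangent_map (aut_smoothV Phi) (erefl _) v))).
Proof.
move=> a v w; rewrite tangent_map_linear.
by rewrite (ssvalP (ssval eta (fbase (aut_val Phi)^-1%g m))) fat_linear.
Qed.

Definition hom_act_at (Phi : aut) (eta : Gamma homTE) : dsec homTE := fun m =>
  mksub (Hom (tangent m) (fiber E m))
    (fun v => fat (fbaseVK Phi m) (ssval (ssval eta (fbase (aut_val Phi)^-1%g m))
      (tangent_map (aut_smoothV Phi) (erefl _) v)))
    (@hom_act_subproof Phi eta m).

Fact hom_act_smooth (Phi : aut) (eta : Gamma homTE) :
  smooth_hom (hom_act_at Phi eta).
Proof.
move=> X; pose psi := fbase (aut_val Phi)^-1%g.
pose Y : dsec (tangent_bundle M) := fun m =>
  tangent_map (aut_smoothV Phi) (fbaseK Phi m) (ssval X (fbase Phi m)).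
have Ys : bsmooth (tangent_bundle M) Y.
  move=> f; apply: (smooth_map_cont_comp (aut_smooth Phi)
    (ssvalP X (sfcomp f (aut_smoothV Phi)))).
pose Ysec : Gamma (tangent_bundle M) := mksub (bsmooth (tangent_bundle M)) Y Ys.
pose w : sectionE := mksub (bsmooth (vbundle E)) _ (ssvalP eta Ysec).
suff -> : (fun m => ssval (hom_act_at Phi eta m) (ssval X m)) = push Phi (ssval w).
  exact: push_smooth.
apply: functional_extensionality_dep => m; rewrite /push; congr fat => /=.
congr (ssval _ _); apply: subspace_of_inj; apply/funext => f /=.
by rewrite fbaseVK.
Qed.

(* Phi . eta = Phi o eta o phi_*^-1, where phi_*^-1 = (phi^-1)_* *)
Definition hom_act (Phi : aut) (eta : Gamma homTE) : Gamma homTE :=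
  mksub (bsmooth homTE) (hom_act_at Phi eta) (hom_act_smooth Phi eta).

Fact hom_act1 eta : hom_act 1%g eta = eta.
Proof.
apply: subspace_of_inj; apply: functional_extensionality_dep => m.
apply: subspace_of_inj; apply/funext => v /=.
apply: existT_snd_inj; rewrite fat_tot.
rewrite -[LHS]/(existT (fiber E) m (ssval (ssval eta m) (tangent_map (aut_smoothV 1%g) (erefl m) v))).
congr existT; congr (ssval _ _).
by apply: subspace_of_inj; apply/funext => f; congr (ssval v _); exact: subspace_of_inj.
Qed.

Fact hom_actM (Phi Psi : aut) eta :
  hom_act (Phi * Psi)%g eta = hom_act Phi (hom_act Psi eta).
Proof.
apply: subspace_of_inj; apply: functional_extensionality_dep => m.
apply: subspace_of_inj; apply/funext => v /=.
apply: existT_snd_inj; rewrite !fat_tot.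
rewrite -[RHS]/(ftot (aut_val (Phi * Psi)%g) _); congr ftot; congr existT; congr (ssval _ _).
by apply: subspace_of_inj; apply/funext => f; congr (ssval v _); exact: subspace_of_inj.
Qed.

Fact hom_actD (Phi : aut) : {morph hom_act Phi : eta theta / eta + theta}.
Proof.
move=> eta theta; apply: subspace_of_inj; apply: functional_extensionality_dep => m.
apply: subspace_of_inj; apply/funext => v /=.
have fatD u w : fat (fbaseVK Phi m) (u + w) =
    fat (fbaseVK Phi m) u + fat (fbaseVK Phi m) w.
  by rewrite -[u]scale1r fat_linear !scale1r.
exact: fatD.
Qed.

(* (F, Phi) with F covering the same diffeomorphism as Phi; F and F^-1 are
   smooth, i.e. F o X o phi^-1 is a smooth section of DE (+) JE iff X is.
   As F is bijective, F{X, Y} = {F X, F Y} amounts to: Z = {X, Y} iff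
   F Z = {F X, F Y}. *)
Definition is_omni_aut (p : fibaut (omni E) * aut) : Prop :=
  let F := p.1 in let Phi := p.2 in
  [/\ forall m, fbase F m = fbase Phi m,
      forall X : dsec (omni E),
        bsmooth (omni E) X <-> bsmooth (omni E) (push F X),
      forall m m' (eF : fbase F m = m') (eP : fbase Phi m = m') x y,
        omni_pair (fat eF x) (fat eF y) = fat eP (omni_pair x y),
      forall X Y Z X' Y' Z' : Gamma (omni E),
        ssval X' = push F (ssval X) -> ssval Y' = push F (ssval Y) ->
        ssval Z' = push F (ssval Z) ->
        (is_omni_bracket X Y Z <-> is_omni_bracket X' Y' Z') &
      forall m m' (eF : fbase F m = m') (eP : fbase Phi m = m') x,
        omni_anchor (fat eF x) = Ad eP (omni_anchor x)].

Lemma omni_aut_base (p : fibaut (omni E) * aut) :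
  (forall m, fbase p.1 m = fbase p.2 m) ->
  forall m, fbase p.1^-1%g m = fbase (aut_val p.2)^-1%g m.
Proof.
by move=> e m; rewrite -{2}(fbaseVK p.1 m) e fbaseK.
Qed.

Lemma AdM (Phi Psi : aut) m m' m'' (e : fbase Psi m = m')
  (e' : fbase Phi m' = m'') (e'' : fbase (Phi * Psi)%g m = m'') d :
  Ad e'' d = Ad e' (Ad e d).
Proof.
apply: subspace_of_inj; apply/funext => u /=.
rewrite -fat_comp; congr (fat _ (ssval d _)).
by apply: subspace_of_inj => /=; rewrite invgM pushM.
Qed.

Lemma Ad1 m m' (e : fbase (1 : aut)%g m = m') d u :
  ssval (Ad e d) u = eq_rect _ (fiber E) (ssval d u) _ e.
Proof.
rewrite /=; have -> : act_section (1 : aut)^-1%g u = u; last by [].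
by apply: subspace_of_inj => /=; rewrite invg1 push1.
Qed.

Lemma AdK (Phi : aut) m m' (e : fbase Phi m = m')
  (e' : fbase (Phi^-1)%g m' = m) d : Ad e' (Ad e d) = d.
Proof.
apply: subspace_of_inj; apply/funext => u /=.
rewrite fatK; congr (ssval d _).
by apply: subspace_of_inj; exact: (pushVK (aut_val Phi)^-1%g).
Qed.

Fact is_omni_aut1 : is_omni_aut 1%g.
Proof.
split=> //=.
- by move=> X; rewrite push1.
- move=> m m' eF eP x y; rewrite (Prop_irrelevance eP eF).
  by case: _ / eF {eP}.
- move=> X Y Z X' Y' Z'; rewrite !push1.
  by move=> /subspace_of_inj-> /subspace_of_inj-> /subspace_of_inj->.
- move=> m m' eF eP x; apply: subspace_of_inj; apply/funext => u.
  rewrite Ad1 (Prop_irrelevance eP eF).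
  by case: _ / eF {eP}.
Qed.

Fact is_omni_autM p q : is_omni_aut p -> is_omni_aut q -> is_omni_aut (p * q)%g.
Proof.
case: p q => F Phi [G Psi].
move=> [/= Fb Fs Fp Fbr FA] [/= Gb Gs Gp Gbr GA]; split=> /=.
- by move=> m; rewrite Gb Fb.
- by move=> X; rewrite Gs Fs pushM.
- move=> m m' eF eP x y; have eG : fbase Psi m = fbase G m by rewrite Gb.
  have eF' : fbase F (fbase G m) = m' by [].
  have eP' : fbase Phi (fbase G m) = m' by rewrite Gb.
  rewrite !(fat_comp (erefl (fbase G m)) eF') (fat_comp eG eP').
  by rewrite Fp Gp.
- move=> X Y Z X' Y' Z'; rewrite !pushM => eX eY eZ.
  pose pG (W : Gamma (omni E)) : Gamma (omni E) :=
    mksub (bsmooth (omni E)) (push G (ssval W)) ((Gs (ssval W)).1 (ssvalP W)).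
  rewrite (Gbr X Y Z (pG X) (pG Y) (pG Z))//.
  exact: Fbr.
- move=> m m' eF eP x; have eG : fbase Psi m = fbase G m by rewrite Gb.
  have eF' : fbase F (fbase G m) = m' by [].
  have eP' : fbase Phi (fbase G m) = m' by rewrite Gb.
  by rewrite (fat_comp (erefl (fbase G m)) eF') (AdM eG eP') FA GA.
Qed.

Fact is_omni_autV p : is_omni_aut p -> is_omni_aut p^-1%g.
Proof.
case: p => F Phi [/= Fb Fs Fp Fbr FA]; split=> /=.
- by move=> m; exact: (omni_aut_base (p := (F, Phi))).
- by move=> X; rewrite [X in _ <-> X]Fs pushVK.
- move=> m m' eF eP x y.
  have eF' : fbase F m' = m by rewrite -eF fbaseVK.
  have eP' : fbase Phi m' = m by rewrite -eP fbaseVK.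
  have fK z : z = fat eF' (fat eF z).
    by apply: existT_snd_inj; rewrite !fat_tot fautVK.
  by rewrite [in RHS](fK x) [in RHS](fK y) (Fp _ _ _ eP') fatK.
- move=> X Y Z X' Y' Z' eX eY eZ; rewrite (Fbr X' Y' Z' X Y Z) ?eX ?eY ?eZ//.
  + by rewrite pushVK.
  + by rewrite pushVK.
  + by rewrite pushVK.
- move=> m m' eF eP x.
  have eF' : fbase F m' = m by rewrite -eF fbaseVK.
  have eP' : fbase Phi m' = m by rewrite -eP fbaseVK.
  have fK z : z = fat eF' (fat eF z).
    by apply: existT_snd_inj; rewrite !fat_tot fautVK.
  by rewrite [in RHS](fK x) (FA _ _ _ eP') AdK.
Qed.

Definition is_omni_aut_mem : pred (fibaut (omni E) * aut) :=
  fun p => `[< is_omni_aut p >].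

Fact is_omni_aut_closed : group_closed is_omni_aut_mem.
Proof.
split=> [|p q /asboolP pP /asboolP qP]; apply/asboolP.
  exact: is_omni_aut1.
by apply: is_omni_autM => //; exact: is_omni_autV.
Qed.

Record omni_aut := OmniAut {
  omni_aut_val : fibaut (omni E) * aut;
  omni_aut_subproof : is_omni_aut_mem omni_aut_val
}.
HB.instance Definition _ := [isSub for omni_aut_val].
HB.instance Definition _ := [Choice of omni_aut by <:].
HB.instance Definition _ := SubChoice_isSubGroup.Build
  (fibaut (omni E) * aut)%type is_omni_aut_mem omni_aut is_omni_aut_closed.

End Automorphisms.

Section SemidirectProduct.
Local Open Scope group_scope.
Variables (G : groupType) (V : zmodType).

Record additive_action := AdditiveAction {
  aact :> G -> V -> V;
  aact1 : forall v, aact 1 v = v;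
  aactM : forall g h v, aact (g * h) v = aact g (aact h v);
  aactD : forall g, {morph aact g : v w / (v + w)%R}
}.

(* (g, v) (h, w) = (g h, v + g.w) *)
Record semidirect (a : additive_action) :=
  Semidirect { sd_group : G; sd_vector : V }.

Variable a : additive_action.
Local Notation sdprod := (semidirect a).

HB.instance Definition _ := gen_eqMixin sdprod.
HB.instance Definition _ := gen_choiceMixin sdprod.

Definition sd_one : sdprod := Semidirect a 1 0%R.
Definition sd_mul (x y : sdprod) : sdprod :=
  Semidirect a (sd_group x * sd_group y)
    (sd_vector x + a (sd_group x) (sd_vector y))%R.
Definition sd_inv (x : sdprod) : sdprod :=
  Semidirect a (sd_group x)^-1 (- a (sd_group x)^-1%g (sd_vector x))%R.

Lemma aact0 g : a g 0%R = 0%R.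
Proof. by apply: (@addrI _ (a g 0%R)); rewrite -aactD !addr0. Qed.
Lemma aactN g v : a g (- v)%R = (- a g v)%R.
Proof. by apply: (@addrI _ (a g v)); rewrite -aactD !subrr aact0. Qed.

Fact sd_mulA : associative sd_mul.
Proof.
by move=> x y z; rewrite /sd_mul /= mulgA aactD aactM addrA.
Qed.
Fact sd_mul1 : left_id sd_one sd_mul.
Proof. by case=> g v; rewrite /sd_mul /= mul1g aact1 add0r. Qed.
Fact sd_mulr1 : right_id sd_one sd_mul.
Proof. by case=> g v; rewrite /sd_mul /= mulg1 aact0 addr0. Qed.
Fact sd_mulV : left_inverse sd_one sd_inv sd_mul.
Proof. by case=> g v; rewrite /sd_mul /= mulVg addNr. Qed.
Fact sd_mulrV : right_inverse sd_one sd_inv sd_mul.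
Proof.
by case=> g v; rewrite /sd_mul /= mulgV aactN -aactM mulgV aact1 subrr.
Qed.

HB.instance Definition _ := isGroup.Build sdprod
  sd_mulA sd_mul1 sd_mulr1 sd_mulV sd_mulrV.

End SemidirectProduct.

Definition hom_action (R : realType) (n : nat) (M : manifold R n) (k : nat)
    (E : vector_bundle M k) : additive_action (aut E) (Gamma (homTE E)) :=
  AdditiveAction (@hom_act1 _ _ _ _ E) (@hom_actM _ _ _ _ E)
    (@hom_actD _ _ _ _ E).

(* Main.v *)
From HB Require Import structures.
From mathcomp Require Import all_boot all_order all_algebra.
From mathcomp Require Import boolp classical_sets functions reals topology.
From mathcomp Require Import interval_inference normedtype landau derive.
From mathcomp Require Import constructive_ereal measure sequences realfun exp.
From mathcomp Require Import lebesgue_measure lebesgue_integral ftc.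
From mathcomp Require Import ring lra.
Require Import Defs.

(** Let [(F, Phi)] be an automorphism of the omni-Lie algebroid. Compatibility
    with the anchor says that the [DE]-component of [F (d + mu)] is [Ad Phi d],
    and the pairing then forces [F] to act on [JE] by
    [nu |-> Phi o nu o Ad_Phi^-1]. What remains is the [JE]-component of [F d].
    It is governed by the image of the identity section: write
    [F Id = Id + J]. The pairing gives [J(Id) = 0], so [J], being a jet, kills
    all of [gl(E)] and factors through the symbol map [DE -> TM]; this defines
    [eta] in [Gamma (Hom(TM, E))] with [J(d) = eta(j d)]. The identity section
    commutes with every section of [DE] and acts on [E] by the identity, so
    applying [F] to [{Id, d} = 0] yields, for [d' = Ad Phi d] and all [c],
    [<F d, c> = d' (J c) - c (J d') - J [d', c]]: the map [F] is determined by
    [Phi] and [eta] (lemmas [twist_bracket] and [omni_aut_inj]). Composing two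
    automorphisms adds [eta] to the transport of the second one-form
    ([twist_homM]), which is the multiplication of the semidirect product.

    Conversely every [Phi] lifts to [omni_lift Phi], whose one-form is zero, and
    every [eta] gives the shift [d + mu |-> d + (b d + mu)], where [b] is the
    differential of the [E]-valued one-form [eta o j] on [DE]. The shift
    preserves the pairing because [b] is skew, and the bracket because [b] is
    closed ([hom_jet_closed]). Every pair [(Phi, eta)] is reached by a product
    of these two kinds.

    The conditions on [F] are about sections while [F] acts on fibres, and
    tangent vectors and elements of [DE] are derivations of global functions and
    sections. Passing between the two needs every tangent vector and every
    element of [DE] to extend to a smooth section ([tangent_extend],
    [gauge_extend]); this rests on bump functions and on Hadamard's lemma, by
    which a derivation is a combination of coordinate derivatives
    ([coordinates_exist]). *)

Set Implicit Arguments.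
Unset Strict Implicit.
Unset Printing Implicit Defensive.
Import Order.TTheory GRing.Theory Num.Theory.
Import numFieldNormedType.Exports.
Local Open Scope classical_set_scope.
Local Open Scope ring_scope.

(** * Functions of class C^k on open sets of R^n *)

Section DifferentiableFunctions.
Variables (R : realType) (n : nat).
Implicit Types (U : set 'rV[R]_n) (f g : 'rV[R]_n -> R).

Lemma Ck_coord k U i : Ck k U (fun x : 'rV[R]_n => x ord0 i).
Proof.
have dc x : differentiable (fun x : 'rV[R]_n => x ord0 i) x.
  exact: differentiable_coord.
case: k => [|k] /=; first by move=> x _; exact: differentiable_continuous.
split=> // j.
suff -> : 'D_(delta_mx ord0 j) (fun x : 'rV[R]_n => x ord0 i) =
    cst ((delta_mx ord0 j : 'rV[R]_n) ord0 i) :> ('rV[R]_n -> R).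
  exact: Ck_cst.
apply/funext => x; have /diff_derivable dv := @dc x.
have dx : derivable (@id 'rV[R]_n) x (delta_mx ord0 j) by exact: derivable_id.
have := derive_mx dx; rewrite derive_id => /matrixP/(_ ord0 i) Hm.
by rewrite {1}Hm mxE.
Qed.

Lemma CkN k U f : open U -> Ck k U f -> Ck k U (- f).
Proof.
move=> oU fC; have -> : - f = cst (-1) * f.
  by apply/funext => x; rewrite /= mulrfctE mulN1r.
by apply: CkM => //; exact: Ck_cst.
Qed.

Lemma derive_outer (h : R -> R) (q : 'rV[R]_n -> R) x v :
  derivable h (q x) 1 -> differentiable q x ->
  differentiable (h \o q) x /\ 'D_v (h \o q) x = h^`()%classic (q x) * 'D_v q x.
Proof.
move=> dh dq; have /derivable1_diffP dh' := dh.
have dc : differentiable (h \o q) x by exact: differentiable_comp.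
split=> //; rewrite deriveE// diff_comp//= deriv1E//= -deriveE//.
by rewrite mulrC.
Qed.

(** Smoothness of a composition is obtained at once for every member of a
    family of functions of one variable that is closed under derivation; both
    the reciprocal powers and the flat functions below form such families. *)
Lemma Ck_comp_family (b : nat -> R -> R) (al be : nat -> R) (D : set R) k U q :
  open U -> (forall p s, D s -> derivable (b p) s 1) ->
  (forall p s, D s -> (b p)^`()%classic s = al p * b p.+1 s + be p * b p.+2 s) ->
  (forall x, U x -> D (q x)) -> Ck k U q -> forall p, Ck k U (b p \o q).
Proof.
move=> oU db b' qD; elim: k => [|k IH] qC p.
  move=> x Ux; apply: continuous_comp; first exact: qC.
  apply: differentiable_continuous; apply/derivable1_diffP.
  by apply: db; exact: qD.
have qC' := Ck_lower qC; case: (qC) => qd qD1.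
split=> [x Ux|i].
  by have [] := derive_outer 0 (db p _ (qD _ Ux)) (qd _ Ux).
have C1 := IH qC' p.+1; have C2 := IH qC' p.+2.
have C : Ck k U ((cst (al p) * (b p.+1 \o q) + cst (be p) * (b p.+2 \o q)) *
                 'D_(delta_mx ord0 i) q).
  apply: CkM (oU) _ (qD1 i).
  apply: CkD (oU) (CkM oU (Ck_cst _ _ _) C1) (CkM oU (Ck_cst _ _ _) C2).
apply: Ck_ext C => // x Ux /=.
have [_ ->] := derive_outer (delta_mx ord0 i) (db p _ (qD _ Ux)) (qd _ Ux).
rewrite b'; last exact: qD.
reflexivity.
Qed.

Lemma Ck_inv k U f : open U -> (forall x, U x -> f x != 0) ->
  Ck k U f -> Ck k U (fun x => (f x)^-1).
Proof.
move=> oU f0 fC.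
pose b p (s : R) := s^-1 ^+ p.+1.
have dV p (s : R) : s != 0 -> is_derive s 1 (b p) (- p.+1%:R * b p.+1 s).
  move=> s0; have dVs : is_derive s (1 : R) (fun t : R => t^-1) (- s ^- 2).
    apply: DeriveDef; first by apply: derivableV => //; exact: derivable_id.
    by rewrite deriveV// derive_id /GRing.scale/= mulr1.
  have := @is_deriveX _ _ (fun t : R => t^-1) p.+1 _ _ _ dVs.
  rewrite exprfctE => ds; apply: (is_derive_eq ds).
  by rewrite /b /GRing.scale/= -exprVn !exprS; ring.
have := Ck_comp_family (b := b) (al := fun p => - p.+1%:R) (be := fun=> 0)
  (D := [set s | s != 0]) oU _ _ f0 fC.
move=> /(_ _ _ 0); apply=> p s s0; have ds := dV p s s0; first exact: ex_derive.
by rewrite derive1E derive_val mul0r addr0.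
Qed.

End DifferentiableFunctions.

(** * Flat functions and bumps on R^n *)

Section FlatFunction.
Variable R : realType.
Implicit Types (s : R) (p : nat).

(** The functions [s^-p * exp (- 1 / s)] for [s > 0]. All exponents are treated
    together because the derivative of one of them is a combination of the next
    two. *)
Definition flat p s : R := if 0 < s then s^-1 ^+ p * expR (- s^-1) else 0.

Lemma flat_ge0 p s : 0 <= flat p s.
Proof.
by rewrite /flat; case: ifP => // s0; rewrite mulr_ge0 ?expR_ge0// exprn_ge0// invr_ge0 ltW.
Qed.

Lemma flat0_gt0 s : 0 < s -> 0 < flat 0 s.
Proof. by move=> s0; rewrite /flat s0 expr0 mul1r expR_gt0. Qed.

Lemma flat_le0 p s : s <= 0 -> flat p s = 0.
Proof. by rewrite /flat ltNge => ->. Qed.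

(** One term of the exponential series gives a bound of order two, which is what
    differentiability at the origin requires. *)
Lemma flat_bound p s : flat p s <= (p.+2)`!%:R * s ^+ 2.
Proof.
rewrite /flat; case: ifPn => [s0|_]; last by rewrite mulr_ge0 ?ler0n ?sqr_ge0.
set y := s^-1; have y0 : 0 < y by rewrite invr_gt0.
have fy : (0 : R) < (p.+2)`!%:R by rewrite ltr0n fact_gt0.
have := expR_ge1Dxn p.+1 (ltW y0) => ey.
have {}ey : y ^+ p.+2 / p.+2`!%:R <= expR y by apply: le_trans ey; rewrite lerDr.
rewrite expRN ler_pdivrMr ?expR_gt0//.
have -> : y ^+ p = p.+2`!%:R * s ^+ 2 * (y ^+ p.+2 / p.+2`!%:R).
  rewrite /y !exprVn (exprS s p.+1) (exprS s p); field.
  by rewrite expf_neq0 ?gt_eqF.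
by rewrite ler_wpM2l// mulr_ge0 ?sqr_ge0// ltW.
Qed.

Lemma flat_is_derive p s :
  is_derive s 1 (flat p) (- p%:R * flat p.+1 s + flat p.+2 s).
Proof.
have [s0|s0|s0] := ltgtP s 0.
- have e : \near s, cst 0 s = flat p s.
    by near=> y; rewrite flat_le0//=; apply/ltW; near: y; exact: lt_nbhsl.
  rewrite !flat_le0 ?(ltW s0)// mulr0 addr0.
  by apply: near_eq_is_derive e _; exact: is_derive_cst.
- pose g (y : R) := y^-1 ^+ p * expR (- y^-1).
  have e : \near s, g s = flat p s.
    by near=> y; rewrite /flat ifT//; near: y; exact: lt_nbhsr.
  apply: near_eq_is_derive e _.
  have sn0 : s != 0 by rewrite gt_eqF.
  have dV : is_derive s (1 : R) (fun t : R => t^-1) (- s ^- 2).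
    apply: DeriveDef; first by apply: derivableV => //; exact: derivable_id.
    by rewrite deriveV// derive_id /GRing.scale/= mulr1.
  have dE : is_derive s (1 : R) (fun t : R => expR (- t^-1)) (s ^- 2 * expR (- s^-1)).
    apply: is_derive_eq; rewrite ?/GRing.scale/=.
    by rewrite opprK mulrC.
  have dP : is_derive s (1 : R) (fun t : R => t^-1 ^+ p)
      ((p%:R * s^-1 ^+ p.-1) *: - s ^- 2).
    have := @is_deriveX _ _ (fun t : R => t^-1) p _ _ _ dV; rewrite exprfctE.
    exact.
  have dg : is_derive s (1 : R) g
      (s^-1 ^+ p *: (s ^- 2 * expR (- s^-1)) +
       expR (- s^-1) *: ((p%:R * s^-1 ^+ p.-1) *: - s ^- 2)).
    exact: (@is_deriveM _ _ (fun t : R => t^-1 ^+ p) (fun t => expR (- t^-1))).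
  apply: (is_derive_eq dg); rewrite /flat s0 /GRing.scale/= -!exprVn.
  by case: (p) => [|q]; rewrite /= ?exprS; ring.
- (* at the origin the difference quotient is bounded by a multiple of |h| *)
  rewrite s0 !flat_le0// mulr0 addr0.
  suff c0 : (fun h : R => h^-1 *: ((flat p \o shift 0) (h *: 1) - flat p 0)) @ 0^' --> (0 : R).
    by apply: DeriveDef; [apply/cvg_ex; exists 0|exact/cvg_lim].
  apply/cvgr0Pnorm_lt => e e0.
  have C0 : (0 : R) < (p.+2)`!%:R by rewrite ltr0n fact_gt0.
  have h1 : \forall h \near (0 : R)^', `|h| < e / (p.+2)`!%:R.
    by apply: dnbhs0_lt; rewrite divr_gt0.
  near=> h.
  have hn0 : h != 0 by near: h; exact: nbhs_dnbhs_neq.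
  rewrite /= addr0 [X in _ - X]flat_le0// subr0 /GRing.scale/= mulr1 normrM normfV.
  rewrite ltr_pdivrMl ?normr_gt0// ger0_norm ?flat_ge0//.
  apply: le_lt_trans (flat_bound _ _) _.
  rewrite -[h ^+ 2]ger0_norm ?sqr_ge0// normrX expr2 mulrCA ltr_pM2l ?normr_gt0//.
  by rewrite mulrC -ltr_pdivlMr//; near: h.
Unshelve. all: by end_near. Qed.

End FlatFunction.

Section EuclideanBump.
Variables (R : realType) (n : nat).
Implicit Types (U : set 'rV[R]_n).

Lemma rV_coord_le (x : 'rV[R]_n) i : `|x ord0 i| <= `|x|.
Proof.
rewrite [leRHS]/Num.norm /= mx_normrE; apply/bigmax_geP; right => /=.
by exists (ord0, i).
Qed.

Lemma rV_norm_le (x : 'rV[R]_n) (r : R) : 0 <= r ->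
  (forall i, `|x ord0 i| <= r) -> `|x| <= r.
Proof.
move=> r0 xr; rewrite [leLHS]/Num.norm /= mx_normrE; apply/bigmax_leP; split=> //.
by case=> i j _ /=; rewrite ord1.
Qed.

Definition sqdist (a x : 'rV[R]_n) : R := \sum_i (x ord0 i - a ord0 i) ^+ 2.

Lemma Cinf_sqdist a k : Ck k setT (sqdist a).
Proof.
have C i : Ck k setT ((fun x : 'rV[R]_n => x ord0 i) - cst (a ord0 i)).
  by apply: CkD; [exact: openT|exact: Ck_coord|exact: (Ck_cst _ _ (- a ord0 i))].
apply: Ck_ext (Ck_sum (index_enum _) openT (fun i => CkM openT (C i) (C i))).
  exact: openT.
by move=> x _; rewrite fct_sumE; apply: eq_bigr => i _; rewrite expr2.
Qed.

Lemma coord_le_sqdist (a x : 'rV[R]_n) i : (x ord0 i - a ord0 i) ^+ 2 <= sqdist a x.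
Proof.
rewrite /sqdist (bigD1 i)//= lerDl sumr_ge0// => j _; exact: sqr_ge0.
Qed.

Lemma rV_bump (a : 'rV[R]_n) U : nbhs a U ->
  exists chi : 'rV[R]_n -> R, exists K,
  [/\ forall k, Ck k setT chi, compact K, K `<=` U,
      forall x, ~ K x -> chi x = 0 & \forall x \near a, chi x = 1].
Proof.
move=> /nbhs_ballP[e /= e0 eU].
pose r := e / 2; have r0 : 0 < r by rewrite divr_gt0.
have r2 : 0 < r ^+ 2 by rewrite exprn_gt0.
have Nc : continuous (sqdist a) by move=> x; exact: (Cinf_sqdist a 0).
have N0 : sqdist a a = 0.
  by rewrite /sqdist big1// => i _; rewrite subrr expr0n.
(* with N the squared distance to a and g the flat function, the quotient
   g (r^2 - N) / (g (r^2 - N) + g (N - r^2 / 2)) equals 1 where N <= r^2 / 2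
   and vanishes where N >= r^2; one of the two terms is always positive *)
pose u x := flat 0 (r ^+ 2 - sqdist a x).
pose v x := flat 0 (sqdist a x - r ^+ 2 / 2).
have flatC k (q : 'rV[R]_n -> R) : Ck k setT q -> Ck k setT (flat 0 \o q).
  move=> qC; have := Ck_comp_family (b := @flat R) (al := fun p => - p%:R)
    (be := fun=> 1) (D := setT) openT _ _ _ qC.
  apply=> // p s _; have ds := flat_is_derive p s; first exact: ex_derive.
  by rewrite derive1E derive_val mul1r.
have uC k : Ck k setT u.
  apply: flatC; apply: CkD; [exact: openT|exact: Ck_cst|apply: CkN => //].
    exact: openT.
  exact: Cinf_sqdist.
have vC k : Ck k setT v.
  apply: flatC; apply: (@CkD _ _ _ _ _ (cst (- (r ^+ 2 / 2)))) => //.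
  - exact: openT.
  - exact: Cinf_sqdist.
  - exact: Ck_cst.
have uv0 x : 0 < u x + v x.
  have [Nr|Nr] := ltP (sqdist a x) (r ^+ 2).
    by rewrite ltr_wpDr ?flat_ge0// flat0_gt0// subr_gt0.
  by rewrite ltr_wpDl ?flat_ge0// flat0_gt0// subr_gt0; lra.
exists (fun x => u x * (u x + v x)^-1), [set x | sqdist a x <= r ^+ 2].
split.
- move=> k; apply: CkM => //; first exact: openT.
  apply: Ck_inv; first exact: openT.
    by move=> x _; rewrite gt_eqF//; exact: uv0.
  by apply: CkD => //; exact: openT.
- apply: bounded_closed_compact.
    exists (`|a| + r); split; first exact: num_real.
    move=> M aM x /= xr; apply: le_trans (ltW aM).
    rewrite -(subrK a x) addrC; apply: le_trans (ler_normD _ _) _.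
    rewrite lerD2l; apply: rV_norm_le; first exact: ltW.
    move=> i; rewrite !mxE -ler_sqr ?nnegrE ?(ltW r0)// real_normK ?num_real//.
    exact: le_trans (coord_le_sqdist _ _ _) xr.
  by have /continuous_closedP/(_ _ (@closed_le _ (r ^+ 2))) := Nc.
- move=> x /= xr; apply: eU; rewrite -ball_normE /= distrC.
  apply: (@le_lt_trans _ _ r); last by rewrite /r; lra.
  apply: rV_norm_le; first exact: ltW.
  move=> i; rewrite !mxE -ler_sqr ?nnegrE ?(ltW r0)// real_normK ?num_real//.
  exact: le_trans (coord_le_sqdist _ _ _) xr.
- move=> x /= /negP; rewrite -ltNge => rx.
  by rewrite /u flat_le0 ?mul0r// subr_le0 ltW.
- have : \forall x \near a, sqdist a x < r ^+ 2 / 2.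
    by have /cvgr_lt := Nc a; apply; rewrite N0 divr_gt0.
  apply: filterS => x xr; have vx : v x = 0 by rewrite /v flat_le0 ?subr_le0 ?ltW.
  have := uv0 x; rewrite vx addr0 => ux.
  by rewrite mulfV// gt_eqF.
Qed.

End EuclideanBump.

(** * Hadamard's lemma *)

Section Hadamard.
Variables (R : realType).

Lemma MVT01 (F dF : R -> R) :
  (forall t : R, 0 <= t <= 1 -> is_derive t 1 F (dF t)) ->
  exists2 c, 0 <= c <= 1 & F 1 - F 0 = dF c.
Proof.
move=> dFt; have dF' (x : R) : x \in `[0, 1] -> is_derive x 1 F (dF x).
  by rewrite in_itv/=; exact: dFt.
have le01 : (0 : R) <= 1 by exact: ler01.
have dFo (x : R) : x \in `]0, 1[ -> is_derive x 1 F (dF x).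
  by move=> x01; apply: dF'; apply: subset_itv_oo_cc.
have cF : {within `[0, 1], continuous F}.
  apply: derivable_within_continuous => x x01.
  exact: (@ex_derive _ _ _ _ _ _ _ (dF' x x01)).
have [c c01 ->] := MVT_segment le01 dFo cF.
by exists c; [move: c01; rewrite in_itv/=|rewrite subr0 mulr1].
Qed.

Lemma sum_continuous (T : topologicalType) n (F : 'I_n -> T -> R) :
  (forall i, continuous (F i)) -> continuous (fun x => \sum_i F i x).
Proof.
move=> cF; apply: continuous_big => [|i _]; last exact: cF.
exact: add_continuous.
Qed.

Lemma term_le_sum n (F : 'I_n -> R) i : (forall j, 0 <= F j) -> F i <= \sum_j F j.
Proof. by move=> F0; rewrite (bigD1 i)//= lerDl sumr_ge0. Qed.

(** The lower bound [-1] leaves room for differentiability at both ends of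
    [0, 1]. *)
Definition primitive (phi : R -> R) (x : R) : R :=
  \int[@lebesgue_measure R]_(t in `[-1, x]) phi t.

Lemma primitive_is_derive (phi : R -> R) (x : R) : continuous phi -> -1 < x ->
  is_derive x 1 (primitive phi) (phi x).
Proof.
move=> cphi x1.
have iphi : (@lebesgue_measure R).-integrable `[-1, x + 1] (EFin \o phi).
  apply: continuous_compact_integrable; first exact: segment_compact.
  exact: continuous_subspaceT.
have xx1 : x < x + 1 by rewrite ltrDl.
have [dphi phiE] := continuous_FTC1_closed xx1 iphi x1 (cphi x).
by apply: (DeriveDef dphi); rewrite -derive1E.
Qed.

Definition int01 (phi : R -> R) : R := primitive phi 1 - primitive phi 0.

Lemma int01_eq (F phi : R -> R) : continuous phi ->
  (forall t : R, 0 <= t <= 1 -> is_derive t 1 F (phi t)) -> int01 phi = F 1 - F 0.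
Proof.
move=> cphi dF; have [|c _] := @MVT01 (primitive phi - F) (phi - phi).
  move=> t /andP[t0 t1]; apply: is_deriveB; last by apply: dF; rewrite t0.
  by apply: primitive_is_derive => //; apply: lt_le_trans t0; rewrite oppr_lt0.
rewrite subrr /= => /eqP.
rewrite -[X in X == _]/((primitive phi 1 - F 1) - (primitive phi 0 - F 0)) => /eqP e.
apply/eqP; rewrite -subr_eq0 /int01 -[X in _ == X]/((0 : R -> R) c) -e; apply/eqP.
ring.
Qed.

(** The mean value theorem, applied to the same combination of primitives. *)
Lemma int01_bound n (phi0 phi1 : R -> R) (psi : 'I_n -> R -> R) c (C : R) :
  continuous phi0 -> continuous phi1 -> (forall i, continuous (psi i)) ->
  (forall t : R, 0 <= t <= 1 ->
    `|phi1 t - phi0 t - \sum_i c i * psi i t| <= C) ->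
  `|int01 phi1 - int01 phi0 - \sum_i c i * int01 (psi i)| <= C.
Proof.
move=> c0 c1 cpsi bC.
pose F := primitive phi1 - primitive phi0 - \sum_i c i *: primitive (psi i).
have [|s s01] := @MVT01 F (phi1 - phi0 - \sum_i c i *: psi i).
  move=> t /andP[t0 t1]; have t1' : -1 < t by apply: lt_le_trans t0; rewrite oppr_lt0.
  have d1 := primitive_is_derive c1 t1'; have d0 := primitive_is_derive c0 t1'.
  have dp i := primitive_is_derive (cpsi i) t1'.
  have ds : is_derive t (1 : R) (\sum_i c i *: primitive (psi i))
      (\sum_i c i *: psi i t).
    by apply: is_derive_sum => i; exact: is_deriveZ (dp i).
  apply: (is_derive_eq (is_deriveB (is_deriveB d1 d0) ds)).
  by rewrite !fctE fct_sumE.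
have FE x : F x = primitive phi1 x - primitive phi0 x -
    \sum_i c i * primitive (psi i) x.
  by rewrite /F !fctE; congr (_ - _); rewrite fct_sumE.
rewrite !FE => e; have := bC s s01; congr (`| _ | <= C).
transitivity ((phi1 - phi0 - \sum_i c i *: psi i) s).
  by rewrite !fctE; congr (_ - _); rewrite fct_sumE.
rewrite -e /int01; under [in RHS]eq_bigr do rewrite mulrBr.
rewrite sumrB; ring.
Qed.

Variable n : nat.
Implicit Types (f g : 'rV[R]_n -> R) (a x y h : 'rV[R]_n).
Local Notation D i f := ('D_(delta_mx ord0 i) f).

Lemma derive_coords f y h : differentiable f y ->
  'd f y h = \sum_i h ord0 i * D i f y.
Proof.
move=> df; rewrite {1}[h]row_sum_delta linear_sum; apply: eq_bigr => i _.
by rewrite linearZ/= deriveE.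
Qed.

Lemma line_is_derive f y h (s : R) : differentiable f (y + s *: h) ->
  is_derive s 1 (fun s => f (y + s *: h)) (\sum_i h ord0 i * D i f (y + s *: h)).
Proof.
move=> df; pose l (s : R) : 'rV[R]_n := y + s *: h.
have dl : is_diff s l ((0 : R -> 'rV[R]_n) + *:%R^~ h).
  exact: is_diffD (is_diff_cst y s) (is_diff_scalel s h).
have dll : differentiable l s by [].
apply: DeriveDef.
  apply: diff_derivable; exact: (@differentiable_comp _ _ _ _ l f).
rewrite deriveE; last exact: (@differentiable_comp _ _ _ _ l f).
rewrite (@diff_comp _ _ _ _ l f)//= diff_val fctE scale1r add0r.
exact: derive_coords.
Qed.

(** Two applications of the mean value theorem on the segment from [y] to
    [y + h], first to [f] and then to its partial derivatives. *)
Lemma taylor2_bound f y h (C : R) : (forall k, Ck k setT f) ->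
  (forall i j s, 0 <= s <= 1 -> `|D j (D i f) (y + s *: h)| <= C) ->
  `|f (y + h) - f y - \sum_i h ord0 i * D i f y| <= n%:R ^+ 2 * C * `|h| ^+ 2.
Proof.
move=> fC bC; have fd z : differentiable f z by exact: (fC 1).1.
have fdd i z : differentiable (D i f) z by exact: ((fC 2).2 i).1.
have [c /andP[c0 c1]] := @MVT01 (fun s => f (y + s *: h))
  (fun s => \sum_i h ord0 i * D i f (y + s *: h)) (fun s _ => line_is_derive (fd _)).
rewrite scale1r scale0r addr0 => ->; rewrite -sumrB.
apply: le_trans (ler_norm_sum _ _ _) _.
have -> : n%:R ^+ 2 * C * `|h| ^+ 2 = \sum_(i < n) (n%:R * C * `|h| ^+ 2).
  by rewrite sumr_const card_ord -mulr_natl; ring.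
apply: ler_sum => i _; rewrite -mulrBr normrM.
have [s /andP[s0 s1]] := @MVT01 (fun s => D i f (y + s *: (c *: h)))
  (fun s => \sum_j (c *: h) ord0 j * D j (D i f) (y + s *: (c *: h)))
  (fun s _ => line_is_derive (fdd i _)).
rewrite scale1r scale0r addr0 => ->.
have -> : n%:R * C * `|h| ^+ 2 = `|h| * \sum_(j < n) `|h| * C.
  by rewrite sumr_const card_ord -mulr_natl; ring.
apply: ler_pM => //; first exact: rV_coord_le.
apply: le_trans (ler_norm_sum _ _ _) _; apply: ler_sum => j _.
rewrite normrM; apply: ler_pM => //.
  rewrite mxE normrM -[leRHS]mul1r; apply: ler_pM => //; last exact: rV_coord_le.
  by rewrite ger0_norm.
rewrite scalerA; apply: bC; rewrite mulr_ge0//=.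
by rewrite mulr_ile1.
Qed.

Lemma quadratic_differentiable g x (c : 'I_n -> R) (C : R) :
  (forall h, `|h| <= 1 ->
     `|g (x + h) - g x - \sum_i h ord0 i * c i| <= C * `|h| ^+ 2) ->
  differentiable g x /\ forall i, D i g x = c i.
Proof.
move=> gC; pose L h : R := \sum_i h ord0 i * c i.
have Ll : linear L.
  move=> a u v; rewrite /L scaler_sumr -big_split/=; apply: eq_bigr => i _.
  by rewrite !mxE mulrDl -mulrA.
pose LM := GRing.isLinear.Build _ _ _ _ _ Ll.
pose LL : {linear 'rV[R]_n -> R} := HB.pack L LM.
have Lc : continuous L.
  move=> z; have -> : L = \sum_i (fun h => h ord0 i * c i).
    by apply/funext => h; rewrite fct_sumE.
  elim/big_ind: _ => [|u v uc vc|i _]; [exact: cst_continuous|exact: continuousD|].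
  apply: continuousM; last exact: cst_continuous.
  exact: (Ck_coord 0 setT i).
have gE : g \o shift x = cst (g x) + L +o_ (0 : 'rV[R]_n) id.
  apply/eqaddoP => e e0.
  have C0 : 0 < `|C| + 1 by rewrite ltr_wpDl.
  have n1 : \forall h \near (0 : 'rV[R]_n), `|h| <= 1.
    exact: (@nbhs0_le _ 'rV[R]_n).
  have n2 : \forall h \near (0 : 'rV[R]_n), `|h| <= e / (`|C| + 1).
    by apply: (@nbhs0_le _ 'rV[R]_n); rewrite divr_gt0.
  apply: filterS2 n1 n2 => h h1 hC.
  rewrite !fctE /= opprD addrA [h + x]addrC; apply: le_trans (gC h h1) _.
  rewrite expr2 mulrA ler_wpM2r//.
  apply: (@le_trans _ _ ((`|C| + 1) * `|h|)).
    by rewrite ler_wpM2r//; apply: le_trans (ler_norm C) _; rewrite lerDl.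
  by rewrite mulrC -ler_pdivlMr.
have dE : 'd g x = LL :> ('rV[R]_n -> R).
  by apply: diff_unique => //; exact: Lc.
have gd : differentiable g x.
  by apply/diff_locallyP; rewrite dE; split => //; exact: Lc.
split=> // i; rewrite deriveE// dE /= /L (bigD1 i)//= big1 => [|j ji].
  by rewrite mxE !eqxx mul1r addr0.
by rewrite mxE (negbTE ji) mul0r.
Qed.

(** The weighted averages of [f] over the segments issued from [a]; the
    weights [t ^+ p] make this family stable under partial derivatives. *)
Definition ray_mean a p f x : R := int01 (fun t => t ^+ p * f (a + t *: (x - a))).

Lemma ray_continuous p f a x : (forall y, differentiable f y) ->
  continuous (fun t : R => t ^+ p * f (a + t *: (x - a))).
Proof.
move=> fd t; apply: cvgM; first exact: exprn_continuous.
have dl := line_is_derive (h := x - a) (s := t) (fd (a + t *: (x - a))).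
apply: differentiable_continuous; apply/derivable1_diffP.
exact: (@ex_derive _ _ _ _ _ _ _ dl).
Qed.

(** The second-order Taylor bound holds uniformly along the segments from [a],
    by compactness of a ball; integrating it exchanges differentiation and
    integral, with an error quadratic in the increment. The factor [t] produced
    by the chain rule raises the weight by one. *)
Lemma ray_mean_differentiable a p f x : (forall k, Ck k setT f) ->
  differentiable (ray_mean a p f) x /\
  forall i, D i (ray_mean a p f) x = ray_mean a p.+1 (D i f) x.
Proof.
move=> fC; have fd z : differentiable f z by exact: (fC 1).1.
have fdd i z : differentiable (D i f) z by exact: ((fC 2).2 i).1.
have fddc i j : continuous (D j (D i f)) by move=> z; exact: ((fC 2).2 i).2.
pose r := `|x - a| + 1.
pose K : set 'rV[R]_n := [set y | `|y - a| <= r].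
have cK : compact K.
  apply: bounded_closed_compact.
    exists (`|a| + r); split; first exact: num_real.
    move=> M aM y /= yr; apply: le_trans (ltW aM).
    rewrite -(subrK a y) addrC; apply: le_trans (ler_normD _ _) _.
    by rewrite lerD2l.
  have /continuous_closedP/(_ _ (@closed_le _ r)) : continuous (fun y : 'rV[R]_n => `|y - a|).
    move=> y; apply: (@continuous_comp _ _ _ (fun y => y - a) (fun y => `|y|)).
      by apply: continuousB; [exact: cvg_id|exact: cst_continuous].
    exact: norm_continuous.
  by [].
have [C [C0 bC]] : exists C, 0 <= C /\ forall y, K y -> forall i j, `|D j (D i f) y| <= C.
  pose S (y : 'rV[R]_n) := \sum_i \sum_j `|D j (D i f) y|.
  have cS : continuous S.
    apply: sum_continuous => i; apply: sum_continuous => j y.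
    apply: (@cvg_comp _ _ _ (D j (D i f)) (@Num.norm R R)); first exact: fddc.
    exact: norm_continuous.
  have K0 : K !=set0 by exists a; rewrite /K /= subrr normr0 /r addr_ge0.
  have [c _ Sc] := EVT_max_rV K0 cK (continuous_subspaceT cS).
  exists (S c); split=> [|y Ky i j].
    by apply: sumr_ge0 => i _; exact: sumr_ge0.
  apply: le_trans (Sc y (mem_set Ky)).
  apply: le_trans (term_le_sum (F := fun i => \sum_j `|D j (D i f) y|) i _).
    by apply: (term_le_sum (F := fun j => `|D j (D i f) y|)) => l.
  by move=> l; exact: sumr_ge0.
apply: (@quadratic_differentiable _ _ _ (n%:R ^+ 2 * C)) => h h1.
apply: (@int01_bound n _ _ (fun i t => t ^+ p.+1 * D i f (a + t *: (x - a)))).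
- exact: ray_continuous.
- exact: ray_continuous.
- by move=> i; apply: (@ray_continuous p.+1 (D i f)); exact: fdd.
move=> t /andP[t0 t1]; pose y := a + t *: (x - a).
have -> : a + t *: (x + h - a) = y + t *: h.
  by rewrite /y -[RHS]addrA -scalerDr addrAC.
have -> : t ^+ p * f (y + t *: h) - t ^+ p * f y -
    \sum_i h ord0 i * (t ^+ p.+1 * D i f y) =
    t ^+ p * (f (y + t *: h) - f y - \sum_i (t *: h) ord0 i * D i f y).
  rewrite !mulrBr; congr (_ - _); rewrite mulr_sumr; apply: eq_bigr => i _.
  by rewrite mxE exprSr; ring.
rewrite normrM normrX ger0_norm// -[leRHS]mul1r; apply: ler_pM => //.
- exact: exprn_ge0.
- by rewrite exprn_ile1.
have nM (z w : R) : 0 <= z -> z <= 1 -> w <= 1 -> 0 <= w -> `|z| * w <= 1.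
  by move=> z0 z1 w1 w0; rewrite ger0_norm// mulr_ile1.
apply: (@le_trans _ _ (n%:R ^+ 2 * C * `|t *: h| ^+ 2)).
  apply: taylor2_bound => // i j s /andP[s0 s1].
  apply: bC; rewrite /K /= /y addrAC [a + _]addrC addrK.
  apply: le_trans (ler_normD _ _) _; rewrite /r !normrZ lerD//.
    by rewrite ger0_norm// ler_piMl.
  by apply: (nM) => //; exact: nM.
rewrite normrZ ger0_norm// exprMn ler_wpM2l ?mulr_ge0 ?exprn_ge0//.
by rewrite ler_piMl ?exprn_ge0// exprn_ile1.
Qed.

Lemma ray_mean_smooth a p f k : (forall l, Ck l setT f) ->
  Ck k setT (ray_mean a p f).
Proof.
elim: k p f => [|k IH] p f fC.
  by move=> x _; apply: differentiable_continuous; case: (ray_mean_differentiable a p x fC).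
split=> [x _|i]; first by case: (ray_mean_differentiable a p x fC).
have -> : D i (ray_mean a p f) = ray_mean a p.+1 (D i f).
  by apply/funext => x; case: (ray_mean_differentiable a p x fC) => _ ->.
by apply: IH => l; exact: (fC l.+1).2.
Qed.

(** The functions [g i] are the averages of the partial derivatives over the
    segment from [a] to [x], so the identity is the fundamental theorem of
    calculus along that segment. *)
Lemma hadamard a f : (forall k, Ck k setT f) ->
  exists g : 'I_n -> 'rV[R]_n -> R,
  [/\ forall i k, Ck k setT (g i), forall i, g i a = D i f a &
      forall x, f x = f a + \sum_i (x ord0 i - a ord0 i) * g i x].
Proof.
move=> fC; have fd z : differentiable f z by exact: (fC 1).1.
have fdd i z : differentiable (D i f) z by exact: ((fC 2).2 i).1.
have dC i k : Ck k setT (D i f) by exact: (fC k.+1).2.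
have ec i x := ray_continuous (p := 0) (a := a) (x := x) (fdd i).
exists (fun i => ray_mean a 0 (D i f)); split.
- by move=> i k; exact: ray_mean_smooth.
- move=> i.
  have dt (t : R) : is_derive t (1 : R) (fun t : R => t * D i f a)
      (t ^+ 0 * D i f (a + t *: (a - a))).
    have := @is_deriveM _ _ (fun t : R => t) (cst (D i f a)) _ _ _ _
      (is_derive_id t (1 : R)) (is_derive_cst (D i f a) t (1 : R)).
    by rewrite scaler0 add0r subrr scaler0 addr0 expr0 /GRing.scale/= mulr1 mul1r.
  by rewrite /ray_mean (int01_eq (ec i a) (fun t _ => dt t)) mul1r mul0r subr0.
- move=> x; apply/eqP; rewrite addrC -subr_eq; apply/eqP.
  have dl (t : R) := line_is_derive (h := x - a) (s := t) (fd (a + t *: (x - a))).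
  pose G t := \sum_i (x - a) ord0 i * (t ^+ 0 * D i f (a + t *: (x - a))).
  have cG : continuous G.
    apply: sum_continuous => i t.
    by apply: cvgM; [exact: cvg_cst|exact: ec].
  have := @int01_bound n (cst 0) G
    (fun i t => t ^+ 0 * D i f (a + t *: (x - a))) (fun i => (x - a) ord0 i) 0.
  have -> : int01 (cst 0) = 0 :> R.
    have c0 : continuous (cst (0 : R) : R -> R) by exact: cst_continuous.
    by rewrite (int01_eq c0 (fun t _ => is_derive_cst (0 : R) t (1 : R))) subrr.
  have -> : int01 G = f x - f a.
    have dG (t : R) : is_derive t (1 : R) (fun t => f (a + t *: (x - a))) (G t).
      apply: (is_derive_eq (dl t)); apply: eq_bigr => i _.
      by rewrite expr0 mul1r.
    rewrite (int01_eq cG (fun t _ => dG t)).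
    by rewrite scale1r scale0r addr0 [a + _]addrC subrK.
  move=> H; have {H} : `|f x - f a - 0 - \sum_i (x - a) ord0 i *
      ray_mean a 0 (D i f) x| <= 0.
    apply: H => //; first exact: cst_continuous.
    by move=> t _; rewrite /G /= subr0 subrr normr0.
  rewrite normr_le0 subr0 subr_eq0 => /eqP ->.
  by apply: eq_bigr => i _; rewrite !mxE.
Qed.

End Hadamard.

(** * Bump functions and locality on a manifold *)

Section ManifoldCalculus.
Variables (R : realType) (n : nat) (M : manifold R n).
Implicit Types (m p : M) (U : set M) (f g : smooth_fun M).
Local Notation smooth_fun := (smooth_fun M).

Lemma smooth_on_chart (c : chart R n M) (g : 'rV[R]_n -> R) : atlas c ->
  (forall k, Ck k (cmap c @` cdom c) g) -> smooth_on (cdom c) (g \o cmap c).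
Proof.
move=> ac gC c' ac' k.
have oU := chart_open (c := c') (cdom_open c).
apply: (Ck_comp (g := fun x => cmap c (cinv c' x)) oU _ _ (gC k)) => [x|i].
  by move=> [p [c'p cp] <-]; exists p => //; rewrite cmapK.
exact: atlas_compat.
Qed.

(** The intersections of [V] with [U] and with the complement of [K] are open and
    cover [V]; [f] is smooth on the first and zero on the second. *)
Lemma smooth_cutoff U V (K : set M) (f : M -> R) : open U -> open V ->
  closed K -> K `<=` U -> (forall p, V p -> ~ K p -> f p = 0) ->
  smooth_on (U `&` V) f -> smooth_on V f.
Proof.
move=> oU oV cK KU f0 fU; apply: smooth_on_loc => p Vp.
have [Kp|nKp] := pselect (K p); first by exists (U `&` V) => //; split=> //; exact: KU.
exists (V `&` ~` K) => //; apply: smooth_on_ext (smooth_on_cst _ 0).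
  by apply: openI => //; rewrite openC.
by move=> q [Vq /(f0 q Vq)].
Qed.

Definition from_chart (c : chart R n M) (g : 'rV[R]_n -> R) (p : M) : R :=
  if `[< cdom c p >] then g (cmap c p) else 0.

Lemma from_chartE c (g : 'rV[R]_n -> R) p : cdom c p -> from_chart c g p = g (cmap c p).
Proof. by move=> cp; rewrite /from_chart asboolT. Qed.

(** The image is compact, hence closed because the manifold is Hausdorff; this is
    what allows extension by zero outside a chart. *)
Lemma chart_image_closed c (K : set 'rV[R]_n) :
  compact K -> K `<=` cmap c @` cdom c -> closed (cinv c @` K : set M).
Proof.
move=> cK KW; apply: compact_closed; first exact: mhausdorff.
apply: continuous_compact => //; apply: continuous_in_subspaceT => x.
by rewrite inE => /KW[p cp <-]; exact: cinv_cont.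
Qed.

Lemma from_chart_smooth c (g : 'rV[R]_n -> R) (K : set 'rV[R]_n) : atlas c -> compact K ->
  K `<=` cmap c @` cdom c -> (forall x, ~ K x -> g x = 0) ->
  (forall k, Ck k (cmap c @` cdom c) g) -> smooth_on setT (from_chart c g).
Proof.
move=> ac cK KW g0 gC.
have oc := cdom_open c.
apply: (smooth_cutoff oc openT (chart_image_closed cK KW)).
- by move=> _ [x /[dup] Kx /KW[p cp <-] <-]; rewrite cmapK.
- move=> p _ nKp; rewrite /from_chart; case: ifPn => // /asboolP cp.
  by apply: g0 => Kp; apply: nKp; exists (cmap c p) => //; rewrite cmapK.
- rewrite setIT; apply: smooth_on_ext (smooth_on_chart ac gC) => // p cp.
  by rewrite from_chartE.
Qed.

Lemma smooth_bump (m : M) U : nbhs m U ->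
  exists chi : smooth_fun, exists K, [/\ closed K, K `<=` U,
    forall p, ~ K p -> ssval chi p = 0 & \forall p \near m, ssval chi p = 1].
Proof.
rewrite nbhsE => -[V [oV Vm] VU].
have [c ac cm] := atlas_cover m.
have nW : nbhs (cmap c m) (cmap c @` (cdom c `&` V)).
  by apply: open_nbhs_nbhs; split; [exact: chart_open|exists m].
have [chi [K [chiC cK KW chi0 chi1]]] := rV_bump nW.
have KW' : K `<=` cmap c @` cdom c by move=> _ /KW[p [cp _] <-]; exists p.
have sC : smooth_on setT (from_chart c chi).
  apply: from_chart_smooth cK KW' chi0 _ => // k.
  exact: Ck_sub (chiC k).
exists (mksub smooth_fun _ sC), (cinv c @` K); split.
- exact: chart_image_closed.
- by move=> _ [x /KW[p [cp Vp] <-] <-]; rewrite cmapK//; exact: VU.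
- move=> p nKp /=; rewrite /from_chart; case: ifPn => // /asboolP cp.
  by apply: chi0 => Kp; apply: nKp; exists (cmap c p) => //; rewrite cmapK.
- have ncm : nbhs m (cdom c) by apply: open_nbhs_nbhs; split=> //; exact: cdom_open.
  have := cmap_cont cm chi1; rewrite /= => h.
  by apply: filterS2 ncm h => p cp /= <-; rewrite from_chartE.
Qed.

Definition cst_fun (a : R) : smooth_fun :=
  mksub smooth_fun (fun=> a) (smooth_on_cst _ a).

Lemma tangentD m (v : tangent m) f g : ssval v (f + g) = ssval v f + ssval v g.
Proof. by rewrite -[f]scale1r (ssvalP v).1 !scale1r. Qed.

Lemma tangent_cst m (v : tangent m) a : ssval v (cst_fun a) = 0.
Proof.
have v1 : ssval v (cst_fun 1) = 0.
  have := (ssvalP v).2 (cst_fun 1) (cst_fun 1).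
  have -> : sfmul (cst_fun 1) (cst_fun 1) = cst_fun 1.
    by apply: subspace_of_inj; apply/funext => p /=; rewrite mulr1.
  by rewrite /= !mul1r => /eqP; rewrite -subr_eq subrr eq_sym => /eqP.
have -> : cst_fun a = a *: cst_fun 1.
  apply: subspace_of_inj; rewrite ssvalZ; apply/funext => p.
  by rewrite /= -[RHS]/(a * 1) mulr1.
by rewrite linear_atZ ?v1 ?scaler0//; exact: (ssvalP v).1.
Qed.

(** Multiply [f] by a bump at [m] supported where [f] vanishes, and apply the
    Leibniz rule to the product, which is zero. *)
Lemma tangent_near0 m (v : tangent m) f :
  (\forall p \near m, ssval f p = 0) -> ssval v f = 0.
Proof.
move=> f0; have [chi [K [_ K0 chi0 chi1]]] := smooth_bump f0.
have e : sfmul chi f = 0.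
  apply: subspace_of_inj; rewrite ssval0; apply/funext => p /=.
  rewrite -[RHS]/(0 : R).
  by have [/K0 ->|/chi0 ->] := pselect (K p); rewrite ?mulr0 ?mul0r.
have := (ssvalP v).2 chi f.
rewrite e linear_at0; last exact: (ssvalP v).1.
by rewrite (nbhs_singleton chi1) (nbhs_singleton f0) mul1r mul0r addr0.
Qed.

Lemma tangent_near_eq m (v : tangent m) f g :
  (\forall p \near m, ssval f p = ssval g p) -> ssval v f = ssval v g.
Proof.
move=> fg; have -> : f = (f - g) + g by rewrite subrK.
rewrite tangentD tangent_near0 ?add0r//.
apply: filterS fg => p fgp; rewrite -scaleN1r addrC ssvalZD.
by rewrite -[LHS]/(-1 * ssval g p + ssval f p) fgp mulN1r addNr.
Qed.

Lemma tangent_sum m (v : tangent m) (I : Type) (r : seq I) (F : I -> smooth_fun) :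
  ssval v (\sum_(i <- r) F i) = \sum_(i <- r) ssval v (F i).
Proof.
elim: r => [|i r IH]; first by rewrite !big_nil linear_at0//; exact: (ssvalP v).1.
by rewrite !big_cons tangentD IH.
Qed.

Lemma tangent_sumE m (I : Type) (r : seq I) (w : I -> tangent m) f :
  ssval (\sum_(i <- r) w i) f = \sum_(i <- r) ssval (w i) f.
Proof.
elim: r => [|i r IH]; first by rewrite !big_nil ssval0.
by rewrite !big_cons -IH ssvalD.
Qed.

End ManifoldCalculus.

(** * Coordinates near a point *)

Section Coordinates.
Variables (R : realType) (n : nat) (M : manifold R n).
Implicit Types (m p : M) (f g : smooth_fun M).
Local Notation smooth_fun := (smooth_fun M).
Local Notation D i f := ('D_(delta_mx ord0 i) f).

Lemma Gamma_ext (B : bundle M) (X Y : Gamma B) :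
  (forall m, ssval X m = ssval Y m) -> X = Y.
Proof.
by move=> XY; apply: subspace_of_inj; exact: functional_extensionality_dep.
Qed.

Lemma Gamma_addE (B : bundle M) (X Y : Gamma B) m :
  ssval (X + Y) m = ssval X m + ssval Y m.
Proof. by rewrite ssvalD. Qed.

Lemma Gamma_scaleE (B : bundle M) a (X : Gamma B) m :
  ssval (a *: X) m = a *: ssval X m.
Proof. by rewrite ssvalZ. Qed.

Lemma Gamma_zeroE (B : bundle M) m : ssval (0 : Gamma B) m = 0.
Proof. by rewrite ssval0. Qed.

Lemma Gamma_oppE (B : bundle M) (X : Gamma B) m : ssval (- X) m = - ssval X m.
Proof.
by apply: (addIr (ssval X m)); rewrite -Gamma_addE !addNr Gamma_zeroE.
Qed.

Lemma Gamma_sumE (B : bundle M) (I : Type) (r : seq I) (F : I -> Gamma B) m :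
  ssval (\sum_(i <- r) F i) m = \sum_(i <- r) ssval (F i) m.
Proof.
elim: r => [|i r IH]; first by rewrite !big_nil Gamma_zeroE.
by rewrite !big_cons Gamma_addE IH.
Qed.

Lemma sf_addE f g m : ssval (f + g) m = ssval f m + ssval g m.
Proof. by rewrite ssvalD. Qed.

Lemma sf_sumE (I : Type) (r : seq I) (F : I -> smooth_fun) m :
  ssval (\sum_(i <- r) F i) m = \sum_(i <- r) ssval (F i) m.
Proof.
elim: r => [|i r IH]; first by rewrite !big_nil ssval0.
by rewrite !big_cons sf_addE IH.
Qed.

(** Globally defined functions and vector fields which behave like local
    coordinates and the associated partial derivatives near [m0]. *)
Record coordinates m0 := Coordinates {
  co_fun : 'I_n -> smooth_fun;
  co_field : 'I_n -> Gamma (tangent_bundle M);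
  coordinatesP : \forall m \near m0, forall (v : tangent m) f,
    ssval v f = \sum_i ssval v (co_fun i) * ssval (ssval (co_field i) m) f
}.

Section ChartField.
Variables (c : chart R n M) (chi : 'rV[R]_n -> R) (K : set 'rV[R]_n).
Hypotheses (ac : atlas c) (chiC : forall k, Ck k setT chi) (cK : compact K)
  (KW : K `<=` cmap c @` cdom c) (chi0 : forall x, ~ K x -> chi x = 0).
Variable i : 'I_n.

Definition chart_partial p f : R :=
  from_chart c (fun x => chi x * D i (ssval f \o cinv c) x) p.

Lemma chart_fun_Ck f k : Ck k (cmap c @` cdom c) (ssval f \o cinv c).
Proof. by have := ssvalP f c ac k; rewrite setIT. Qed.

Fact chart_partial_derivation p : is_derivation p (chart_partial p : _ -> R^o).
Proof.
rewrite /chart_partial /from_chart; case: (pselect (cdom c p)) => [cp|ncp]; last first.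
  rewrite asboolF//.
  by split=> [a f g|f g] /=; rewrite ?scaler0 ?mulr0 addr0.
rewrite asboolT//.
have dc f : derivable (ssval f \o cinv c) (cmap c p) (delta_mx ord0 i).
  by apply: diff_derivable; apply: (chart_fun_Ck f 1).1; exists p.
split=> [a f g|f g] /=.
  have -> : ssval (a *: f + g) \o cinv c =
      a *: (ssval f \o cinv c) + (ssval g \o cinv c) by rewrite ssvalZD.
  rewrite deriveD ?deriveZ//; last exact: derivableZ.
  by rewrite mulrDr /GRing.scale/= mulrCA.
have -> : ssval (sfmul f g) \o cinv c =
    (ssval f \o cinv c) * (ssval g \o cinv c) by [].
by rewrite deriveM// /GRing.scale/= !cmapK//; ring.
Qed.

Fact chart_field_smooth :
  bsmooth (tangent_bundle M) (fun p => mksub (tangent p) _ (chart_partial_derivation p)).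
Proof.
move=> f; apply: (from_chart_smooth ac cK KW) => [x /chi0 ->|k].
  by rewrite mul0r.
apply: CkM; first by have := chart_open (c := c) openT; rewrite setIT.
  by apply: Ck_sub (chiC k).
exact: (chart_fun_Ck f k.+1).2.
Qed.

Definition chart_field : Gamma (tangent_bundle M) := mksub _ _ chart_field_smooth.

Fact chart_coord_smooth :
  smooth_on setT (from_chart c (fun x => chi x * x ord0 i)).
Proof.
apply: (from_chart_smooth ac cK KW) => [x /chi0 ->|k]; first by rewrite mul0r.
apply: CkM; first by have := chart_open (c := c) openT; rewrite setIT.
  by apply: Ck_sub (chiC k).
exact: Ck_coord.
Qed.

Definition chart_coord : smooth_fun := mksub smooth_fun _ chart_coord_smooth.

End ChartField.

(** By Hadamard's lemma, [f - f m] is near [m] a sum of products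
    [(x_i - x_i m) * g_i] with [g_i m] the [i]-th partial derivative, and the
    Leibniz rule evaluates a derivation at [m] on such a product as
    [g_i m * v x_i]. *)
Lemma coordinates_exist m0 : inhabited (coordinates m0).
Proof.
have [c ac cm0] := atlas_cover m0.
have oW : open (cmap c @` cdom c) by have := chart_open (c := c) openT; rewrite setIT.
have nW : nbhs (cmap c m0) (cmap c @` cdom c).
  by apply: open_nbhs_nbhs; split=> //; exists m0.
have [chi [K [chiC cK KW chi0 chi1]]] := rV_bump nW.
constructor; apply: (@Coordinates m0 (chart_coord ac chiC cK KW chi0)
  (chart_field ac chiC cK KW chi0)).
have nc : nbhs m0 (cdom c) by apply: open_nbhs_nbhs; split=> //; exact: cdom_open.
have := cmap_cont cm0 (nbhs_interior chi1); rewrite /= => chi1M.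
apply: filterS2 nc chi1M => m cm chi1m v f.
pose a := cmap c m; have chia : chi a = 1 by exact: nbhs_singleton chi1m.
(* F is f read in the chart, cut off so as to be smooth on the whole of R^n *)
pose F x := chi x * (ssval f \o cinv c) x.
have FC k : Ck k setT F.
  apply: Ck_loc => x _; have [Kx|nKx] := pselect (K x).
    exists (cmap c @` cdom c); first exact: KW.
    apply: CkM => //; last exact: chart_fun_Ck.
    exact: Ck_sub (chiC k).
  exists (~` K) => //; apply: Ck_ext (Ck_cst _ _ 0).
    by rewrite openC; apply: compact_closed => //; exact: norm_hausdorff.
  by move=> y /chi0 chiy; rewrite /F chiy mul0r.
have [g [gC ga FE]] := hadamard a FC.
have GC i : smooth_on setT (from_chart c (fun x => chi x * g i x)).
  apply: (from_chart_smooth ac cK KW) => [x /chi0 ->|k]; first by rewrite mul0r.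
  apply: CkM => //; first exact: Ck_sub (chiC k).
  exact: Ck_sub (gC i k).
pose G i : smooth_fun := mksub smooth_fun _ (GC i).
pose Z i : smooth_fun := chart_coord ac chiC cK KW chi0 i + cst_fun M (- a ord0 i).
have ZE i p : cdom c p -> ssval (Z i) p = chi (cmap c p) * cmap c p ord0 i - a ord0 i.
  by move=> cp; rewrite /Z sf_addE /= from_chartE.
have Zm i : ssval (Z i) m = 0 by rewrite ZE// -/a chia mul1r subrr.
have vZ i : ssval v (Z i) = ssval v (chart_coord ac chiC cK KW chi0 i).
  by rewrite /Z tangentD tangent_cst addr0.
have fE : \forall p \near m, ssval f p =
    ssval (cst_fun M (ssval f m) + \sum_i sfmul (Z i) (G i)) p.
  have ncm : nbhs m (cdom c) by apply: open_nbhs_nbhs; split=> //; exact: cdom_open.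
  have chi1m' : \forall p \near m, chi (cmap c p) = 1 := cmap_cont cm chi1m.
  apply: filterS2 ncm chi1m' => p cp chip.
  have := FE (cmap c p); rewrite /F chip mul1r chia mul1r.
  rewrite -![(ssval f \o cinv c) _]/(ssval f (cinv c _)) !cmapK// => ->.
  rewrite sf_addE sf_sumE; congr (_ + _); apply: eq_bigr => i _.
  rewrite -[RHS]/(ssval (Z i) p * from_chart c (fun x => chi x * g i x) p).
  by rewrite ZE// from_chartE// chip !mul1r.
rewrite (tangent_near_eq v fE) tangentD tangent_cst add0r tangent_sum.
apply: eq_bigr => i _; rewrite (ssvalP v).2 Zm mul0r add0r mulrC vZ.
congr (_ * _); rewrite /= /chart_partial !from_chartE// -/a chia !mul1r ga.
apply: near_eq_derive; apply: filterS chi1m => x chix.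
by rewrite /F chix mul1r.
Qed.

End Coordinates.

(** * Local frames, symbols and derivations of a vector bundle *)

Section BundleCalculus.
Variables (R : realType) (n : nat) (M : manifold R n).
Variables (k : nat) (E : vector_bundle M k).
Local Notation smooth_fun := (smooth_fun M).
Local Notation vfield := (Gamma (tangent_bundle M)).
Local Notation sectionE := (Gamma (vbundle E)).
Local Notation sectionD := (Gamma (gauge_bundle E)).
Local Notation sectionJ := (Gamma (jet_bundle E)).
Implicit Types (m p : M) (f g : smooth_fun) (u : sectionE).

Lemma fsecE f u m : ssval (fsec f u) m = ssval f m *: ssval u m.
Proof. by []. Qed.

Lemma smooth_section_loc (w : dsec (fiber E)) :
  (forall m, exists u, \forall p \near m, w p = ssval u p) -> smooth_section w.
Proof.
move=> wu t et j; apply: smooth_on_loc => m tm; have [u /nbhs_interior uE] := wu m.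
have := open_nbhs_nbhs (conj (tdom_open t) tm) => nt.
exists (tdom t `&` (fun p => w p = ssval u p)°).
  by split=> //; exact: nbhs_singleton uE.
have oV : open (tdom t `&` (fun p => w p = ssval u p)°).
  by apply: openI; [exact: tdom_open|exact: open_interior].
apply: smooth_on_ext (smooth_onS _ (ssvalP u t et j)) => //.
by move=> p [_ /interior_subset ->].
Qed.

(** Global sections that form a frame near [m0], with globally defined linear
    coordinates; multiplying by cut-off functions makes the reconstruction
    formula hold everywhere, up to a function equal to [1] near [m0]. *)
Record frame m0 := Frame {
  fr_vec : 'I_k -> sectionE;
  fr_coef : forall m, 'I_k -> fiber E m -> R^o;
  fr_coef_linear : forall m j, linear (@fr_coef m j);
  fr_coef_smooth : forall u j, smooth_on setT (fun m => fr_coef j (ssval u m));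
  fr_cut : smooth_fun;
  frameP : forall m (w : fiber E m),
    \sum_j fr_coef j w *: ssval (fr_vec j) m = ssval fr_cut m *: w;
  fr_cut1 : \forall m \near m0, ssval fr_cut m = 1
}.

Lemma frame_exist m0 : inhabited (frame m0).
Proof.
have [t et tm0] := trivs_cover E m0.
have ot := tdom_open t.
have [chi [K [cK KU chi0 chi1]]] := smooth_bump (open_nbhs_nbhs (conj ot tm0)).
have eS j : smooth_section (fun m => ssval chi m *: tinv t m (delta_mx ord0 j) : fiber E m).
  move=> t' et' i; have ot' := tdom_open t'.
  apply: (smooth_cutoff ot ot' cK KU) => [p t'p /chi0 ->|].
    by rewrite scale0r (linear_at0 (tmap_linear t'p)) mxE.
  apply: smooth_on_ext (smooth_onM (openI ot ot')
    (smooth_onS (@subsetT _ _) (ssvalP chi)) (trivs_compat et et' j i)).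
    exact: openI.
  by move=> p [_ t'p]; rewrite (linear_atZ _ _ (tmap_linear t'p)) mxE.
have cS u j : smooth_on setT (fun m => ssval chi m * tmap t (ssval u m) ord0 j).
  apply: (smooth_cutoff ot openT cK KU) => [p _ /chi0 ->|]; first by rewrite mul0r.
  rewrite setIT; apply: (smooth_onM ot _ (ssvalP u t et j)).
  exact: smooth_onS (@subsetT _ _) (ssvalP chi).
have chi_tdom m : ssval chi m = 0 \/ tdom t m.
  by have [/KU|/chi0] := pselect (K m); [right|left].
constructor; apply: (@Frame m0
  (fun j => mksub (bsmooth (vbundle E)) _ (eS j))
  (fun m j w => ssval chi m * tmap t w ord0 j) _ cS (sfmul chi chi)).
- move=> m j a v w; have [->|tm] := chi_tdom m.
    by rewrite !mul0r scaler0 addr0.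
  by rewrite (tmap_linear tm) !mxE mulrDr /GRing.scale/= mulrCA.
- move=> m w /=; have [->|tm] := chi_tdom m.
    by rewrite mul0r scale0r big1// => j _; rewrite mul0r scale0r.
  rewrite {2}[w](triv_expand tm _ (L := id))// scaler_sumr.
  by apply: eq_bigr => j _; rewrite !scalerA; congr (_ *: _); ring.
- by apply: filterS chi1 => m /= ->; rewrite mulr1.
Qed.

Definition coef_fun m0 (fr : frame m0) j u : smooth_fun :=
  mksub smooth_fun (fun m => fr_coef fr j (ssval u m)) (fr_coef_smooth fr u j).

Lemma coef_fun_fsec m0 (fr : frame m0) j f u :
  coef_fun fr j (fsec f u) = sfmul f (coef_fun fr j u).
Proof.
apply: subspace_of_inj; apply/funext => m.
exact: (linear_atZ _ _ (fr_coef_linear _ _)).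
Qed.

Lemma coef_fun_linear m0 (fr : frame m0) j : linear (coef_fun fr j).
Proof.
move=> a u w; apply: subspace_of_inj; apply/funext => m.
exact: fr_coef_linear.
Qed.

Lemma frame_cut_near m0 (fr : frame m0) :
  \forall m \near m0, \forall p \near m, ssval (fr_cut fr) p = 1.
Proof. exact: nbhs_interior (fr_cut1 fr). Qed.

Lemma vector_extend m (w : fiber E m) : exists u, ssval u m = w.
Proof.
have [fr] := frame_exist m; exists (\sum_j fr_coef fr j w *: fr_vec fr j).
rewrite Gamma_sumE; under eq_bigr do rewrite Gamma_scaleE.
by rewrite frameP (nbhs_singleton (fr_cut1 fr)) scale1r.
Qed.

Lemma fiber_trivial m (w : fiber E m) : k = 0%N -> w = 0.
Proof.
move=> k0; have [t et tm] := trivs_cover E m.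
apply: (can_inj (tmapK tm)); apply/rowP => -[i ik].
by exfalso; move: ik; rewrite k0.
Qed.

Lemma fiber_nontrivial m : (0 < k)%N -> exists w : fiber E m, w != 0.
Proof.
move=> k0; have [t et tm] := trivs_cover E m.
exists (tinv t m (delta_mx ord0 (Ordinal k0))); apply/eqP => w0.
have := tinvK tm (delta_mx ord0 (Ordinal k0)).
rewrite w0 (linear_at0 (tmap_linear tm)) => /matrixP/(_ ord0 (Ordinal k0)).
by rewrite !mxE !eqxx => /eqP; rewrite eq_sym oner_eq0.
Qed.

Definition is_symbol m (d : gauge E m) (v : tangent m) : Prop :=
  forall f u, ssval d (fsec f u) = ssval f m *: ssval d u + ssval v f *: ssval u m.

Lemma gaugeD m (d : gauge E m) (u w : sectionE) : ssval d (u + w) = ssval d u + ssval d w.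
Proof. by rewrite -[u]scale1r (ssvalP d).1 !scale1r. Qed.

Lemma gauge0 m (d : gauge E m) : ssval d 0 = 0.
Proof. by rewrite linear_at0//; exact: (ssvalP d).1. Qed.

Lemma gaugeB m (d : gauge E m) (u w : sectionE) : ssval d (u - w) = ssval d u - ssval d w.
Proof. by apply: (addIr (ssval d w)); rewrite -gaugeD !subrK. Qed.

Lemma gauge_sum m (d : gauge E m) (I : Type) (r : seq I) (F : I -> sectionE) :
  ssval d (\sum_(i <- r) F i) = \sum_(i <- r) ssval d (F i).
Proof.
elim: r => [|i r IH]; first by rewrite !big_nil gauge0.
by rewrite !big_cons gaugeD IH.
Qed.

Lemma gauge_near0 m (d : gauge E m) u :
  (\forall p \near m, ssval u p = 0) -> ssval d u = 0.
Proof.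
move=> u0; have [chi [K [_ K0 chi0 chi1]]] := smooth_bump u0.
have e : fsec chi u = 0.
  apply: Gamma_ext => p; rewrite fsecE Gamma_zeroE.
  by have [/K0 ->|/chi0 ->] := pselect (K p); rewrite ?scaler0 ?scale0r.
have [_ [v dv]] := ssvalP d; have := dv chi u.
by rewrite e gauge0 (nbhs_singleton chi1) (nbhs_singleton u0) scale1r scaler0 addr0.
Qed.

Lemma gauge_near_eq m (d : gauge E m) (u w : sectionE) :
  (\forall p \near m, ssval u p = ssval w p) -> ssval d u = ssval d w.
Proof.
move=> uw; apply/eqP; rewrite -subr_eq0 -gaugeB gauge_near0//.
by apply: filterS uw => p e; rewrite Gamma_addE Gamma_oppE e subrr.
Qed.

(** Near [m] the section [u] is the combination of the frame with coefficients
    [coef_fun fr j u]; expand [d] by locality and the Leibniz rule. *)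
Lemma gauge_expand m0 (fr : frame m0) m (d : gauge E m) v u :
  (\forall p \near m, ssval (fr_cut fr) p = 1) -> is_symbol d v ->
  ssval d u = \sum_j (fr_coef fr j (ssval u m) *: ssval d (fr_vec fr j) +
                      ssval v (coef_fun fr j u) *: ssval (fr_vec fr j) m).
Proof.
move=> cut1 dv.
have uE : \forall p \near m,
    ssval u p = ssval (\sum_j fsec (coef_fun fr j u) (fr_vec fr j)) p.
  apply: filterS cut1 => p cutp; rewrite Gamma_sumE.
  by rewrite -[LHS]scale1r -cutp -frameP.
rewrite (gauge_near_eq d uE) gauge_sum; apply: eq_bigr => j _.
exact: dv.
Qed.

Lemma symbol_uniq m (d : gauge E m) v w :
  (0 < k)%N -> is_symbol d v -> is_symbol d w -> v = w.
Proof.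
move=> k0 dv dw; have [x x0] := fiber_nontrivial m k0.
have [u ux] := vector_extend x.
apply: subspace_of_inj; apply/funext => f.
have := dv f u; rewrite dw ux => /addrI/eqP.
by rewrite -subr_eq0 -scalerBl scaler_eq0 (negbTE x0) orbF subr_eq0 => /eqP.
Qed.

(** With [v = 0] the expansion of [d u] in a frame involves [u] only through its
    value at [m]. *)
Lemma symbol0_gl m (d : gauge E m) : is_symbol d 0 -> exists Psi, d = gl_gauge Psi.
Proof.
move=> d0; have [fr] := frame_exist m.
pose P (w : fiber E m) := \sum_j fr_coef fr j w *: ssval d (fr_vec fr j).
have Pl : linear P.
  move=> a w x; rewrite /P scaler_sumr -big_split/=; apply: eq_bigr => j _.
  by rewrite fr_coef_linear scalerDl scalerA.
exists (mksub (Hom (fiber E m) (fiber E m)) P Pl).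
apply: subspace_of_inj; apply/funext => u.
rewrite (gauge_expand u (nbhs_singleton (frame_cut_near fr)) d0).
rewrite -[RHS]/(P _) /P; apply: eq_bigr => j _.
by rewrite -[ssval 0 _]/(0 : R) scale0r addr0.
Qed.

Lemma symbol_comb m (a : R) (d r : gauge E m) v w :
  is_symbol d v -> is_symbol r w -> is_symbol (a *: d + r) (a *: v + w).
Proof.
move=> dv rw f u.
change (a *: ssval d (fsec f u) + ssval r (fsec f u) =
  ssval f m *: (a *: ssval d u + ssval r u) +
  (a * ssval v f + ssval w f) *: ssval u m).
by rewrite dv rw !scalerDr scalerDl !scalerA [ssval f m * a]mulrC addrACA.
Qed.

Lemma symbol_gl m Psi : is_symbol (@gl_gauge _ _ _ _ E m Psi) 0.
Proof.
move=> f u; rewrite -[ssval 0 f]/(0 : R) scale0r addr0.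
by rewrite /= (linear_atZ _ _ (ssvalP Psi)).
Qed.

(** The difference of [d] and [r] has zero symbol, so it lies in [gl(E)], where
    [nu] is determined by its value on the identity. *)
Lemma jet_symbol m (nu : jet E m) (d r : gauge E m) v :
  ssval nu (gl_gauge (id_gl E m)) = 0 -> is_symbol d v -> is_symbol r v ->
  ssval nu d = ssval nu r.
Proof.
move=> nu0 dv rv; have [nul nuP] := ssvalP nu.
have := symbol_comb (-1) rv dv.
have -> : -1 *: v + v = 0 by rewrite scaleN1r addNr.
move=> /symbol0_gl[Psi e].
have := nul (-1) r d; rewrite e nuP nu0 (linear_at0 (ssvalP Psi)).
by rewrite scaleN1r => /esym/eqP; rewrite addrC subr_eq0 => /eqP.
Qed.

Definition vscale f (X : vfield) : vfield :=
  mksub (bsmooth (tangent_bundle M)) (fun m => ssval f m *: ssval X m)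
    (fun g => smooth_onM openT (ssvalP f) (ssvalP (vact X g))).

(** A derivation with prescribed values [s] on the frame and prescribed symbol
    [v], by the formula of [gauge_expand]. With [s = 0] this is the covariant
    derivative along [v] of the flat connection attached to the frame. Away from
    [m0] the symbol is multiplied by the cut-off function of the frame. *)
Section FrameGauge.
Variables (m0 : M) (fr : frame m0).

Definition frame_op m (s : 'I_k -> fiber E m) (v : tangent m) u : fiber E m :=
  \sum_j (fr_coef fr j (ssval u m) *: s j +
          ssval v (coef_fun fr j u) *: ssval (fr_vec fr j) m).

Lemma frame_op_fsec m (s : 'I_k -> fiber E m) v f u :
  frame_op s v (fsec f u) =
  ssval f m *: frame_op s v u + ssval (ssval (fr_cut fr) m *: v) f *: ssval u m.
Proof.
rewrite /frame_op scaler_sumr.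
have -> : ssval (ssval (fr_cut fr) m *: v) f *: ssval u m =
    \sum_j (ssval v f * fr_coef fr j (ssval u m)) *: ssval (fr_vec fr j) m.
  rewrite -[ssval (_ *: v) f]/(ssval (fr_cut fr) m * ssval v f) mulrC -scalerA.
  by rewrite -frameP scaler_sumr; apply: eq_bigr => j _; rewrite scalerA.
rewrite -big_split/=; apply: eq_bigr => j _.
rewrite coef_fun_fsec (ssvalP v).2 (linear_atZ _ _ (fr_coef_linear _ _)).
by rewrite scalerDl scalerDr !scalerA addrA [ssval v f * _]mulrC.
Qed.

Lemma frame_op_linear m (s : 'I_k -> fiber E m) v : linear (frame_op s v).
Proof.
move=> a u w; rewrite /frame_op scaler_sumr -big_split/=; apply: eq_bigr => j _.
rewrite coef_fun_linear (ssvalP v).1.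
change (fr_coef fr j (a *: ssval u m + ssval w m) *: s j +
    (a * ssval v (coef_fun fr j u) + ssval v (coef_fun fr j w)) *:
      ssval (fr_vec fr j) m =
  a *: (fr_coef fr j (ssval u m) *: s j +
    ssval v (coef_fun fr j u) *: ssval (fr_vec fr j) m) +
  (fr_coef fr j (ssval w m) *: s j +
    ssval v (coef_fun fr j w) *: ssval (fr_vec fr j) m)).
by rewrite fr_coef_linear !scalerDl scalerDr !scalerA addrACA.
Qed.

Fact frame_op_covdiff m (s : 'I_k -> fiber E m) v : is_covdiff (frame_op s v).
Proof.
split; first exact: frame_op_linear.
by exists (ssval (fr_cut fr) m *: v) => f u; exact: frame_op_fsec.
Qed.

Definition frame_gauge m (s : 'I_k -> fiber E m) (v : tangent m) : gauge E m :=
  mksub (gauge E m) _ (frame_op_covdiff s v).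

Lemma frame_gauge_symbol m (s : 'I_k -> fiber E m) v :
  ssval (fr_cut fr) m = 1 -> is_symbol (frame_gauge s v) v.
Proof. by move=> cut1 f u; rewrite /= frame_op_fsec cut1 scale1r. Qed.

Fact frame_gauge_smooth (s : 'I_k -> sectionE) (X : vfield) :
  bsmooth (gauge_bundle E) (fun m => frame_gauge (fun j => ssval (s j) m) (ssval X m)).
Proof.
split=> [u|].
  pose w := \sum_j (fsec (coef_fun fr j u) (s j) +
    fsec (vact X (coef_fun fr j u)) (fr_vec fr j)).
  suff -> : (fun m => ssval (frame_gauge (fun j => ssval (s j) m) (ssval X m)) u) =
      ssval w by exact: ssvalP w.
  apply: functional_extensionality_dep => m; rewrite Gamma_sumE.
  by apply: eq_bigr => j _; rewrite Gamma_addE.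
by exists (vscale (fr_cut fr) X) => f u m; exact: frame_op_fsec.
Qed.

Definition frame_gauge_field s X : sectionD :=
  mksub (bsmooth (gauge_bundle E)) _ (frame_gauge_smooth s X).

End FrameGauge.

Lemma symbol_exist m (v : tangent m) : exists d : gauge E m, is_symbol d v.
Proof.
have [fr] := frame_exist m; exists (frame_gauge fr (fun=> 0) v).
apply: frame_gauge_symbol; exact: nbhs_singleton (fr_cut1 fr).
Qed.

Lemma tangent_extend m (v : tangent m) : exists X : vfield, ssval X m = v.
Proof.
have [co] := coordinates_exist m.
exists (\sum_i ssval v (co_fun co i) *: co_field co i).
rewrite Gamma_sumE; apply: subspace_of_inj; apply/funext => f.
rewrite (nbhs_singleton (coordinatesP co) v f) tangent_sumE.
by apply: eq_bigr => i _; rewrite Gamma_scaleE.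
Qed.

(** Both the derivation and its symbol extend, the derivation through its values
    on a frame. *)
Lemma gauge_extend m (d : gauge E m) : exists D : sectionD, ssval D m = d.
Proof.
have [fr] := frame_exist m; have [_ [v dv]] := ssvalP d.
have [X Xm] := tangent_extend v.
have [s sE] := choice (fun j => vector_extend (ssval d (fr_vec fr j))).
exists (frame_gauge_field fr s X); apply: subspace_of_inj; apply/funext => u.
rewrite (gauge_expand u (nbhs_singleton (frame_cut_near fr)) dv) /= /frame_op.
by apply: eq_bigr => j _; rewrite sE Xm.
Qed.

(** In rank zero every tangent vector is a symbol; asking for zero there makes
    the choice unique, and therefore linear and smooth. *)
Lemma symb_exist m (d : gauge E m) :
  exists v, is_symbol d v /\ (k = 0%N -> v = 0).
Proof.
have [k0|k0] := posnP k; last first.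
  have [_ [v dv]] := ssvalP d; exists v; split=> // k0'.
  by move: k0; rewrite k0'.
by exists 0; split=> // f u; rewrite [LHS]fiber_trivial// [RHS]fiber_trivial.
Qed.

Definition symb m (d : gauge E m) : tangent m := projT1 (cid (symb_exist d)).

Lemma symbP m (d : gauge E m) : is_symbol d (symb d).
Proof. by rewrite /symb; case: cid => v []. Qed.

Lemma symb_rank0 m (d : gauge E m) : k = 0%N -> symb d = 0.
Proof. by rewrite /symb; case: cid => v []. Qed.

Lemma symb_eq m (d : gauge E m) v :
  is_symbol d v -> (k = 0%N -> v = 0) -> symb d = v.
Proof.
move=> dv v0; have [k0|k0] := posnP k; first by rewrite symb_rank0// v0.
exact: symbol_uniq (symbP d) dv.
Qed.

Lemma symb_linear m : linear (@symb m).
Proof.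
move=> a d r; apply: symb_eq; first exact: symbol_comb (symbP d) (symbP r).
by move=> k0; rewrite !symb_rank0// scaler0 addr0.
Qed.

Lemma symb_gl m Psi : symb (@gl_gauge _ _ _ _ E m Psi) = 0.
Proof. by apply: symb_eq => //; exact: symbol_gl. Qed.

Fact symb_smooth (D : sectionD) :
  bsmooth (tangent_bundle M) (fun m => symb (ssval D m)).
Proof.
have [k0|k0] := posnP k.
  suff -> : (fun m => symb (ssval D m)) = 0 :> dsec (tangent_bundle M).
    exact: subspace0.
  by apply: functional_extensionality_dep => m; rewrite symb_rank0.
have [_ [X DX]] := ssvalP D.
suff -> : (fun m => symb (ssval D m)) = ssval X by exact: ssvalP X.
apply: functional_extensionality_dep => m; apply: symb_eq => [f u|k0'].
  exact: DX.
by move: k0; rewrite k0'.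
Qed.

Definition symb_field (D : sectionD) : vfield :=
  mksub (bsmooth (tangent_bundle M)) _ (symb_smooth D).

Lemma symb_field_act (D : sectionD) f u :
  gauge_act D (fsec f u) = fsec f (gauge_act D u) + fsec (vact (symb_field D) f) u.
Proof. by apply: Gamma_ext => m; rewrite Gamma_addE; exact: symbP. Qed.

Lemma symb_comm (D D' : sectionD) :
  symb_field (gauge_comm D D') = vbracket (symb_field D) (symb_field D').
Proof.
apply: Gamma_ext => m; apply: symb_eq.
  move=> f u; apply: commD_at; exact: symb_field_act.
move=> k0; apply: subspace_of_inj; apply/funext => f /=.
by rewrite !symb_rank0// -[LHS]/(0 - 0 : R) subrr.
Qed.

(** A section of [JE] that vanishes on the identity is induced by a section of
    [Hom(TM, E)]: by [jet_symbol] it factors through the symbol, and smoothness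
    follows because vector fields lift locally to smooth sections of [DE]. *)
Lemma jet_descends (J : sectionJ) :
  (forall m, ssval (ssval J m) (gl_gauge (id_gl E m)) = 0) ->
  exists eta : Gamma (homTE E), forall m (d : gauge E m) v, is_symbol d v ->
    ssval (ssval eta m) v = ssval (ssval J m) d.
Proof.
move=> J0; pose d m (v : tangent m) : gauge E m :=
  frame_gauge (inhabited_witness (frame_exist m)) (fun=> 0) v.
have ds m (v : tangent m) : is_symbol (d m v) v.
  apply: frame_gauge_symbol; exact: nbhs_singleton (fr_cut1 _).
have Jl m : linear (fun v => ssval (ssval J m) (d m v)).
  move=> a v w; rewrite -(ssvalP (ssval J m)).1; apply: jet_symbol (J0 m) (ds _ _) _.
  exact: symbol_comb.
pose e : dsec (fun m => Hom (tangent m) (fiber E m) : lmodType R) := fun m =>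
  mksub (Hom (tangent m) (fiber E m)) _ (Jl m).
have eP m (r : gauge E m) v : is_symbol r v -> ssval (e m) v = ssval (ssval J m) r.
  by move=> rv; exact: jet_symbol (J0 m) (ds _ _) rv.
have es : bsmooth (homTE E) e.
  move=> X; apply: smooth_section_loc => m; have [fr] := frame_exist m.
  exists (jet_act J (frame_gauge_field fr (fun=> 0) X)).
  apply: filterS (fr_cut1 fr) => p cut1; apply: eP; exact: frame_gauge_symbol.
by exists (mksub (bsmooth (homTE E)) e es).
Qed.

End BundleCalculus.

(** * The differential of a one-form with values in E *)

Section HomForm.
Variables (R : realType) (n : nat) (M : manifold R n).
Variables (k : nat) (E : vector_bundle M k).
Local Notation smooth_fun := (smooth_fun M).
Local Notation vfield := (Gamma (tangent_bundle M)).
Local Notation sectionE := (Gamma (vbundle E)).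
Local Notation sectionD := (Gamma (gauge_bundle E)).
Local Notation sectionJ := (Gamma (jet_bundle E)).
Implicit Types (m p : M) (f g : smooth_fun) (u : sectionE).
Variable eta : Gamma (homTE E).

Definition hom_app (X : vfield) : sectionE :=
  mksub (bsmooth (vbundle E)) (fun m => ssval (ssval eta m) (ssval X m)) (ssvalP eta X).

Definition hom_symb (D : sectionD) : sectionE := hom_app (symb_field D).

Lemma hom_linear m : linear (ssval (ssval eta m)).
Proof. exact: ssvalP (ssval eta m). Qed.

Lemma hom_coordinates m (x : 'I_n -> smooth_fun) (dx : 'I_n -> vfield) (v : tangent m) :
  (forall f, ssval v f = \sum_i ssval v (x i) * ssval (ssval (dx i) m) f) ->
  ssval (ssval eta m) v = \sum_i ssval v (x i) *: ssval (hom_app (dx i)) m.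
Proof.
move=> vE; rewrite -(linear_at_sum _ _ _ (@hom_linear m)); congr (ssval _ _).
apply: subspace_of_inj; apply/funext => f; rewrite vE tangent_sumE.
by apply: eq_bigr.
Qed.

Definition coords m : coordinates m := inhabited_witness (coordinates_exist m).

Lemma coordsP m (v : tangent m) f :
  ssval v f = \sum_i ssval v (co_fun (coords m) i) *
    ssval (ssval (co_field (coords m) i) m) f.
Proof. exact: (nbhs_singleton (coordinatesP (coords m))). Qed.

(** The differential of the [E]-valued one-form [eta \o symb] on [DE], as a
    pointwise bilinear form: [d] and [r] are extended with symbols that have
    constant components in the chosen coordinates, so that the bracket term
    drops out. *)
Definition hom_form m (d r : gauge E m) : fiber E m :=
  \sum_i (ssval (symb r) (co_fun (coords m) i) *:
            ssval d (hom_app (co_field (coords m) i)) -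
          ssval (symb d) (co_fun (coords m) i) *:
            ssval r (hom_app (co_field (coords m) i))).

Lemma hom_formC m (d r : gauge E m) : hom_form r d = - hom_form d r.
Proof. by rewrite /hom_form -sumrN; apply: eq_bigr => i _; rewrite opprB. Qed.

Lemma hom_form_linearr m (d : gauge E m) : linear (hom_form d).
Proof.
move=> a r r'; rewrite /hom_form scaler_sumr -big_split/=; apply: eq_bigr => i _.
set x := co_fun _ i; set s := hom_app _; rewrite symb_linear.
change ((a * ssval (symb r) x + ssval (symb r') x) *: ssval d s -
    ssval (symb d) x *: (a *: ssval r s + ssval r' s) =
  a *: (ssval (symb r) x *: ssval d s - ssval (symb d) x *: ssval r s) +
  (ssval (symb r') x *: ssval d s - ssval (symb d) x *: ssval r' s)).
rewrite scalerDl scalerDr !scalerBr opprD !scalerA [a * ssval (symb d) x]mulrC.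
by rewrite addrACA.
Qed.

Lemma hom_form_linearl m (r : gauge E m) : linear (fun d : gauge E m => hom_form d r).
Proof.
move=> a d d'; rewrite hom_formC hom_form_linearr opprD -scalerN.
by rewrite -!hom_formC.
Qed.

Lemma hom_form_gl m (d : gauge E m) Psi :
  hom_form d (gl_gauge Psi) = - ssval Psi (ssval (ssval eta m) (symb d)).
Proof.
rewrite (hom_coordinates (coordsP (symb d))) (linear_at_sum _ _ _ (ssvalP Psi)).
rewrite /hom_form -sumrN; apply: eq_bigr => i _.
by rewrite symb_gl -[ssval 0 _]/(0 : R) scale0r add0r.
Qed.

(** Cartan's formula: near [m] a vector field [Y] is the combination of the
    coordinate fields with coefficients [Y x_i], and the derivatives of these
    coefficients cancel against the bracket term. *)
Lemma hom_formE (D D' : sectionD) m :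
  hom_form (ssval D m) (ssval D' m) =
  ssval (gauge_act D (hom_symb D') - gauge_act D' (hom_symb D) -
         hom_symb (gauge_comm D D')) m.
Proof.
set x := co_fun (coords m); set dx := co_field (coords m).
pose X := symb_field D; pose Y := symb_field D'.
have hE (Z : vfield) : \forall p \near m,
    ssval (hom_app Z) p = ssval (\sum_i fsec (vact Z (x i)) (hom_app (dx i))) p.
  apply: filterS (coordinatesP (coords m)) => p co; rewrite Gamma_sumE.
  exact: hom_coordinates.
have aE (C : sectionD) (Z : vfield) : ssval (gauge_act C (hom_app Z)) m =
    \sum_i (ssval (ssval Z m) (x i) *: ssval (ssval C m) (hom_app (dx i)) +
            ssval (ssval (symb_field C) m) (vact Z (x i)) *:
              ssval (hom_app (dx i)) m).
  rewrite /= (gauge_near_eq _ (hE Z)) gauge_sum; apply: eq_bigr => i _.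
  exact: symbP.
rewrite !Gamma_addE !Gamma_oppE /hom_symb symb_comm -/X -/Y !aE.
have -> : ssval (hom_app (vbracket X Y)) m =
    \sum_i ssval (ssval (vbracket X Y) m) (x i) *: ssval (hom_app (dx i)) m.
  exact: hom_coordinates (coordsP _).
rewrite -!sumrB.
apply: eq_bigr => i _; rewrite -/x -/dx.
set s := hom_app (dx i).
change (ssval (symb (ssval D' m)) (x i) *: ssval (ssval D m) s -
    ssval (symb (ssval D m)) (x i) *: ssval (ssval D' m) s =
  ssval (ssval Y m) (x i) *: ssval (ssval D m) s +
    ssval (ssval X m) (vact Y (x i)) *: ssval s m -
  (ssval (ssval X m) (x i) *: ssval (ssval D' m) s +
    ssval (ssval Y m) (vact X (x i)) *: ssval s m) -
  (ssval (ssval X m) (vact Y (x i)) - ssval (ssval Y m) (vact X (x i))) *: ssval s m).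
rewrite scalerBl opprB opprD.
set a := _ *: ssval (ssval D m) s; set b := _ *: ssval (ssval D' m) s.
set p := _ *: ssval s m; set q := _ *: ssval s m.
rewrite [a + p + _]addrACA -[RHS]addrA.
have -> : p - q + (q - p) = 0 by rewrite -[q - p]opprB subrr.
by rewrite addr0.
Qed.

Fact hom_form_jet m (d : gauge E m) : is_jet (hom_form d).
Proof.
split; first exact: hom_form_linearr.
move=> Psi; rewrite !hom_form_gl.
have PN w : ssval Psi (- w) = - ssval Psi w.
  by rewrite -scaleN1r (linear_atZ _ _ (ssvalP Psi)) scaleN1r.
by rewrite PN.
Qed.

Definition hom_jet m (d : gauge E m) : jet E m := mksub (jet E m) _ (hom_form_jet d).

Lemma hom_jet_linear m : linear (@hom_jet m).
Proof.
move=> a d d'; apply: subspace_of_inj; apply/funext => r.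
exact: hom_form_linearl.
Qed.

Lemma hom_jet_smooth (D : dsec (gauge_bundle E)) : bsmooth (gauge_bundle E) D ->
  bsmooth (jet_bundle E) (fun m => hom_jet (D m)).
Proof.
move=> Ds; pose DD : sectionD := mksub (bsmooth (gauge_bundle E)) D Ds.
move=> D'; pose w := gauge_act DD (hom_symb D') - gauge_act D' (hom_symb DD) -
         hom_symb (gauge_comm DD D').
suff -> : (fun m => ssval (hom_jet (D m)) (ssval D' m)) = ssval w.
  exact: ssvalP w.
by apply: functional_extensionality_dep => m; exact: (hom_formE DD D').
Qed.

Definition hom_jet_field (D : sectionD) : sectionJ :=
  mksub (bsmooth (jet_bundle E)) _ (hom_jet_smooth (ssvalP D)).

Lemma hom_jet_fieldE D D' : jet_act (hom_jet_field D) D' =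
  gauge_act D (hom_symb D') - gauge_act D' (hom_symb D) - hom_symb (gauge_comm D D').
Proof. by apply: Gamma_ext => m; exact: hom_formE. Qed.

End HomForm.

(** * Lifting automorphisms of E *)

Section Lift.
Variables (R : realType) (n : nat) (M : manifold R n).
Variables (k : nat) (E : vector_bundle M k).
Local Notation smooth_fun := (smooth_fun M).
Local Notation vfield := (Gamma (tangent_bundle M)).
Local Notation sectionE := (Gamma (vbundle E)).
Local Notation sectionD := (Gamma (gauge_bundle E)).
Local Notation sectionJ := (Gamma (jet_bundle E)).
Implicit Types (m p : M) (f g : smooth_fun) (u : sectionE).
Implicit Types (Phi : aut E).

Lemma fatVK Phi m m' (e : fbase Phi m = m') (e' : fbase (Phi^-1)%g m' = m)
  (w : fiber E m') : fat e (fat e' w) = w.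
Proof. by apply: existT_snd_inj; rewrite !fat_tot fautVK. Qed.

Lemma fat_linE Phi m m' (e : fbase Phi m = m') a (v w : fiber E m) :
  fat e (a *: v + w) = a *: fat e v + fat e w.
Proof. exact: fat_linear. Qed.

Lemma act_sectionVK Phi u : act_section Phi (act_section Phi^-1%g u) = u.
Proof. by apply: subspace_of_inj; exact: pushVK. Qed.

Lemma act_sectionK Phi u : act_section Phi^-1%g (act_section Phi u) = u.
Proof. by apply: subspace_of_inj; exact: pushK. Qed.

Lemma act_sectionD Phi u w :
  act_section Phi (u + w) = act_section Phi u + act_section Phi w.
Proof. by rewrite -[u]scale1r act_section_linear !scale1r. Qed.

Lemma act_sectionB Phi u w :
  act_section Phi (u - w) = act_section Phi u - act_section Phi w.
Proof. by apply: (addIr (act_section Phi w)); rewrite -act_sectionD !subrK. Qed.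

Lemma act_section_at Phi u m m' (e : fbase Phi m = m') :
  ssval (act_section Phi u) m' = fat e (ssval u m).
Proof. exact: push_at. Qed.

Lemma AdVK Phi m m' (e : fbase Phi m = m') (e' : fbase (Phi^-1)%g m' = m)
  (d : gauge E m') : Ad e (Ad e' d) = d.
Proof.
apply: subspace_of_inj; apply/funext => u /=; rewrite fatVK.
by congr (ssval d _); apply: subspace_of_inj; rewrite /= invgK pushVK.
Qed.

Lemma Ad_linear Phi m m' (e : fbase Phi m = m') : linear (@Ad _ _ _ _ E Phi m m' e).
Proof.
move=> a d r; apply: subspace_of_inj; apply/funext => u; exact: fat_linE.
Qed.

Lemma Ad_symbol Phi m m' (e : fbase Phi m = m') (d : gauge E m) v :
  is_symbol d v -> is_symbol (Ad e d) (tangent_map (aut_smooth Phi) e v).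
Proof.
move=> dv f u; rewrite /= act_section_fsec dv fat_linE.
rewrite (linear_atZ _ _ (fat_linear _)) act_sectionV; congr (_ *: _ + _ *: _).
  by rewrite -e.
by congr (ssval v _); exact: subspace_of_inj.
Qed.

Fact conj_gl_linear Phi m m' (e : fbase Phi m = m') (e' : fbase (Phi^-1)%g m' = m)
  (Psi : Hom (fiber E m) (fiber E m)) : linear (fun w => fat e (ssval Psi (fat e' w))).
Proof. by move=> a v w; rewrite fat_linE (ssvalP Psi) fat_linE. Qed.

Lemma Ad_gl Phi m m' (e : fbase Phi m = m') (e' : fbase (Phi^-1)%g m' = m) Psi :
  Ad e (gl_gauge Psi) = gl_gauge (mksub (Hom _ _) _ (conj_gl_linear e e' Psi)) :> gauge E m'.
Proof.
apply: subspace_of_inj; apply/funext => u /=.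
by congr (fat e (ssval Psi _)); exact: (act_section_at (Phi := Phi^-1%g)).
Qed.

Lemma Ad_id Phi m m' (e : fbase Phi m = m') :
  Ad e (gl_gauge (id_gl E m)) = gl_gauge (id_gl E m').
Proof.
by apply: subspace_of_inj; apply/funext => u /=; exact: act_sectionV.
Qed.

Fact jAd_jet Phi m m' (e : fbase Phi m = m') (e' : fbase (Phi^-1)%g m' = m)
  (nu : jet E m) : is_jet (fun d : gauge E m' => fat e (ssval nu (Ad e' d))).
Proof.
have [nul nuP] := ssvalP nu; split=> [a d r|Psi].
  by rewrite Ad_linear nul fat_linE.
have e'' : fbase (Phi^-1^-1)%g m = m' by rewrite invgK.
rewrite (Ad_gl e' e'') nuP Ad_id /=.
transitivity (fat e (fat e' (ssval Psi (fat e (ssval nu (gl_gauge (id_gl E m))))))).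
  congr (fat e (fat e' (ssval Psi _))).
  by apply: existT_snd_inj; rewrite !fat_tot.
by rewrite fatVK.
Qed.

(** The transpose of [Ad Phi^-1] for the [E]-valued pairing, composed with [Phi]
    on the values so that the pairing is preserved. *)
Definition jAd Phi m m' (e : fbase Phi m = m') (e' : fbase (Phi^-1)%g m' = m)
  (nu : jet E m) : jet E m' := mksub (jet E m') _ (jAd_jet e e' nu).

Lemma jAd_linear Phi m m' (e : fbase Phi m = m') (e' : fbase (Phi^-1)%g m' = m) :
  linear (@jAd Phi m m' e e').
Proof.
move=> a nu mu; apply: subspace_of_inj; apply/funext => d.
exact: (fat_linE e a (ssval nu (Ad e' d)) (ssval mu (Ad e' d))).
Qed.

Fact omni_lift_linear Phi m : linear (fun x : omni E m =>
  (Ad (erefl (fbase Phi m)) x.1, jAd (erefl _) (fbaseK Phi m) x.2) :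
    omni E (fbase Phi m)).
Proof.
by move=> a x y; congr (_, _); [exact: Ad_linear|exact: jAd_linear].
Qed.

Definition omni_lift_map Phi : fibmap (omni E) := Fibmap (@omni_lift_linear Phi).

Lemma fat_omni_lift Phi m m' (e : fbase (omni_lift_map Phi) m = m')
    (e1 : fbase Phi m = m') (e' : fbase (Phi^-1)%g m' = m) (x : omni E m) :
  fat e x = (Ad e1 x.1, jAd e1 e' x.2) :> omni E m'.
Proof.
rewrite (Prop_irrelevance e e1); move: e'; case: _ / e1 => e'.
by rewrite (Prop_irrelevance e' (fbaseK Phi m)).
Qed.

Lemma omni_lift_mapK Phi :
  cancel (ftot (omni_lift_map Phi)) (ftot (omni_lift_map Phi^-1%g)).
Proof.
case=> m x; pose e : fbase Phi m = fbase Phi m := erefl.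
pose e' : fbase (Phi^-1)%g (fbase Phi m) = m := fbaseK Phi m.
have e'' : fbase (Phi^-1^-1)%g m = fbase Phi m by rewrite invgK.
rewrite -(fat_tot (m' := m) (f := omni_lift_map Phi^-1%g) e').
congr existT; rewrite (fat_omni_lift e' e' e'').
case: x => d nu /=; congr (_, _); first exact: AdK.
apply: subspace_of_inj; apply/funext => r.
change (fat e' (fat e (ssval nu (Ad e' (Ad e'' r)))) = ssval nu r).
by rewrite (AdVK e' e'') (fatK (f := aut_val Phi)).
Qed.

Lemma omni_lift_mapVK Phi :
  cancel (ftot (omni_lift_map Phi^-1%g)) (ftot (omni_lift_map Phi)).
Proof. by move=> x; rewrite -{2}(@omni_lift_mapK Phi^-1%g x) invgK. Qed.

Definition omni_lift Phi : fibaut (omni E) :=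
  Fibaut (@omni_lift_mapK Phi) (@omni_lift_mapVK Phi).

Lemma omni_liftV Phi : (omni_lift Phi)^-1%g = omni_lift Phi^-1%g.
Proof. exact: fibaut_ext. Qed.

Definition Ad_section Phi (D : dsec (gauge_bundle E)) : dsec (gauge_bundle E) :=
  fun m => Ad (fbaseVK Phi m) (D (fbase (aut_val Phi)^-1%g m)).

Definition jAd_section Phi (nu : dsec (jet_bundle E)) : dsec (jet_bundle E) :=
  fun m => jAd (fbaseVK Phi m) (erefl : fbase (Phi^-1)%g m = _)
    (nu (fbase (aut_val Phi)^-1%g m)).

Lemma push_omni_lift Phi (X : dsec (omni E)) m : push (omni_lift Phi) X m =
  (Ad_section Phi (fun m => (X m).1) m, jAd_section Phi (fun m => (X m).2) m).
Proof. exact: fat_omni_lift. Qed.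

Lemma Ad_section_at Phi D m m' (e : fbase Phi m = m') :
  Ad_section Phi D m' = Ad e (D m).
Proof.
rewrite /Ad_section; have em : fbase (aut_val Phi)^-1%g m' = m by rewrite -e fbaseK.
by move: (fbaseVK Phi m'); case: _ / em (e) => e2 e1; rewrite (Prop_irrelevance e1 e2).
Qed.

Lemma Ad_section_smooth Phi D : bsmooth (gauge_bundle E) D ->
  bsmooth (gauge_bundle E) (Ad_section Phi D).
Proof.
move=> Ds; pose DD : sectionD := mksub (bsmooth (gauge_bundle E)) D Ds.
split=> [u|].
  exact: ssvalP (act_section Phi (gauge_act DD (act_section Phi^-1%g u))).
have [_ [X DX]] := Ds.
pose Y : dsec (tangent_bundle M) := fun m => tangent_map (aut_smooth Phi)
  (fbaseVK Phi m) (ssval X (fbase (aut_val Phi)^-1%g m)).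
have Ys : bsmooth (tangent_bundle M) Y.
  by move=> f; exact: smooth_map_cont_comp (aut_smoothV Phi)
    (ssvalP (vact X (sfcomp f (aut_smooth Phi)))).
exists (mksub (bsmooth (tangent_bundle M)) Y Ys) => f u m.
apply: Ad_symbol => g w; exact: DX.
Qed.

Definition Ad_field Phi (D : sectionD) : sectionD :=
  mksub (bsmooth (gauge_bundle E)) _ (Ad_section_smooth Phi (ssvalP D)).

Lemma gauge_act_Ad Phi D u :
  gauge_act (Ad_field Phi D) u =
  act_section Phi (gauge_act D (act_section Phi^-1%g u)).
Proof. exact: subspace_of_inj. Qed.

Lemma Ad_fieldVK Phi D : Ad_field Phi (Ad_field Phi^-1%g D) = D.
Proof.
apply: Gamma_ext => m.
have e : fbase (Phi^-1)%g m = fbase (aut_val Phi)^-1%g m by [].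
rewrite [LHS](Ad_section_at _ (fbaseVK Phi m)).
by rewrite [X in Ad _ X](Ad_section_at (ssval D) e) AdVK.
Qed.

Lemma Ad_fieldK Phi D : Ad_field Phi^-1%g (Ad_field Phi D) = D.
Proof. by rewrite -{2}(Ad_fieldVK Phi^-1%g D) invgK. Qed.

Lemma gauge_act_inj (D D' : sectionD) :
  (forall u, gauge_act D u = gauge_act D' u) -> D = D'.
Proof.
move=> DD; apply: Gamma_ext => m; apply: subspace_of_inj; apply/funext => u.
exact: (congr1 (fun s : sectionE => ssval s m) (DD u)).
Qed.

(** [Ad] is conjugation by [Phi] on operators, so it commutes with
    commutators. *)
Lemma Ad_comm Phi D D' :
  Ad_field Phi (gauge_comm D D') = gauge_comm (Ad_field Phi D) (Ad_field Phi D').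
Proof.
apply: gauge_act_inj => u; rewrite gauge_act_Ad !commE !gauge_act_Ad !act_sectionK.
by rewrite act_sectionB.
Qed.

Lemma jAd_section_smooth Phi nu : bsmooth (jet_bundle E) nu ->
  bsmooth (jet_bundle E) (jAd_section Phi nu).
Proof.
move=> ns D; pose NN : sectionJ := mksub (bsmooth (jet_bundle E)) nu ns.
have := ssvalP (act_section Phi (jet_act NN (Ad_field Phi^-1%g D))).
congr smooth_section; apply: functional_extensionality_dep => m /=.
rewrite /push; congr (fat _ (ssval _ _)).
exact: (Ad_section_at _ (erefl : fbase (Phi^-1)%g m = _)).
Qed.

Definition jAd_field Phi (nu : sectionJ) : sectionJ :=
  mksub (bsmooth (jet_bundle E)) _ (jAd_section_smooth Phi (ssvalP nu)).

Lemma jet_act_jAd Phi nu D : jet_act (jAd_field Phi nu) D =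
  act_section Phi (jet_act nu (Ad_field Phi^-1%g D)).
Proof.
apply: Gamma_ext => m /=; rewrite /push; congr (fat _ (ssval _ _)).
exact/esym/(Ad_section_at _ (erefl : fbase (Phi^-1)%g m = _)).
Qed.

Lemma lie_pair_Ad Phi D nu D' :
  lie_pair (Ad_field Phi D) (jAd_field Phi nu) D' =
  act_section Phi (lie_pair D nu (Ad_field Phi^-1%g D')).
Proof.
rewrite /lie_pair gauge_act_Ad !jet_act_jAd act_sectionK Ad_comm Ad_fieldK.
by rewrite act_sectionB.
Qed.

Lemma push_omni_lift_smooth Phi (X : dsec (omni E)) : bsmooth (omni E) X ->
  bsmooth (omni E) (push (omni_lift Phi) X).
Proof.
move=> [X1 X2].
have -> : push (omni_lift Phi) X = (fun m =>
  (Ad_section Phi (fun m => (X m).1) m, jAd_section Phi (fun m => (X m).2) m)).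
  by apply: functional_extensionality_dep => m; exact: push_omni_lift.
by split; [exact: Ad_section_smooth|exact: jAd_section_smooth].
Qed.

Lemma fat_pair Phi m m' (e : fbase Phi m = m') (v w : fiber E m) :
  fat e ((2%:R^-1 : R) *: (v + w)) = (2%:R^-1 : R) *: (fat e v + fat e w).
Proof.
rewrite (linear_atZ _ _ (fat_linear _)); congr (_ *: _).
by rewrite -[v]scale1r fat_linE !scale1r.
Qed.

(** All structures are transported along [Phi]; each bracket identity at
    [Ad_Phi D'] is the image under [Phi] of the one at [D']. *)
Lemma omni_lift_aut Phi : is_omni_aut (omni_lift Phi, Phi).
Proof.
split=> [//|X|m m' eF eP x y|X Y Z X' Y' Z' eX eY eZ|m m' eF eP x].
- split=> [|Xs]; first exact: push_omni_lift_smooth.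
  by rewrite -[X](pushK (omni_lift Phi)) omni_liftV; exact: push_omni_lift_smooth.
- have e' : fbase (Phi^-1)%g m' = m by rewrite -eP fbaseK.
  rewrite (fat_omni_lift eF eP e' x) (fat_omni_lift eF eP e' y) /omni_pair fat_pair.
  by rewrite /= !AdK.
- have fE (W W' : Gamma (omni E)) : ssval W' = push (omni_lift Phi) (ssval W) ->
      omni_fst W' = Ad_field Phi (omni_fst W) /\
      omni_snd W' = jAd_field Phi (omni_snd W).
    move=> eW; split; apply: Gamma_ext => m.
      by rewrite -[LHS]/(ssval W' m).1 eW push_omni_lift.
    by rewrite -[LHS]/(ssval W' m).2 eW push_omni_lift.
  have [fX sX] := fE _ _ eX; have [fY sY] := fE _ _ eY; have [fZ sZ] := fE _ _ eZ.
  rewrite /is_omni_bracket /= fX sX fY sY fZ sZ -Ad_comm.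
  have rE D' : lie_pair (Ad_field Phi (omni_fst X)) (jAd_field Phi (omni_snd Y)) D' -
      lie_pair (Ad_field Phi (omni_fst Y)) (jAd_field Phi (omni_snd X)) D' +
      gauge_act D' (jet_act (jAd_field Phi (omni_snd X)) (Ad_field Phi (omni_fst Y))) =
    act_section Phi (lie_pair (omni_fst X) (omni_snd Y) (Ad_field Phi^-1%g D') -
      lie_pair (omni_fst Y) (omni_snd X) (Ad_field Phi^-1%g D') +
      gauge_act (Ad_field Phi^-1%g D') (jet_act (omni_snd X) (omni_fst Y))).
    rewrite !lie_pair_Ad act_sectionD act_sectionB; congr (_ + _).
    by rewrite jet_act_jAd Ad_fieldK gauge_act_Ad invgK act_sectionVK.
  split=> -[h1 h2]; split.
  + by rewrite h1.
  + by move=> D'; rewrite rE jet_act_jAd h2.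
  + by rewrite -[LHS](Ad_fieldK Phi) h1 Ad_fieldK.
  + move=> D'; have := h2 (Ad_field Phi D'); rewrite rE jet_act_jAd Ad_fieldK.
    by move=> /(congr1 (act_section Phi^-1%g)); rewrite !act_sectionK.
- have e' : fbase (Phi^-1)%g m' = m by rewrite -eP fbaseK.
  by rewrite (fat_omni_lift eF eP e' x).
Qed.

End Lift.

(** * Shifts by a one-form *)

Section Shift.
Variables (R : realType) (n : nat) (M : manifold R n).
Variables (k : nat) (E : vector_bundle M k).
Local Notation smooth_fun := (smooth_fun M).
Local Notation vfield := (Gamma (tangent_bundle M)).
Local Notation sectionE := (Gamma (vbundle E)).
Local Notation sectionD := (Gamma (gauge_bundle E)).
Local Notation sectionJ := (Gamma (jet_bundle E)).
Implicit Types (m p : M) (f g : smooth_fun) (u : sectionE).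
Variable eta : Gamma (homTE E).

Fact omni_shift_linear m : linear (fun x : omni E m =>
  (x.1, hom_jet eta x.1 + x.2) : omni E m).
Proof.
move=> a x y; congr (_, _).
change (hom_jet eta (a *: x.1 + y.1) + (a *: x.2 + y.2) =
  a *: (hom_jet eta x.1 + x.2) + (hom_jet eta y.1 + y.2)).
by rewrite hom_jet_linear scalerDr addrACA.
Qed.

Fact omni_unshift_linear m : linear (fun x : omni E m =>
  (x.1, - hom_jet eta x.1 + x.2) : omni E m).
Proof.
move=> a x y; congr (_, _).
change (- hom_jet eta (a *: x.1 + y.1) + (a *: x.2 + y.2) =
  a *: (- hom_jet eta x.1 + x.2) + (- hom_jet eta y.1 + y.2)).
by rewrite hom_jet_linear opprD scalerDr scalerN addrACA.
Qed.

Definition omni_shift_map : fibmap (omni E) := Fibmap (fbase := id) omni_shift_linear.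
Definition omni_unshift_map : fibmap (omni E) :=
  Fibmap (fbase := id) omni_unshift_linear.

Fact omni_shiftK : cancel (ftot omni_shift_map) (ftot omni_unshift_map).
Proof.
case=> m [d nu]; congr existT; congr (_, _).
by rewrite /= addrA addNr add0r.
Qed.

Fact omni_unshiftK : cancel (ftot omni_unshift_map) (ftot omni_shift_map).
Proof.
case=> m [d nu]; congr existT; congr (_, _).
by rewrite /= addrA subrr add0r.
Qed.

Definition omni_shift : fibaut (omni E) := Fibaut omni_shiftK omni_unshiftK.

Lemma push_omni_shift X m :
  push omni_shift X m = ((X m).1, hom_jet eta (X m).1 + (X m).2).
Proof. by rewrite (push_at (f := omni_shift) X (erefl : fbase omni_shift m = m)). Qed.

Lemma jet_actD (mu nu : sectionJ) D : jet_act (mu + nu) D = jet_act mu D + jet_act nu D.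
Proof. by apply: Gamma_ext => m; rewrite Gamma_addE. Qed.

Lemma gauge_actD D (u w : sectionE) :
  gauge_act D (u + w) = gauge_act D u + gauge_act D w.
Proof. by rewrite -[u]scale1r gauge_act_linear !scale1r. Qed.

Lemma lie_pairD D (mu nu : sectionJ) D' :
  lie_pair D (mu + nu) D' = lie_pair D mu D' + lie_pair D nu D'.
Proof.
by rewrite /lie_pair !jet_actD opprD gauge_actD addrACA.
Qed.

Lemma gauge_actB D (u w : sectionE) :
  gauge_act D (u - w) = gauge_act D u - gauge_act D w.
Proof. by rewrite -scaleN1r addrC gauge_act_linear scaleN1r addrC. Qed.

(** Identities in abelian groups behind the Jacobi identity and the vanishing of
    the square of the differential. *)
Lemma zmod_jacobi (V : zmodType) (a b c d x y : V) :
  a - b - (c - d) = a - x - (y - d) - (b - y - (x - c)).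
Proof.
rewrite !opprB; transitivity (a - b + (d - c) + ((- x + x) + (- y + y))).
  by rewrite !addNr !addr0.
by rewrite [RHS](AC ((2*2)*(2*2)) ((1*8)*(3*6)*((2*5)*(4*7)))).
Qed.

Lemma zmod_telescope (V : zmodType) (p a r s b w : V) :
  p - a - r - (s - (a - b) - w) = p - (r + s) - b + w.
Proof.
rewrite !opprB !opprD.
transitivity (p + (- r - s) - b + w + (- a + a)); last by rewrite addNr addr0.
by rewrite [LHS](AC (3*(1*3)) ((1*(3*7)*6*4)*(2*5))).
Qed.

Lemma zmod_closed (V : zmodType) (p q r s a a' b b' u w c : V) :
  p - q - c - (u - w) = p - a - r - (s - (a - b) - w) -
    (q - a' - s - (r - (a' - b') - u)) + (b - b' - c).
Proof.
rewrite !zmod_telescope [s + r]addrC; move: (r + s) => t.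
rewrite !opprB !opprD !opprK.
transitivity (p - q - c + (w - u) + ((- t + t) + (- b + b) + (b' - b'))).
  by rewrite !addNr subrr !addr0.
by rewrite [RHS](AC ((4*4)*3) ((1*5*11*(4*8))*((2*6)*(3*9)*(7*10)))).
Qed.

Lemma gauge_comm_jacobi (D D' D'' : sectionD) :
  gauge_comm (gauge_comm D D') D'' =
  gauge_comm D (gauge_comm D' D'') - gauge_comm D' (gauge_comm D D'').
Proof.
apply: gauge_act_inj => u.
have aB (C C' : sectionD) : gauge_act (C - C') u = gauge_act C u - gauge_act C' u.
  apply: Gamma_ext => m; rewrite [RHS]Gamma_addE Gamma_oppE.
  change (ssval (ssval (C - C') m) u = ssval (ssval C m) u - ssval (ssval C' m) u).
  by rewrite Gamma_addE Gamma_oppE.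
rewrite aB !commE !gauge_actB; exact: zmod_jacobi.
Qed.

Lemma hom_symbB (D D' : sectionD) :
  hom_symb eta (D - D') = hom_symb eta D - hom_symb eta D'.
Proof.
apply: Gamma_ext => m; rewrite Gamma_addE Gamma_oppE.
have h := hom_linear eta (m := m) (-1) (symb (ssval D' m)) (symb (ssval D m)).
rewrite -symb_linear !scaleN1r in h; rewrite [RHS]addrC -h.
change (ssval (ssval eta m) (symb (ssval (D - D') m)) =
  ssval (ssval eta m) (symb (- ssval D' m + ssval D m))).
by rewrite Gamma_addE Gamma_oppE addrC.
Qed.

(** The form [hom_form eta] is closed, being the differential of [eta o symb]:
    after expansion by Cartan's formula this is the Jacobi identity. *)
Lemma hom_jet_closed (D D' C : sectionD) :
  jet_act (hom_jet_field eta (gauge_comm D D')) C =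
  lie_pair D (hom_jet_field eta D') C - lie_pair D' (hom_jet_field eta D) C +
  gauge_act C (jet_act (hom_jet_field eta D) D').
Proof.
rewrite /lie_pair !hom_jet_fieldE gauge_comm_jacobi hom_symbB !gauge_actB !commE.
exact: zmod_closed.
Qed.

(** The pairing is preserved because [hom_form eta] is skew-symmetric; the
    contributions of [hom_form eta] to the two sides of a bracket identity agree
    by [hom_jet_closed]. *)
Lemma omni_shift_aut : is_omni_aut (omni_shift, 1%g : aut E).
Proof.
split=> [//|X|m m' eF eP x y|X Y Z X' Y' Z' eX eY eZ|m m' eF eP x].
- have -> : push omni_shift X = (fun m => ((X m).1, hom_jet eta (X m).1 + (X m).2)).
    by apply: functional_extensionality_dep => m; exact: push_omni_shift.
  split=> -[X1 X2]; split=> //.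
    exact: (@subspaceD _ _ (bsmooth (jet_bundle E)) _ _ (hom_jet_smooth eta X1) X2).
  have := @subspaceB _ _ (bsmooth (jet_bundle E)) _ _ X2 (hom_jet_smooth eta X1).
  congr smooth_jet; apply: functional_extensionality_dep => m.
  by rewrite -[LHS]/(hom_jet eta (X m).1 + (X m).2 - hom_jet eta (X m).1) addrAC subrr add0r.
- rewrite (Prop_irrelevance eP eF); case: _ / eF {eP}.
  rewrite /omni_pair /=; congr (_ *: _).
  change (hom_form eta y.1 x.1 + ssval y.2 x.1 +
    (hom_form eta x.1 y.1 + ssval x.2 y.1) = ssval y.2 x.1 + ssval x.2 y.1).
  by rewrite addrACA hom_formC addNr add0r.
- have fE (W W' : Gamma (omni E)) : ssval W' = push omni_shift (ssval W) ->
      omni_fst W' = omni_fst W /\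
      omni_snd W' = hom_jet_field eta (omni_fst W) + omni_snd W.
    move=> eW; split; apply: Gamma_ext => m.
      by rewrite -[LHS]/(ssval W' m).1 eW push_omni_shift.
    by rewrite Gamma_addE -[LHS]/(ssval W' m).2 eW push_omni_shift.
  have [fX sX] := fE _ _ eX; have [fY sY] := fE _ _ eY; have [fZ sZ] := fE _ _ eZ.
  rewrite /is_omni_bracket /= fX sX fY sY fZ sZ.
  set D := omni_fst X; set D' := omni_fst Y.
  set mu := omni_snd X; set nu := omni_snd Y.
  have rE C : lie_pair D (hom_jet_field eta D' + nu) C -
      lie_pair D' (hom_jet_field eta D + mu) C +
      gauge_act C (jet_act (hom_jet_field eta D + mu) D') =
    jet_act (hom_jet_field eta (gauge_comm D D')) C +
      (lie_pair D nu C - lie_pair D' mu C + gauge_act C (jet_act mu D')).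
    rewrite hom_jet_closed !lie_pairD jet_actD gauge_actD.
    by rewrite opprD [RHS]addrACA; congr (_ + _); exact: addrACA.
  split=> -[h1 h2]; split=> // C.
    by rewrite rE jet_actD h1 h2.
  by have := h2 C; rewrite rE jet_actD h1 => /addrI.
- rewrite (Prop_irrelevance eP eF); case: _ / eF {eP}.
  by apply: subspace_of_inj; apply/funext => u; rewrite Ad1.
Qed.

End Shift.

(** * The one-form of an automorphism *)

Section OmniAutomorphisms.
Variables (R : realType) (n : nat) (M : manifold R n).
Variables (k : nat) (E : vector_bundle M k).
Local Notation smooth_fun := (smooth_fun M).
Local Notation vfield := (Gamma (tangent_bundle M)).
Local Notation sectionE := (Gamma (vbundle E)).
Local Notation sectionD := (Gamma (gauge_bundle E)).
Local Notation sectionJ := (Gamma (jet_bundle E)).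
Implicit Types (m p : M) (f g : smooth_fun) (u : sectionE).

Fact id_field_smooth : bsmooth (gauge_bundle E) (fun m => gl_gauge (id_gl E m)).
Proof.
split=> [u|]; first exact: ssvalP u.
by exists 0 => f u m; rewrite Gamma_zeroE; exact: symbol_gl.
Qed.

Definition id_field : sectionD := mksub (bsmooth (gauge_bundle E)) _ id_field_smooth.

Lemma gauge_act_id u : gauge_act id_field u = u.
Proof. exact: Gamma_ext. Qed.

Lemma gauge_comm_id (D : sectionD) : gauge_comm id_field D = 0.
Proof.
apply: gauge_act_inj => u; rewrite commE !gauge_act_id subrr.
apply: Gamma_ext => m; rewrite [LHS]Gamma_zeroE.
by change (0 = ssval (ssval (0 : sectionD) m) u); rewrite Gamma_zeroE.
Qed.

Lemma gauge_act0 (D : sectionD) : gauge_act D 0 = 0.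
Proof. by apply: (addrI (gauge_act D 0)); rewrite -gauge_actD !addr0. Qed.

Lemma jet_act0 D : jet_act (0 : sectionJ) D = 0.
Proof. by apply: (addrI (jet_act 0 D)); rewrite -jet_actD !addr0. Qed.

Lemma jet_actr0 (nu : sectionJ) : jet_act nu 0 = 0.
Proof.
apply: Gamma_ext => m; rewrite [RHS]Gamma_zeroE.
change (ssval (ssval nu m) (ssval (0 : sectionD) m) = 0); rewrite Gamma_zeroE.
exact: linear_at0 (ssvalP (ssval nu m)).1.
Qed.

Fact omni_of_gauge_smooth (D : sectionD) :
  bsmooth (omni E) (fun m => (ssval D m, 0)).
Proof. by split; [exact: ssvalP D|exact: subspace0 (bsmooth (jet_bundle E))]. Qed.

Definition omni_of_gauge (D : sectionD) : Gamma (omni E) :=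
  mksub (bsmooth (omni E)) _ (omni_of_gauge_smooth D).

Lemma omni_fst0 : omni_fst (0 : Gamma (omni E)) = 0.
Proof.
apply: Gamma_ext => m; rewrite [RHS]Gamma_zeroE.
by change ((ssval (0 : Gamma (omni E)) m).1 = 0); rewrite Gamma_zeroE.
Qed.

Lemma omni_snd0 : omni_snd (0 : Gamma (omni E)) = 0.
Proof.
apply: Gamma_ext => m; rewrite [RHS]Gamma_zeroE.
by change ((ssval (0 : Gamma (omni E)) m).2 = 0); rewrite Gamma_zeroE.
Qed.

Lemma omni_fst_of_gauge D : omni_fst (omni_of_gauge D) = D.
Proof. exact: Gamma_ext. Qed.

Lemma omni_snd_of_gauge D : omni_snd (omni_of_gauge D) = 0.
Proof. by apply: Gamma_ext => m; rewrite Gamma_zeroE. Qed.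

Variables (F : fibaut (omni E)) (Phi : aut E).
Hypothesis hF : is_omni_aut (F, Phi).

Definition omni_push (X : Gamma (omni E)) : Gamma (omni E) :=
  let: And5 _ hs _ _ _ := hF in
  mksub (bsmooth (omni E)) (push F (ssval X)) ((hs (ssval X)).1 (ssvalP X)).

Lemma omni_pushE X : ssval (omni_push X) = push F (ssval X).
Proof. by rewrite /omni_push; case: hF. Qed.

Lemma omni_aut_fst m m' (eF : fbase F m = m') (eP : fbase Phi m = m') x :
  (fat eF x).1 = Ad eP x.1.
Proof. by case: hF => _ _ _ _; exact. Qed.

Lemma omni_aut_base_eq m : fbase F m = fbase Phi m.
Proof. by case: hF. Qed.

(** On [JE] the map is forced by the pairing with the images of elements of
    [DE], whose [DE]-components are known. *)
Lemma omni_aut_jet m m' (eF : fbase F m = m') (eP : fbase Phi m = m')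
    (nu : jet E m) (d : gauge E m) :
  ssval (fat eF ((0, nu) : omni E m)).2 (Ad eP d) = fat eP (ssval nu d).
Proof.
have hp : omni_pair (fat eF ((0, nu) : omni E m)) (fat eF ((d, 0) : omni E m)) =
    fat eP (omni_pair ((0, nu) : omni E m) ((d, 0) : omni E m)).
  by case: hF => _ _ hp _ _; exact: hp.
have h2 : (2%:R^-1 : R) != 0 by rewrite invr_eq0 pnatr_eq0.
move: hp; rewrite /omni_pair fat_pair => /(scalerI h2).
rewrite !(omni_aut_fst eF eP) /=.
have -> : Ad eP (0 : gauge E m) = 0 by exact: linear_at0 (Ad_linear eP).
rewrite (linear_at0 (ssvalP (fat eF _).2).1) add0r => ->.
by change (fat eP 0 + fat eP (ssval nu d) = fat eP (ssval nu d));
  rewrite (linear_at0 (fat_linear _)) add0r.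
Qed.

(** Measures how far the map is from preserving [DE]; the image of the other
    sections of [DE] is expressed through it in [twist_bracket]. *)
Definition twist : sectionJ := omni_snd (omni_push (omni_of_gauge id_field)).

Lemma twistE m m' (eF : fbase F m = m') :
  ssval twist m' = (fat eF ((gl_gauge (id_gl E m), 0) : omni E m)).2.
Proof. by rewrite /twist /= omni_pushE (push_at (f := F) _ eF). Qed.

Lemma omni_fst_push_id : omni_fst (omni_push (omni_of_gauge id_field)) = id_field.
Proof.
apply: Gamma_ext => m' /=; rewrite omni_pushE.
pose m := fbase F^-1%g m'; have eF : fbase F m = m' by exact: fbaseVK.
have eP : fbase Phi m = m' by rewrite -omni_aut_base_eq.
by rewrite (push_at (f := F) _ eF) (omni_aut_fst eF eP) /= Ad_id.
Qed.

(** The identity element is isotropic, and so is its image. *)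
Lemma twist_id m' : ssval (ssval twist m') (gl_gauge (id_gl E m')) = 0.
Proof.
pose m := fbase F^-1%g m'; have eF : fbase F m = m' by exact: fbaseVK.
have eP : fbase Phi m = m' by rewrite -omni_aut_base_eq.
pose x : omni E m := (gl_gauge (id_gl E m), 0).
have hp : omni_pair (fat eF x) (fat eF x) = fat eP (omni_pair x x).
  by case: hF => _ _ hp _ _; exact: hp.
have h2 : (2%:R^-1 : R) != 0 by rewrite invr_eq0 pnatr_eq0.
move: hp; rewrite /omni_pair fat_pair => /(scalerI h2).
rewrite !(omni_aut_fst eF eP) /= Ad_id -(twistE eF).
set w := ssval _ _; move=> e; have {e} : w + w = fat eP 0 + fat eP 0 by [].
rewrite (linear_at0 (fat_linear _)) addr0 -mulr2n -scaler_nat => /eqP; rewrite scaler_eq0 pnatr_eq0 /=.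
by move=> /eqP.
Qed.

(** Apply the map to the identity [{Id, D} = 0]. Since [Id] commutes with
    sections of [DE] and acts on sections of [E] by the identity, the Lie
    derivative along [Id] in the image gives back the jet component of the image
    of [D]. *)
Lemma twist_bracket (D D' C : sectionD) :
  D' = omni_fst (omni_push (omni_of_gauge D)) ->
  jet_act (omni_snd (omni_push (omni_of_gauge D))) C =
  gauge_act D' (jet_act twist C) - jet_act twist (gauge_comm D' C) -
    gauge_act C (jet_act twist D').
Proof.
move=> D'E; pose X := omni_of_gauge id_field; pose Y := omni_of_gauge D.
have b0 : is_omni_bracket X Y 0.
  rewrite /is_omni_bracket /= omni_fst0 omni_snd0 !omni_fst_of_gauge.
  rewrite !omni_snd_of_gauge gauge_comm_id; split=> // B.
  by rewrite /lie_pair !jet_act0 !gauge_act0 !subrr addr0.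
have e0 : ssval (0 : Gamma (omni E)) = push F (ssval (0 : Gamma (omni E))).
  by rewrite ssval0; exact/esym/linear_at0/push_linear.
have [_] : is_omni_bracket (omni_push X) (omni_push Y) 0.
  case: hF => _ _ _ hb _.
  by apply: (hb X Y 0 _ _ 0 (omni_pushE X) (omni_pushE Y) e0).1.
move=> /(_ C); rewrite omni_fst_push_id -D'E -/twist.
rewrite omni_snd0 jet_act0 /lie_pair gauge_act_id gauge_comm_id jet_actr0 subr0 => /eqP.
rewrite eq_sym addr_eq0 subr_eq => /eqP ->.
by rewrite addrC.
Qed.

Lemma twist_hom_exist : exists eta : Gamma (homTE E),
  forall m (d : gauge E m) v, is_symbol d v ->
  ssval (ssval eta m) v = ssval (ssval twist m) d.
Proof. exact: jet_descends twist_id. Qed.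

End OmniAutomorphisms.

Section TwistGroup.
Variables (R : realType) (n : nat) (M : manifold R n).
Variables (k : nat) (E : vector_bundle M k).
Local Notation smooth_fun := (smooth_fun M).
Local Notation vfield := (Gamma (tangent_bundle M)).
Local Notation sectionE := (Gamma (vbundle E)).
Local Notation sectionD := (Gamma (gauge_bundle E)).
Local Notation sectionJ := (Gamma (jet_bundle E)).
Implicit Types (m p : M) (f g : smooth_fun) (u : sectionE).

Section TwistProduct.
Variables (F G : fibaut (omni E)) (Phi Psi : aut E).
Hypotheses (hF : is_omni_aut (F, Phi)) (hG : is_omni_aut (G, Psi))
  (hFG : is_omni_aut ((F * G)%g, (Phi * Psi)%g)).

(** The image of [Id] under [F * G] is [F (Id + twist hG)], and [F] acts on the
    second summand by [omni_aut_jet]. *)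
Lemma twist_mul m m' (e : fbase Phi m = m') (e' : fbase (Phi^-1)%g m' = m)
    (d : gauge E m') :
  ssval (ssval (twist hFG) m') d =
  ssval (ssval (twist hF) m') d + fat e (ssval (ssval (twist hG) m) (Ad e' d)).
Proof.
have eF : fbase F m = m' by rewrite (omni_aut_base_eq hF).
pose x : omni E m := push G (ssval (omni_of_gauge (id_field E))) m.
have xE : x = ((gl_gauge (id_gl E m), 0) : omni E m) + ((0, ssval (twist hG) m) : omni E m).
  have x1 : x.1 = gl_gauge (id_gl E m).
    have := congr1 (fun D : sectionD => ssval D m) (omni_fst_push_id hG).
    by rewrite /= omni_pushE.
  have x2 : x.2 = ssval (twist hG) m by rewrite /twist /= omni_pushE.
  case: x x1 x2 => x1 x2 /= -> ->; congr (_, _); first by rewrite addr0.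
  by rewrite add0r.
have -> : ssval (twist hFG) m' = (fat eF x).2.
  by rewrite {1}/twist /= omni_pushE pushM (push_at (f := F) _ eF).
have fD (y z : omni E m) : fat eF (y + z) = fat eF y + fat eF z.
  by have := fat_linear (f := F) eF 1 y z; rewrite !scale1r.
rewrite xE fD.
change (ssval (fat eF ((gl_gauge (id_gl E m), 0) : omni E m)).2 d +
  ssval (fat eF ((0, ssval (twist hG) m) : omni E m)).2 d =
  ssval (ssval (twist hF) m') d + fat e (ssval (ssval (twist hG) m) (Ad e' d))).
rewrite -(twistE hF eF); congr (_ + _).
by rewrite -(omni_aut_jet hF eF e) AdVK.
Qed.

End TwistProduct.

Definition twist_hom F Phi (hF : is_omni_aut (F, Phi)) : Gamma (homTE E) :=
  projT1 (cid (twist_hom_exist hF)).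

Lemma twist_homP F Phi (hF : is_omni_aut (F, Phi)) m (d : gauge E m) v :
  is_symbol d v ->
  ssval (ssval (twist_hom hF) m) v = ssval (ssval (twist hF) m) d.
Proof. by rewrite /twist_hom; case: cid => eta /=; exact. Qed.

(** As every tangent vector is a symbol, a one-form is known from its values on
    symbols. *)
Lemma hom_ext (eta theta : Gamma (homTE E)) :
  (forall m (d : gauge E m) v, is_symbol d v ->
    ssval (ssval eta m) v = ssval (ssval theta m) v) -> eta = theta.
Proof.
move=> et; apply: Gamma_ext => m; apply: subspace_of_inj; apply/funext => v.
by have [d dv] := symbol_exist E v; exact: et dv.
Qed.

Lemma twist_homM F G Phi Psi (hF : is_omni_aut (F, Phi))
    (hG : is_omni_aut (G, Psi)) (hFG : is_omni_aut ((F * G)%g, (Phi * Psi)%g)) :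
  twist_hom hFG = twist_hom hF + hom_act Phi (twist_hom hG).
Proof.
apply: hom_ext => m' d v dv; rewrite (twist_homP hFG dv) Gamma_addE.
pose e := fbaseVK Phi m'; pose e' : fbase (Phi^-1)%g m' = _ := erefl.
rewrite (twist_mul hF hG hFG e e').
have := twist_homP hG (Ad_symbol e' dv).
rewrite -(twist_homP hF dv) => <-.
congr (_ + fat _ (ssval _ _)); apply: subspace_of_inj; apply/funext => f.
by congr (ssval v _); exact: subspace_of_inj.
Qed.

(** By [twist_bracket] the one-form determines the images of the sections of
    [DE], and these fill the fibres by [gauge_extend]; on [JE] the map depends
    on [Phi] alone. *)
Lemma omni_aut_inj F G Phi (hF : is_omni_aut (F, Phi)) (hG : is_omni_aut (G, Phi)) :
  twist_hom hF = twist_hom hG -> F = G.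
Proof.
move=> hFG; have tFG : twist hF = twist hG.
  apply: Gamma_ext => m; apply: subspace_of_inj; apply/funext => d.
  by rewrite -(twist_homP hF (symbP d)) hFG (twist_homP hG (symbP d)).
have fstE D : omni_fst (omni_push hF (omni_of_gauge D)) =
    omni_fst (omni_push hG (omni_of_gauge D)).
  apply: Gamma_ext => m' /=; rewrite !omni_pushE.
  pose m := fbase (Phi^-1)%g m'; have eP : fbase Phi m = m' by exact: fbaseVK.
  have eF : fbase F m = m' by rewrite (omni_aut_base_eq hF).
  have eG : fbase G m = m' by rewrite (omni_aut_base_eq hG).
  rewrite (push_at (f := F) _ eF) (push_at (f := G) _ eG).
  by rewrite (omni_aut_fst hF eF eP) (omni_aut_fst hG eG eP).
have sndE D : omni_snd (omni_push hF (omni_of_gauge D)) =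
    omni_snd (omni_push hG (omni_of_gauge D)).
  have jE C : jet_act (omni_snd (omni_push hF (omni_of_gauge D))) C =
      jet_act (omni_snd (omni_push hG (omni_of_gauge D))) C.
    by rewrite (twist_bracket (hF := hF) C erefl) fstE (twist_bracket (hF := hG) C erefl) tFG.
  apply: Gamma_ext => m; apply: subspace_of_inj; apply/funext => c.
  have [C <-] := gauge_extend c.
  exact: (congr1 (fun s : sectionE => ssval s m) (jE C)).
apply: fibaut_ext => -[m [d nu]].
pose m' := fbase Phi m; have eP : fbase Phi m = m' by [].
have eF : fbase F m = m' by rewrite (omni_aut_base_eq hF).
have eG : fbase G m = m' by rewrite (omni_aut_base_eq hG).
rewrite -(fat_tot (f := F) eF) -(fat_tot (f := G) eG); congr existT.
have xE : ((d, nu) : omni E m) = ((d, 0) : omni E m) + ((0, nu) : omni E m).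
  by congr (_, _); rewrite ?addr0 ?add0r.
have fD (H : fibaut (omni E)) (e : fbase H m = m') (y z : omni E m) :
    fat e (y + z) = fat e y + fat e z.
  by have := fat_linear (f := H) e 1 y z; rewrite !scale1r.
have pairE (y z : omni E m') : y.1 = z.1 -> y.2 = z.2 -> y = z.
  by case: y z => [y1 y2] [z1 z2] /= -> ->.
apply: pairE; first by rewrite (omni_aut_fst hF eF eP) (omni_aut_fst hG eG eP).
rewrite xE !fD.
change ((fat eF ((d, 0) : omni E m)).2 + (fat eF ((0, nu) : omni E m)).2 =
  (fat eG ((d, 0) : omni E m)).2 + (fat eG ((0, nu) : omni E m)).2).
congr (_ + _).
  have [D <-] := gauge_extend d.
  have := congr1 (fun J : sectionJ => ssval J m') (sndE D).
  rewrite /= !omni_pushE (push_at (f := F) _ eF) (push_at (f := G) _ eG).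
  exact.
apply: subspace_of_inj; apply/funext => c.
have e' : fbase (Phi^-1)%g m' = m by exact: fbaseK.
by rewrite -(AdVK eP e' c) (omni_aut_jet hF) (omni_aut_jet hG).
Qed.

Lemma twist_hom_lift Phi (h : is_omni_aut (omni_lift Phi, Phi)) : twist_hom h = 0.
Proof.
apply: hom_ext => m' d v dv; rewrite (twist_homP h dv) Gamma_zeroE.
have eP : fbase Phi (fbase (aut_val Phi)^-1%g m') = m' by exact: fbaseVK.
rewrite (twistE h (eP : fbase (omni_lift Phi) _ = m')).
rewrite (fat_omni_lift _ eP erefl) /= (linear_at0 (fat_linear _)).
by [].
Qed.

Lemma twist_hom_shift eta (h : is_omni_aut (omni_shift eta, 1%g : aut E)) :
  twist_hom h = eta.
Proof.
apply: hom_ext => m d v dv; rewrite (twist_homP h dv).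
rewrite (twistE h (erefl : fbase (omni_shift eta) m = m)).
change (ssval (hom_jet eta (gl_gauge (id_gl E m)) + 0) d = ssval (ssval eta m) v).
rewrite addr0 /= hom_formC hom_form_gl opprK /=.
have [k0|k0] := posnP k; first by rewrite [LHS]fiber_trivial// [RHS]fiber_trivial.
by rewrite (symbol_uniq k0 (symbP d) dv).
Qed.

Lemma omni_autP (p : omni_aut E) :
  is_omni_aut ((omni_aut_val p).1, (omni_aut_val p).2).
Proof. by have /asboolP := omni_aut_subproof p. Qed.

Definition omni_aut_split (p : omni_aut E) : semidirect (hom_action E) :=
  Semidirect (hom_action E) (omni_aut_val p).2 (twist_hom (omni_autP p)).

Lemma omni_aut_splitM : {morph omni_aut_split : P Q / (P * Q)%g}.
Proof.
move=> P Q; exact: (congr1 (Semidirect (hom_action E) _)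
  (twist_homM (omni_autP P) (omni_autP Q) (omni_autP (P * Q)%g))).
Qed.

Lemma omni_aut_split_inj : injective omni_aut_split.
Proof.
move=> [[F Phi] hp] [[G Psi] hq] [] /= ePhi; move: hp hq; rewrite -{}ePhi => hp hq.
move=> /omni_aut_inj FG; apply: val_inj => /=; congr (_, _); exact: FG.
Qed.

Definition omni_aut_of F Phi (h : is_omni_aut (F, Phi)) : omni_aut E :=
  OmniAut (asboolT h : is_omni_aut_mem (F, Phi)).

(** The shift by [eta] composed with the lift of [Phi]. *)
Lemma omni_aut_split_surj (x : semidirect (hom_action E)) :
  exists P, omni_aut_split P = x.
Proof.
case: x => Phi eta.
pose P := omni_aut_of (omni_shift_aut eta); pose Q := omni_aut_of (omni_lift_aut Phi).
exists (P * Q)%g; rewrite omni_aut_splitM.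
rewrite /omni_aut_split twist_hom_shift twist_hom_lift.
by rewrite -[LHS]/(sd_mul _ _) /sd_mul /= mul1g hom_act1 addr0.
Qed.

End TwistGroup.

Theorem corollary4p5 (R : realType) (n k : nat) (M : manifold R n)
    (E : vector_bundle M k) :
  exists f : {multiplicative omni_aut E -> semidirect (hom_action E)}, bijective f.
Proof.
pose fM := isMultiplicative.Build _ _ (@omni_aut_split R n M k E)
  (@omni_aut_splitM R n M k E).
pose f : {multiplicative omni_aut E -> semidirect (hom_action E)} :=
  HB.pack (@omni_aut_split R n M k E) fM.
exists f.
have [g gK] := choice (@omni_aut_split_surj R n M k E).
exists g => x /=; last exact: gK.
by apply: (@omni_aut_split_inj R n M k E); exact: gK.
Qed.
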